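(* For every integer $k\geq 1$, the function $f_{2k}(z)=\int_{0}^{z}e^{-t^{2k}}\,dt$ belongs to $\mathrm{elh}(\mathbb{C})\setminus\mathrm{Aut}(\mathbb{C})$, satisfies $f_{2k}(\mathbb{C})=\mathbb{C}$, and is prime.
   Context: $\mathrm{elh}(\mathbb{C})$ is the set of all entire functions $f:\mathbb{C}\to\mathbb{C}$ with $f'(z)\neq 0$ for all $z\in\mathbb{C}$ and $f'(0)=1$. $\mathrm{Aut}(\mathbb{C})=\{z+a : a\in\mathbb{C}\}\subseteq\mathrm{elh}(\mathbb{C})$. A function $c\in\mathrm{elh}(\mathbb{C})$ is composite if there are entire functions $f,g$, neither of which is an affine map $z\mapsto \alpha z+\beta$ ($\alpha\in\mathbb{C}^\times$, $\beta\in\mathbb{C}$), such that $c=f\circ g$. The factors $f,g$ are not required to lie in $\mathrm{elh}(\mathbb{C})$. A function $p\in\mathrm{elh}(\mathbb{C})\setminus\mathrm{Aut}(\mathbb{C})$ is prime if it is not composite. *)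

(* Defs.v *)
From Stdlib Require Import Reals.
From Coquelicot Require Export Coquelicot.
Open Scope C_scope.

(* Coquelicot has no complex exponential: e^(x+iy) = e^x (cos y + i sin y). *)
Definition Cexp (z : C) : C :=
  ((exp (Re z) * cos (Im z))%R, (exp (Re z) * sin (Im z))%R).

(* [z : C] makes [ex_derive] differentiability over the field C. *)
Definition entire (f : C -> C) : Prop := forall z : C, ex_derive f z.

Definition elh (f : C -> C) : Prop :=
  entire f /\ (forall z : C, C_derive f z <> 0) /\ C_derive f 0 = 1.

(* The conformal automorphisms of the plane lying in [elh]: exactly the
   translations. *)
Definition AutC (f : C -> C) : Prop :=
  exists a : C, forall z : C, f z = z + a.

(* The slope is nonzero, so constant maps are not affine. *)
Definition affine (f : C -> C) : Prop :=
  exists alpha beta : C, alpha <> 0 /\ forall z : C, f z = alpha * z + beta.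

Definition composite (c : C -> C) : Prop :=
  elh c /\
  exists f g : C -> C,
    entire f /\ entire g /\ ~ affine f /\ ~ affine g /\
    forall z : C, c z = f (g z).

Definition prime (p : C -> C) : Prop :=
  elh p /\ ~ AutC p /\ ~ composite p.

(* The path integral of [h] from [a] to [b] along the segment
   s |-> a + s (b - a), 0 <= s <= 1; for entire [h] the choice of path is
   immaterial. The module is given explicitly because the canonical structure
   on [C] is a module over the complex field, whereas [RInt] needs one over R. *)
Definition CInt (h : C -> C) (a b : C) : C :=
  RInt (V := C_R_CompleteNormedModule)
    (fun s : R => h (a + RtoC s * (b - a)) * (b - a)) 0%R 1%R.

Definition f_ (n : nat) (z : C) : C := CInt (fun t : C => Cexp (- t ^ n)) 0 z.

(* Main.v *)
Require Import Defs.
From Stdlib Require Import Reals.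
From Coquelicot Require Import Coquelicot.
From Stdlib Require Import Lra Lia Classical ClassicalEpsilon.
Open Scope C_scope.

(* Write c = f_n with n = 2k, so c'(z) = exp (- z^n). For an entire F let T(F, t)
   be the integral of ln (1 + |F|^2) over the circle |z| = e^t.

   Growth. T is convex in t, and comparing Laplacians shows
   T(g, t) = O(1 + t + T(f o g, t)) for every nonconstant entire f: near a point
   where f' <> 0, the Laplacian of ln (1 + |f|^2) dominates the one of a smoothed
   logarithm (a cheap form of Polya's theorem on composition). If g' = exp h, the
   second derivative of T bounds the mean of (Re h)^+ along suitable radii by
   T(g, .), hence h by the Borel-Caratheodory inequality. So T(g, t) = O(e^(N t))
   makes h polynomially bounded, and T(g, t) = O(e^(t/2)) makes h constant.

   Surjectivity. If c omits w, then c - w = exp P with P of polynomial growth and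
   P' without zeros, so P' = exp h with h = - z^n - P constant; then P'(0) = 0.

   Primality. Let c = f o g, so g' = exp h. If f' vanishes at w0, then g omits w0,
   g = w0 + exp q, and as above q is affine; then c is periodic, which it is not.
   Otherwise f' = exp p and p o g = const - z^n - h has polynomial growth; unless p
   is constant, T(g, t) = O(e^(t/2)), so g' is constant. *)

(** The obstacle is that nothing is known about the growth of the outer factor: the growth of g has
    to be read off from that of f o g through an arbitrary entire f. The weight ln (1 + |F|^2) is
    smooth, and in the coordinate w = t + i s with z = e^w the function F o exp is entire and 2 pi
    i-periodic. The second s-derivative therefore integrates to 0 over a period, and the second
    t-derivative of T is the mean of a Laplacian. Pointwise inequalities between Laplacians thus
    become convexity statements in the single real variable t. The same coordinate turns circles
    into vertical segments, so Cauchy's theorem on rectangles yields the mean value and Cauchy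
    formulas on circles. The exponent 1/2 could be any number strictly between 0 and 1: it must
    absorb the O(1 + t) characteristic of a polynomially bounded function, and yet a function of
    size O(|z|^(1/2)) must be constant by Liouville. Each passage from polynomial growth to 1/2
    forgets the degree, which is why the argument always runs in two rounds. *)

Notation ccont := (continuous (T := C_UniformSpace) (U := C_UniformSpace)).
Notation pcont := (continuous (T := R_UniformSpace) (U := C_UniformSpace)).
Notation rcont := (continuous (T := C_UniformSpace) (U := R_UniformSpace)).
Notation jcont K w s := (continuous (T := prod_UniformSpace C_UniformSpace R_UniformSpace)
  (U := C_UniformSpace) (fun p => K (fst p) (snd p)) (w, s)).

Notation cder f z l := (is_derive (K := C_AbsRing) (V := C_NormedModule) f (z : C) (l : C)).
Notation pder f x l := (is_derive (K := R_AbsRing) (V := C_R_NormedModule) f (x : R) (l : C)).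
Definition CI (f : R -> C) (a b : R) : C := RInt (V := C_R_CompleteNormedModule) f a b.
Notation ex_CI := (ex_RInt (V := C_R_NormedModule)).
Notation is_CI := (is_RInt (V := C_R_NormedModule)).

(** * Complex and path derivatives, continuity *)

(** One epsilon form serves complex, path and real derivatives: [cder_eps], [pder_eps] and
    [is_derive_R_eps] are instances. It also lets facts pass between the different uniform
    structures on [C]. *)
Lemma is_derive_eps {K : AbsRing} {V : NormedModule K} (f : K -> V) (x : K) (l : V) :
  is_derive f x l <->
  (forall e : R, (0 < e)%R -> exists d : R, (0 < d)%R /\
     forall y : K, (norm (minus y x : AbsRing_NormedModule K) < d)%R ->
       (norm (minus (minus (f y) (f x)) (scal (minus y x) l)) <=
        e * norm (minus y x : AbsRing_NormedModule K))%R).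
Proof.
split.
- intros [_ H] e He.
  specialize (H x (fun P h => h) (mkposreal e He)).
  apply (locally_norm_le_locally (V := AbsRing_NormedModule K) x) in H.
  destruct H as [d Hd]. exists d. split; [apply cond_pos|]. exact Hd.
- intros H. split.
  + apply is_linear_scal_l.
  + intros y Hy. apply (is_filter_lim_locally_unique (V := AbsRing_NormedModule K)) in Hy. subst y.
    intros e. apply (locally_le_locally_norm (V := AbsRing_NormedModule K) x).
    destruct (H e (cond_pos e)) as [d [Hd H']].
    exists (mkposreal d Hd). exact H'.
Qed.

Lemma cder_eps (f : C -> C) (z l : C) :
  cder f z l <->
  (forall e : R, (0 < e)%R -> exists d : R, (0 < d)%R /\
     forall w : C, (Cmod (w - z) < d)%R ->
       (Cmod (f w - f z - (w - z) * l) <= e * Cmod (w - z))%R).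
Proof. exact (is_derive_eps f z l). Qed.

(* The two uniform structures of [C] (maximum norm and modulus) are not
   convertible; the product and chain rules of Coquelicot need the second. *)
Lemma cder_AbsRing (f : C -> C) (z l : C) :
  cder f z l <-> is_derive (V := AbsRing_NormedModule C_AbsRing) f z l.
Proof.
rewrite cder_eps. symmetry.
exact (is_derive_eps (V := AbsRing_NormedModule C_AbsRing) f z l).
Qed.

Lemma norm_C_R (z : C) : norm (z : C_R_NormedModule) = Cmod z.
Proof.
unfold norm; simpl. unfold prod_norm; simpl. unfold Cmod.
f_equal. unfold norm; simpl. unfold abs; simpl.
now rewrite !Rmult_1_r, <- !Rabs_mult, !Rabs_right by (apply Rle_ge, Rle_0_sqr).
Qed.

Lemma pder_eps (f : R -> C) (x : R) (l : C) :
  pder f x l <->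
  (forall e : R, (0 < e)%R -> exists d : R, (0 < d)%R /\
     forall y : R, (Rabs (y - x) < d)%R ->
       (Cmod (f y - f x - RtoC (y - x) * l) <= e * Rabs (y - x))%R).
Proof.
rewrite (is_derive_eps (V := C_R_NormedModule) f x l).
assert (E : forall y, norm (minus (minus (f y) (f x)) (scal (minus y x) l) : C_R_NormedModule)
   = Cmod (f y - f x - RtoC (y - x) * l)).
{ intros y. rewrite norm_C_R. f_equal.
  destruct (f y), (f x), l; apply injective_projections; simpl;
  unfold minus, plus, opp, scal; simpl; unfold mult; simpl; ring. }
split; intros H e He; destruct (H e He) as [d [Hd H']]; exists d; split; trivial;
intros y Hy; specialize (H' y Hy).
- exact (eq_ind _ (fun u => (u <= e * Rabs (y - x))%R) H' _ (E y)).
- exact (eq_ind_r (fun u => (u <= e * Rabs (y - x))%R) H' (E y)).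
Qed.

Lemma cder_const (c z : C) : cder (fun _ => c) z 0.
Proof. apply (is_derive_const (V := C_NormedModule)). Qed.

Lemma cder_id (z : C) : cder (fun w => w) z 1.
Proof. apply cder_AbsRing. apply (is_derive_id (K := C_AbsRing)). Qed.

Lemma cder_plus (f g : C -> C) (z a b : C) :
  cder f z a -> cder g z b -> cder (fun w => f w + g w) z (a + b).
Proof. apply (is_derive_plus (V := C_NormedModule)). Qed.

Lemma cder_minus (f g : C -> C) (z a b : C) :
  cder f z a -> cder g z b -> cder (fun w => f w - g w) z (a - b).
Proof. apply (is_derive_minus (V := C_NormedModule)). Qed.

Lemma cder_opp (f : C -> C) (z a : C) :
  cder f z a -> cder (fun w => - f w) z (- a).
Proof. apply (is_derive_opp (V := C_NormedModule)). Qed.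

Lemma cder_mult (f g : C -> C) (z a b : C) :
  cder f z a -> cder g z b -> cder (fun w => f w * g w) z (a * g z + f z * b).
Proof.
rewrite !cder_AbsRing. intros Hf Hg.
apply (is_derive_mult (K := C_AbsRing)); trivial. exact Cmult_comm.
Qed.

Lemma cder_comp (f g : C -> C) (z a b : C) :
  cder f (g z) a -> cder g z b -> cder (fun w => f (g w)) z (b * a).
Proof.
rewrite !cder_AbsRing. intros Hf Hg.
exact (is_derive_comp (V := AbsRing_NormedModule C_AbsRing) f g z a b Hf Hg).
Qed.

Lemma cder_ext (f g : C -> C) (z l : C) :
  (forall w, f w = g w) -> cder f z l -> cder g z l.
Proof. intros H. apply (is_derive_ext (V := C_NormedModule)). exact H. Qed.

Lemma cder_unique (f : C -> C) (z a b : C) : cder f z a -> cder f z b -> a = b.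
Proof. intros Ha Hb. now rewrite <- (is_C_derive_unique _ _ _ Ha), (is_C_derive_unique _ _ _ Hb). Qed.

Lemma cder_eq (f : C -> C) (z a b : C) : cder f z a -> a = b -> cder f z b.
Proof. now intros H <-. Qed.

Lemma cder_pow (f : C -> C) (n : nat) (z a : C) :
  cder f z a -> cder (fun w => f w ^ n) z (RtoC (INR n) * f z ^ (pred n) * a).
Proof.
intros H. induction n as [|n IH].
- apply (cder_eq _ _ 0); [exact (cder_const 1 z)|]. simpl. ring.
- apply (cder_eq _ _ _ _ (cder_mult _ _ _ _ _ H IH)).
  rewrite S_INR, RtoC_plus. destruct n; simpl; ring.
Qed.

Lemma cder_inv (z : C) : z <> 0 -> cder Cinv z (- / (z * z)).
Proof.
intros Hz. apply cder_eps. intros e He.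
assert (Hm := proj1 (Cmod_gt_0 z) Hz). set (m := Cmod z) in *.
(* The first bound keeps |w| above m / 2. The remainder (w - z)^2 / (w z^2) is then at most 2 |w -
   z|^2 / m^3, and the second bound brings this below e |w - z|. *)
set (d := Rmin (m / 2) (e * (m * m * m) / 2)).
assert (Hm3 : (0 < m * m * m)%R) by (repeat apply Rmult_lt_0_compat; lra).
assert (Hd : (0 < d)%R).
{ apply Rmin_pos; [lra|]. apply Rdiv_lt_0_compat; [|lra]. now apply Rmult_lt_0_compat. }
exists d. split; trivial. intros w Hw.
assert (H1 : (Cmod (w - z) < m / 2)%R) by (eapply Rlt_le_trans; [exact Hw|apply Rmin_l]).
assert (H2 : (Cmod (w - z) < e * (m * m * m) / 2)%R) by (eapply Rlt_le_trans; [exact Hw|apply Rmin_r]).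
assert (Hwm : (m / 2 < Cmod w)%R).
{ assert (T := Cmod_triangle w (z - w)). replace (w + (z - w)) with z in T by ring.
  rewrite <- (Cmod_opp (z - w)) in T. replace (- (z - w)) with (w - z) in T by ring.
  fold m in T. lra. }
assert (Hw0 : w <> 0) by (apply Cmod_gt_0; lra).
replace (/ w - / z - (w - z) * - / (z * z)) with ((w - z) * (w - z) * / (w * z * z)) by (field; auto).
rewrite !Cmod_mult, Cmod_inv, !Cmod_mult by (repeat apply Cmult_neq_0; auto).
fold m. set (x := Cmod (w - z)) in *.
assert (Hx : (0 <= x)%R) by apply Cmod_ge_0.
rewrite Rmult_assoc, (Rmult_comm e). apply Rmult_le_compat_l; trivial.
apply Rmult_le_reg_r with (Cmod w * m * m)%R; [repeat apply Rmult_lt_0_compat; lra|].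
rewrite Rmult_assoc, Rinv_l, Rmult_1_r by (apply Rgt_not_eq; repeat apply Rmult_lt_0_compat; lra).
apply Rle_trans with (e * (m * m * m) / 2)%R; [lra|].
replace (e * (m * m * m) / 2)%R with (e * m * m * (m / 2))%R by field.
replace (e * (Cmod w * m * m))%R with (e * m * m * Cmod w)%R by ring.
apply Rmult_le_compat_l; [repeat apply Rmult_le_pos|]; lra.
Qed.

Lemma pder_comp (f : C -> C) (g : R -> C) (s : R) (a b : C) :
  cder f (g s) a -> pder g s b -> pder (fun t => f (g t)) s (b * a).
Proof.
rewrite cder_eps, !pder_eps. intros Hf Hg e He.
assert (Ha := Cmod_ge_0 a). assert (Hb := Cmod_ge_0 b).
destruct (Hf (e / (2 * (Cmod b + 1)))%R) as [d1 [Hd1 H1]].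
{ apply Rdiv_lt_0_compat; lra. }
destruct (Hg 1%R Rlt_0_1) as [d2 [Hd2 H2]].
destruct (Hg (e / (2 * (Cmod a + 1)))%R) as [d3 [Hd3 H3]].
{ apply Rdiv_lt_0_compat; lra. }
exists (Rmin (Rmin d2 d3) (d1 / (Cmod b + 1))). split.
{ repeat apply Rmin_pos; trivial. apply Rdiv_lt_0_compat; lra. }
intros t Ht.
assert (T2 : (Rabs (t - s) < d2)%R).
{ eapply Rlt_le_trans; [exact Ht|]. eapply Rle_trans; apply Rmin_l. }
assert (T3 : (Rabs (t - s) < d3)%R).
{ eapply Rlt_le_trans; [exact Ht|]. eapply Rle_trans; [apply Rmin_l|apply Rmin_r]. }
assert (T1 : (Rabs (t - s) < d1 / (Cmod b + 1))%R).
{ eapply Rlt_le_trans; [exact Ht|apply Rmin_r]. }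
specialize (H2 t T2). specialize (H3 t T3).
assert (P := Rabs_pos (t - s)).
assert (L : (Cmod (g t - g s) <= (Cmod b + 1) * Rabs (t - s))%R).
{ assert (T := Cmod_triangle (g t - g s - RtoC (t - s) * b) (RtoC (t - s) * b)).
  rewrite Cmod_mult, Cmod_R in T.
  replace (g t - g s - RtoC (t - s) * b + RtoC (t - s) * b) with (g t - g s) in T by ring.
  lra. }
assert (L1 : (Cmod (g t - g s) < d1)%R).
{ eapply Rle_lt_trans; [exact L|]. rewrite Rmult_comm.
  apply Rmult_lt_reg_r with (/ (Cmod b + 1))%R; [apply Rinv_0_lt_compat; lra|].
  rewrite Rmult_assoc, Rinv_r, Rmult_1_r by lra. exact T1. }
specialize (H1 (g t) L1).
replace (f (g t) - f (g s) - RtoC (t - s) * (b * a)) with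
  ((f (g t) - f (g s) - (g t - g s) * a) + (g t - g s - RtoC (t - s) * b) * a) by ring.
eapply Rle_trans; [apply Cmod_triangle|]. rewrite Cmod_mult.
apply Rle_trans with (e / (2 * (Cmod b + 1)) * ((Cmod b + 1) * Rabs (t - s)) +
  e / (2 * (Cmod a + 1)) * Rabs (t - s) * (Cmod a + 1))%R.
- apply Rplus_le_compat.
  + eapply Rle_trans; [exact H1|]. apply Rmult_le_compat_l; trivial.
    apply Rlt_le, Rdiv_lt_0_compat; lra.
  + apply Rmult_le_compat; trivial; try apply Cmod_ge_0; lra.
- apply Req_le. field. lra.
Qed.

Lemma Cmod_le_Rabs (z : C) : (Cmod z <= Rabs (Re z) + Rabs (Im z))%R.
Proof.
destruct z as [x y]; simpl.
replace ((x, y) : C) with (RtoC x + RtoC y * Ci) by (apply injective_projections; simpl; ring).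
eapply Rle_trans; [apply Cmod_triangle|].
rewrite Cmod_mult, Cmod_Ci, !Cmod_R. lra.
Qed.

Lemma im_le_Cmod (z : C) : (Rabs (Im z) <= Cmod z)%R.
Proof. eapply Rle_trans; [apply Rmax_r|apply Rmax_Cmod]. Qed.

Lemma is_derive_R_eps (f : R -> R) (x l : R) :
  is_derive f x l <->
  (forall e : R, (0 < e)%R -> exists d : R, (0 < d)%R /\
     forall y : R, (Rabs (y - x) < d)%R ->
       (Rabs (f y - f x - (y - x) * l) <= e * Rabs (y - x))%R).
Proof. exact (is_derive_eps f x l). Qed.

Lemma pder_pair (f g : R -> R) (x a b : R) :
  is_derive f x a -> is_derive g x b -> pder (fun t => (f t, g t) : C) x (a, b).
Proof.
rewrite !is_derive_R_eps, pder_eps. intros Hf Hg e He.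
destruct (Hf (e / 2)%R ltac:(lra)) as [d1 [Hd1 H1]].
destruct (Hg (e / 2)%R ltac:(lra)) as [d2 [Hd2 H2]].
exists (Rmin d1 d2). split; [now apply Rmin_pos|]. intros y Hy.
specialize (H1 y (Rlt_le_trans _ _ _ Hy (Rmin_l _ _))).
specialize (H2 y (Rlt_le_trans _ _ _ Hy (Rmin_r _ _))).
eapply Rle_trans; [apply Cmod_le_Rabs|].
replace (Re ((f y, g y) - (f x, g x) - RtoC (y - x) * (a, b)))
  with (f y - f x - (y - x) * a)%R by (simpl; ring).
replace (Im ((f y, g y) - (f x, g x) - RtoC (y - x) * (a, b)))
  with (g y - g x - (y - x) * b)%R by (simpl; ring).
lra.
Qed.

Lemma pder_Re (f : R -> C) (x : R) (l : C) :
  pder f x l -> is_derive (fun t => Re (f t)) x (Re l).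
Proof.
rewrite is_derive_R_eps, pder_eps. intros H e He.
destruct (H e He) as [d [Hd H']]. exists d. split; trivial. intros y Hy.
eapply Rle_trans; [|exact (H' y Hy)].
eapply Rle_trans; [|apply re_le_Cmod]. apply Req_le. f_equal. unfold Re, Im. simpl. ring.
Qed.

Lemma pder_Im (f : R -> C) (x : R) (l : C) :
  pder f x l -> is_derive (fun t => Im (f t)) x (Im l).
Proof.
rewrite is_derive_R_eps, pder_eps. intros H e He.
destruct (H e He) as [d [Hd H']]. exists d. split; trivial. intros y Hy.
eapply Rle_trans; [|exact (H' y Hy)].
eapply Rle_trans; [|apply im_le_Cmod]. apply Req_le. f_equal. unfold Re, Im. simpl. ring.
Qed.

Section Cont.
Context {T : UniformSpace}.
Implicit Types f g : T -> C.

Lemma continuous_Cpair (f g : T -> R) (x : T) :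
  continuous f x -> continuous g x ->
  continuous (U := C_UniformSpace) (fun t => (f t, g t) : C) x.
Proof.
intros Hf Hg.
apply (filterlim_filter_le_2 (F := locally x) (G := filter_prod (locally (f x)) (locally (g x)))).
- intros P [e He]. exists (fun u => ball (f x) e u) (fun v => ball (g x) e v).
  + exists e; auto. + exists e; auto. + intros u v Hu Hv. apply He. split; trivial.
- now apply filterlim_pair.
Qed.

Lemma continuous_Re f x : continuous (U := C_UniformSpace) f x -> continuous (fun t => Re (f t)) x.
Proof.
intros Hf. apply (continuous_comp f fst); trivial.
destruct (f x). apply continuous_fst.
Qed.

Lemma continuous_Im f x : continuous (U := C_UniformSpace) f x -> continuous (fun t => Im (f t)) x.
Proof.
intros Hf. apply (continuous_comp f snd); trivial.
destruct (f x). apply continuous_snd.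
Qed.

Lemma continuous_C (f : T -> C) x : continuous (fun t => Re (f t)) x -> continuous (fun t => Im (f t)) x ->
  continuous (U := C_UniformSpace) f x.
Proof.
intros H1 H2. apply (continuous_ext (fun t => (Re (f t), Im (f t)) : C)).
- intros t. now destruct (f t).
- now apply continuous_Cpair.
Qed.

Lemma continuous_Cplus f g x :
  continuous (U := C_UniformSpace) f x -> continuous (U := C_UniformSpace) g x ->
  continuous (U := C_UniformSpace) (fun t => f t + g t) x.
Proof.
intros Hf Hg. apply continuous_C.
- apply (continuous_plus (fun t => Re (f t)) (fun t => Re (g t))); now apply continuous_Re.
- apply (continuous_plus (fun t => Im (f t)) (fun t => Im (g t))); now apply continuous_Im.
Qed.

Lemma continuous_Copp f x :
  continuous (U := C_UniformSpace) f x ->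
  continuous (U := C_UniformSpace) (fun t => - f t) x.
Proof.
intros Hf. apply continuous_C.
- apply (continuous_opp (fun t => Re (f t))); now apply continuous_Re.
- apply (continuous_opp (fun t => Im (f t))); now apply continuous_Im.
Qed.

Lemma continuous_Cminus f g x :
  continuous (U := C_UniformSpace) f x -> continuous (U := C_UniformSpace) g x ->
  continuous (U := C_UniformSpace) (fun t => f t - g t) x.
Proof. intros Hf Hg. apply continuous_Cplus; trivial. now apply continuous_Copp. Qed.

Lemma continuous_Cmult f g x :
  continuous (U := C_UniformSpace) f x -> continuous (U := C_UniformSpace) g x ->
  continuous (U := C_UniformSpace) (fun t => f t * g t) x.
Proof.
intros Hf Hg.
assert (Hf1 := continuous_Re _ _ Hf). assert (Hf2 := continuous_Im _ _ Hf).
assert (Hg1 := continuous_Re _ _ Hg). assert (Hg2 := continuous_Im _ _ Hg).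
apply continuous_C.
- apply (continuous_minus (fun t => Re (f t) * Re (g t))%R (fun t => Im (f t) * Im (g t))%R).
  + exact (continuous_mult (K := R_AbsRing) _ _ x Hf1 Hg1).
  + exact (continuous_mult (K := R_AbsRing) _ _ x Hf2 Hg2).
- apply (continuous_plus (fun t => Re (f t) * Im (g t))%R (fun t => Im (f t) * Re (g t))%R).
  + exact (continuous_mult (K := R_AbsRing) _ _ x Hf1 Hg2).
  + exact (continuous_mult (K := R_AbsRing) _ _ x Hf2 Hg1).
Qed.

Lemma continuous_RtoC (f : T -> R) x :
  continuous f x -> continuous (U := C_UniformSpace) (fun t => RtoC (f t)) x.
Proof. intros Hf. apply continuous_Cpair; trivial. apply continuous_const. Qed.
End Cont.

Lemma ball_C_Cmod (z w : C) (e : R) : ball (M := C_UniformSpace) z e w -> (Cmod (w - z) < 2 * e)%R.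
Proof.
intros [H1 H2].
eapply Rle_lt_trans; [apply Cmod_le_Rabs|].
change (Rabs (fst w - fst z) < e)%R in H1. change (Rabs (snd w - snd z) < e)%R in H2.
change (Rabs (fst w - fst z) + Rabs (snd w - snd z) < 2 * e)%R. lra.
Qed.

Lemma Cmod_ball_C (z w : C) (e : R) : (Cmod (w - z) < e)%R -> ball (M := C_UniformSpace) z e w.
Proof.
intros H. split.
- exact (Rle_lt_trans _ _ _ (re_le_Cmod (w - z)) H).
- exact (Rle_lt_trans _ _ _ (im_le_Cmod (w - z)) H).
Qed.

Lemma ccont_eps (f : C -> C) (z : C) :
  ccont f z <-> (forall e : R, (0 < e)%R -> exists d : R, (0 < d)%R /\
     forall w : C, (Cmod (w - z) < d)%R -> (Cmod (f w - f z) < e)%R).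
Proof.
split.
- intros H e He.
  destruct (proj1 (filterlim_locally f (f z)) H (mkposreal (e / 2) ltac:(lra))) as [d Hd].
  exists d. split; [apply cond_pos|]. intros w Hw.
  replace e with (2 * (e / 2))%R by field. apply ball_C_Cmod. now apply Hd, Cmod_ball_C.
- intros H. apply filterlim_locally. intros e.
  destruct (H e (cond_pos e)) as [d [Hd H']].
  exists (mkposreal (d / 2) ltac:(lra)). intros w Hw. apply Cmod_ball_C, H'.
  apply ball_C_Cmod in Hw. simpl in Hw. lra.
Qed.

Lemma cder_ccont (f : C -> C) (z l : C) : cder f z l -> ccont f z.
Proof.
rewrite cder_eps, ccont_eps. intros H e He.
destruct (H 1%R Rlt_0_1) as [d [Hd H']]. assert (Hl := Cmod_ge_0 l).
exists (Rmin d (e / (Cmod l + 1))). split.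
{ apply Rmin_pos; trivial. apply Rdiv_lt_0_compat; lra. }
intros w Hw. specialize (H' w (Rlt_le_trans _ _ _ Hw (Rmin_l _ _))).
assert (Hw2 := Rlt_le_trans _ _ _ Hw (Rmin_r _ _)).
assert (T := Cmod_triangle (f w - f z - (w - z) * l) ((w - z) * l)).
replace (f w - f z - (w - z) * l + (w - z) * l) with (f w - f z) in T by ring.
rewrite Cmod_mult in T.
apply Rle_lt_trans with (Cmod (w - z) * (Cmod l + 1))%R; [lra|].
apply Rmult_lt_reg_r with (/ (Cmod l + 1))%R; [apply Rinv_0_lt_compat; lra|].
rewrite Rmult_assoc, Rinv_r, Rmult_1_r by lra. exact Hw2.
Qed.

Lemma pder_pcont (f : R -> C) (x : R) (l : C) : pder f x l -> pcont f x.
Proof.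
intros H. apply (ex_derive_continuous (V := C_R_NormedModule)). now exists l.
Qed.

Lemma continuous_Cinv {T : UniformSpace} (f : T -> C) (x : T) :
  continuous (U := C_UniformSpace) f x -> f x <> 0 ->
  continuous (U := C_UniformSpace) (fun t => / f t) x.
Proof.
intros Hf H. apply (continuous_comp f Cinv); trivial.
eapply cder_ccont. now apply cder_inv.
Qed.

(** * The exponential; complex-valued integrals *)

Lemma Cexp_plus (z w : C) : Cexp (z + w) = Cexp z * Cexp w.
Proof.
destruct z as [a b], w as [c d]. unfold Cexp; simpl.
rewrite exp_plus, cos_plus, sin_plus. apply injective_projections; simpl; ring.
Qed.

Lemma Cexp_0 : Cexp 0 = 1.
Proof. unfold Cexp; simpl. rewrite exp_0, cos_0, sin_0. apply injective_projections; simpl; ring. Qed.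

Lemma Cexp_opp_l (z : C) : Cexp (- z) * Cexp z = 1.
Proof. rewrite <- Cexp_plus. replace (- z + z) with (RtoC 0) by ring. apply Cexp_0. Qed.

Lemma Cexp_neq_0 (z : C) : Cexp z <> 0.
Proof.
intros H. assert (E := Cexp_opp_l z). rewrite H, Cmult_0_r in E.
apply (f_equal fst) in E; simpl in E. lra.
Qed.

Lemma Cmod_Cexp (z : C) : Cmod (Cexp z) = exp (Re z).
Proof.
unfold Cmod, Cexp; simpl.
replace (exp (Re z) * cos (Im z) * (exp (Re z) * cos (Im z) * 1) +
 exp (Re z) * sin (Im z) * (exp (Re z) * sin (Im z) * 1))%R with
 (Rsqr (exp (Re z)) * (Rsqr (sin (Im z)) + Rsqr (cos (Im z))))%R by (unfold Rsqr; ring).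
rewrite sin2_cos2, Rmult_1_r. apply sqrt_Rsqr, Rlt_le, exp_pos.
Qed.

Lemma Cexp_surj (z : C) : z <> 0 -> exists w, Cexp w = z.
Proof.
intros Hz. assert (Hm := proj1 (Cmod_gt_0 z) Hz).
destruct z as [x y]. set (m := Cmod (x, y)) in *.
assert (Hsq : (m * m = x * x + y * y)%R).
{ unfold m, Cmod; simpl. rewrite sqrt_sqrt; [ring|]. nra. }
assert (Hx : (-1 <= x / m <= 1)%R).
{ split; [apply Rmult_le_reg_r with m|apply Rmult_le_reg_r with m]; trivial;
  unfold Rdiv; rewrite Rmult_assoc, Rinv_l by lra; nra. }
assert (Hc := cos_acos _ Hx). assert (Hs := sin_acos _ Hx).
assert (Hs' : (m * sin (acos (x / m)) = Rabs y)%R).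
{ rewrite Hs. rewrite <- (sqrt_Rsqr m) at 1 by lra. rewrite <- sqrt_mult_alt by apply Rle_0_sqr.
  rewrite <- sqrt_Rsqr_abs. f_equal. unfold Rsqr.
  replace (m * m * (1 - x / m * (x / m)))%R with (m * m - x * x)%R by (field; lra). lra. }
assert (Hc' : (m * cos (acos (x / m)) = x)%R) by (rewrite Hc; field; lra).
(* [acos] yields an argument in [0, PI], where the sine is nonnegative; the lower half plane takes
   the opposite argument. *)
destruct (Rle_lt_dec 0 y) as [Hy|Hy].
- exists (ln m, acos (x / m)). unfold Cexp; simpl. rewrite exp_ln by trivial.
  rewrite Hc', Hs', Rabs_pos_eq by trivial. reflexivity.
- exists (ln m, - acos (x / m))%R. unfold Cexp; simpl. rewrite exp_ln by trivial.
  rewrite cos_neg, sin_neg, Hc', Ropp_mult_distr_r_reverse, Hs', Rabs_left by trivial.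
  now rewrite Ropp_involutive.
Qed.

(** The functional equation moves the question to the point 0, where the derivatives of the real
    [exp], [cos] and [sin] decide. *)
Lemma cder_Cexp (z : C) : cder Cexp z (Cexp z).
Proof.
apply cder_eps. intros e He.
assert (Hm : (0 < Cmod (Cexp z))%R) by apply Cmod_gt_0, Cexp_neq_0.
set (m := Cmod (Cexp z)) in *.
set (k := (Rmin 1 (e / (8 * m)))%R).
assert (Hk : (0 < k)%R) by (apply Rmin_pos; [lra|apply Rdiv_lt_0_compat; lra]).
assert (Hk1 : (k <= 1)%R) by apply Rmin_l.
assert (Hk2 : (8 * k * m <= e)%R).
{ assert (T : (k <= e / (8 * m))%R) by apply Rmin_r.
  apply Rmult_le_compat_r with (r := (8 * m)%R) in T; [|lra].
  unfold Rdiv in T. rewrite Rmult_assoc, Rinv_l in T by lra. lra. }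
assert (De : is_derive exp 0 1) by (auto_derive; trivial; rewrite exp_0; ring).
assert (Dc : is_derive cos 0 0) by (auto_derive; trivial; rewrite sin_0; ring).
assert (Ds : is_derive sin 0 1) by (auto_derive; trivial; rewrite cos_0; ring).
rewrite is_derive_R_eps in De, Dc, Ds.
destruct (De k Hk) as [d1 [Hd1 H1]]. destruct (Dc k Hk) as [d2 [Hd2 H2]].
destruct (Ds k Hk) as [d3 [Hd3 H3]].
exists (Rmin (Rmin (k / 2) d1) (Rmin d2 d3)). split; [repeat apply Rmin_pos; lra|].
intros w Hw. set (h := w - z).
replace (Cexp w) with (Cexp z * Cexp h) by (rewrite <- Cexp_plus; f_equal; unfold h; ring).
replace (Cexp z * Cexp h - Cexp z - h * Cexp z) with (Cexp z * (Cexp h - 1 - h)) by ring.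
rewrite Cmod_mult. fold m h in Hw |- *.
assert (Hh1 := re_le_Cmod h). assert (Hh2 := im_le_Cmod h).
assert (B1 := Rmin_l (Rmin (k/2) d1) (Rmin d2 d3)).
assert (B2 := Rmin_r (Rmin (k/2) d1) (Rmin d2 d3)).
assert (B3 := Rmin_l (k/2) d1). assert (B4 := Rmin_r (k/2) d1).
assert (B5 := Rmin_l d2 d3). assert (B6 := Rmin_r d2 d3).
destruct h as [x y] eqn:Eh. simpl in Hh1, Hh2.
specialize (H1 x). specialize (H2 y). specialize (H3 y).
rewrite Rminus_0_r in H1, H2, H3. rewrite exp_0 in H1. rewrite cos_0 in H2. rewrite sin_0 in H3.
specialize (H1 ltac:(lra)). specialize (H2 ltac:(lra)). specialize (H3 ltac:(lra)).
set (c := Cmod (x, y)) in *.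
assert (Hc : (0 <= c)%R) by apply Cmod_ge_0.
(* Real and imaginary parts split into first-order remainders, some weighted by [exp x], which is at
   most 2, or by [y], and the product [y * x]. Together they cost at most 7 k c. *)
assert (Q : (Cmod (Cexp (x, y) - 1 - (x, y)) <= 8 * k * c)%R).
{ eapply Rle_trans; [apply Cmod_le_Rabs|]. unfold Cexp, Re, Im; simpl.
  replace (exp x * cos y + - (1) + - x)%R with (exp x * (cos y - 1 - y * 0) + (exp x - 1 - x * 1))%R by ring.
  replace (exp x * sin y + - 0 + - y)%R with (exp x * (sin y - 0 - y * 1) + y * (exp x - 1 - x * 1) + y * x)%R by ring.
  assert (Hex : (0 <= exp x <= 2)%R).
  { split; [apply Rlt_le, exp_pos|]. apply Rabs_le_between in H1.
    assert (Rabs x <= 1/2)%R by lra. assert (x <= Rabs x)%R by apply Rle_abs.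
    assert (k * Rabs x <= 1 * Rabs x)%R by (apply Rmult_le_compat_r; [apply Rabs_pos|lra]). lra. }
  assert (K2 : (k * Rabs y <= k * c)%R) by (apply Rmult_le_compat_l; lra).
  assert (K1 : (k * Rabs x <= k * c)%R) by (apply Rmult_le_compat_l; lra).
  assert (A1 : (Rabs (exp x * (cos y - 1 - y * 0)) <= 2 * (k * c))%R).
  { rewrite Rabs_mult, (Rabs_pos_eq (exp x)) by lra. apply Rmult_le_compat; try lra; apply Rabs_pos. }
  assert (A2 : (Rabs (exp x * (sin y - 0 - y * 1)) <= 2 * (k * c))%R).
  { rewrite Rabs_mult, (Rabs_pos_eq (exp x)) by lra. apply Rmult_le_compat; try lra; apply Rabs_pos. }
  assert (A3 : (Rabs (y * (exp x - 1 - x * 1)) <= 1 * (k * c))%R).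
  { rewrite Rabs_mult. apply Rmult_le_compat; try lra; apply Rabs_pos. }
  assert (A4 : (Rabs (y * x) <= c * k)%R).
  { rewrite Rabs_mult. apply Rmult_le_compat; try lra; apply Rabs_pos. }
  eapply Rle_trans; [apply Rplus_le_compat; [apply Rabs_triang|
    eapply Rle_trans; [apply Rabs_triang|apply Rplus_le_compat_r, Rabs_triang]]|].
  assert (0 <= k * c)%R by (apply Rmult_le_pos; lra). lra. }
apply Rle_trans with (m * (8 * k * c))%R.
- apply Rmult_le_compat_l; [lra|exact Q].
- replace (m * (8 * k * c))%R with (8 * k * m * c)%R by ring. now apply Rmult_le_compat_r.
Qed.

Lemma continuous_Cexp {T : UniformSpace} (f : T -> C) (x : T) :
  continuous (U := C_UniformSpace) f x -> continuous (U := C_UniformSpace) (fun t => Cexp (f t)) x.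
Proof.
intros Hf. apply (continuous_comp f Cexp); trivial. eapply cder_ccont, cder_Cexp.
Qed.

Lemma is_CI_iff (f : R -> C) (a b : R) (l : C) :
  is_CI f a b l <-> is_RInt (fun t => Re (f t)) a b (Re l) /\ is_RInt (fun t => Im (f t)) a b (Im l).
Proof.
split.
- intros H. split; [exact (is_RInt_fct_extend_fst _ _ _ _ H)|exact (is_RInt_fct_extend_snd _ _ _ _ H)].
- intros [H1 H2]. destruct l. exact (is_RInt_fct_extend_pair f a b _ _ H1 H2).
Qed.

Lemma ex_CI_cont (f : R -> C) (a b : R) :
  (forall t, Rmin a b <= t <= Rmax a b -> pcont f t)%R -> ex_CI f a b.
Proof. intros H. exact (ex_RInt_continuous (V := C_R_CompleteNormedModule) f a b H). Qed.

Lemma CI_correct (f : R -> C) (a b : R) : ex_CI f a b -> is_CI f a b (CI f a b).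
Proof. exact (RInt_correct (V := C_R_CompleteNormedModule) f a b). Qed.

Lemma CI_unique (f : R -> C) (a b : R) (l : C) : is_CI f a b l -> CI f a b = l.
Proof. exact (is_RInt_unique (V := C_R_CompleteNormedModule) f a b l). Qed.

Lemma CI_Re (f : R -> C) (a b : R) : ex_CI f a b -> Re (CI f a b) = RInt (fun t => Re (f t)) a b.
Proof.
intros H. apply CI_correct, is_CI_iff in H. symmetry. apply is_RInt_unique, H.
Qed.

Lemma CI_ext (f g : R -> C) (a b : R) :
  (forall t, Rmin a b < t < Rmax a b -> f t = g t)%R -> CI f a b = CI g a b.
Proof. exact (RInt_ext (V := C_R_CompleteNormedModule) f g a b). Qed.

Lemma is_CI_mult (c : C) (f : R -> C) (a b : R) (l : C) :
  is_CI f a b l -> is_CI (fun t => c * f t) a b (c * l).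
Proof.
rewrite !is_CI_iff. intros [H1 H2]. split.
- exact (is_RInt_minus _ _ _ _ _ _ (is_RInt_scal _ _ _ (Re c) _ H1) (is_RInt_scal _ _ _ (Im c) _ H2)).
- exact (is_RInt_plus _ _ _ _ _ _ (is_RInt_scal _ _ _ (Re c) _ H2) (is_RInt_scal _ _ _ (Im c) _ H1)).
Qed.

Lemma CI_mult (c : C) (f : R -> C) (a b : R) :
  ex_CI f a b -> CI (fun t => c * f t) a b = c * CI f a b.
Proof. intros H. apply CI_unique, is_CI_mult, CI_correct, H. Qed.

Lemma CI_plus (f g : R -> C) (a b : R) : ex_CI f a b -> ex_CI g a b ->
  CI (fun t => f t + g t) a b = CI f a b + CI g a b.
Proof. exact (RInt_plus (V := C_R_CompleteNormedModule) f g a b). Qed.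

Lemma CI_minus (f g : R -> C) (a b : R) : ex_CI f a b -> ex_CI g a b ->
  CI (fun t => f t - g t) a b = CI f a b - CI g a b.
Proof. exact (RInt_minus (V := C_R_CompleteNormedModule) f g a b). Qed.

Lemma CI_const (c : C) (a b : R) : CI (fun _ => c) a b = RtoC (b - a) * c.
Proof.
apply CI_unique, is_CI_iff. destruct c as [x y].
assert (H1 := is_RInt_const a b x). assert (H2 := is_RInt_const a b y).
unfold scal in H1, H2; simpl in H1, H2. unfold mult in H1, H2; simpl in H1, H2.
simpl. rewrite !Rmult_0_l, Rplus_0_r, Rminus_0_r. now split.
Qed.

Lemma CI_Chasles (f : R -> C) (a b c : R) : ex_CI f a b -> ex_CI f b c ->
  CI f a b + CI f b c = CI f a c.
Proof. exact (RInt_Chasles (V := C_R_CompleteNormedModule) f a b c). Qed.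

Lemma Cmod_CI_le (f : R -> C) (g : R -> R) (a b : R) : (a <= b)%R ->
  ex_CI f a b -> ex_RInt g a b ->
  (forall t, a <= t <= b -> Cmod (f t) <= g t)%R ->
  (Cmod (CI f a b) <= RInt g a b)%R.
Proof.
intros Hab Hf Hg H. rewrite <- norm_C_R.
apply (norm_RInt_le (V := C_R_NormedModule) f g a b); trivial.
- intros t Ht. rewrite norm_C_R. auto.
- now apply CI_correct.
- now apply (RInt_correct (V := R_CompleteNormedModule)).
Qed.

Lemma Cmod_CI_const (f : R -> C) (M a b : R) : (a <= b)%R -> ex_CI f a b ->
  (forall t, a <= t <= b -> Cmod (f t) <= M)%R -> (Cmod (CI f a b) <= (b - a) * M)%R.
Proof.
intros Hab Hf H. rewrite <- norm_C_R.
apply (norm_RInt_le_const (V := C_R_NormedModule) f a b); trivial.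
- intros t Ht. rewrite norm_C_R. auto.
- now apply CI_correct.
Qed.

Lemma is_CI_derive (f df : R -> C) (a b : R) :
  (forall t, Rmin a b <= t <= Rmax a b -> pder f t (df t))%R ->
  (forall t, Rmin a b <= t <= Rmax a b -> pcont df t)%R ->
  is_CI df a b (f b - f a).
Proof. exact (is_RInt_derive (V := C_R_CompleteNormedModule) f df a b). Qed.

Lemma pder_horizontal (x y : R) : pder (fun t => (t, y) : C) x 1.
Proof. apply pder_pair; auto_derive; trivial. Qed.

Lemma pder_vertical (x y : R) : pder (fun t => (x, t) : C) y Ci.
Proof. apply pder_pair; auto_derive; trivial. Qed.

Lemma pder_line (z v : C) (s : R) : pder (fun t => z + RtoC t * v) s v.
Proof.
destruct z as [a b], v as [c d].
apply (is_derive_ext (V := C_R_NormedModule) (fun t => (a + t * c, b + t * d)%R : C)).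
- intros t. apply injective_projections; simpl; ring.
- apply pder_pair; auto_derive; trivial; ring.
Qed.

(** * Goursat's theorem on rectangles *)

Definition boundary_int (F : C -> C) (a b c d : R) : C :=
  CI (fun x => F (x, c)) a b + Ci * CI (fun y => F (b, y)) c d
  - CI (fun x => F (x, d)) a b - Ci * CI (fun y => F (a, y)) c d.

Definition cont_rect (F : C -> C) (a b c d : R) : Prop :=
  forall x y, (a <= x <= b)%R -> (c <= y <= d)%R -> ccont F (x, y).

Lemma cont_horizontal (F : C -> C) (x y : R) : ccont F (x, y) -> pcont (fun t => F (t, y)) x.
Proof.
intros H. apply (continuous_comp (fun t : R => (t, y) : C_UniformSpace) F); trivial.
eapply pder_pcont, pder_horizontal.
Qed.

Lemma cont_vertical (F : C -> C) (x y : R) : ccont F (x, y) -> pcont (fun t => F (x, t)) y.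
Proof.
intros H. apply (continuous_comp (fun t : R => (x, t) : C_UniformSpace) F); trivial.
eapply pder_pcont, pder_vertical.
Qed.

Lemma ex_CI_horizontal (F : C -> C) (a b c d x1 x2 y : R) : cont_rect F a b c d ->
  (a <= x1 <= x2 -> x2 <= b -> c <= y <= d -> ex_CI (fun t => F (t, y)) x1 x2)%R.
Proof.
intros H H1 H2 H3. apply ex_CI_cont. intros t Ht. rewrite Rmin_left, Rmax_right in Ht by lra.
apply cont_horizontal, H; lra.
Qed.

Lemma ex_CI_vertical (F : C -> C) (a b c d x y1 y2 : R) : cont_rect F a b c d ->
  (c <= y1 <= y2 -> y2 <= d -> a <= x <= b -> ex_CI (fun t => F (x, t)) y1 y2)%R.
Proof.
intros H H1 H2 H3. apply ex_CI_cont. intros t Ht. rewrite Rmin_left, Rmax_right in Ht by lra.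
apply cont_vertical, H; lra.
Qed.

Lemma boundary_int_split_x (F : C -> C) (a m b c d : R) : cont_rect F a b c d ->
  (a <= m <= b)%R -> (c <= d)%R ->
  boundary_int F a b c d = boundary_int F a m c d + boundary_int F m b c d.
Proof.
intros H Hm Hcd. unfold boundary_int.
rewrite <- (CI_Chasles (fun x => F (x, c)) a m b), <- (CI_Chasles (fun x => F (x, d)) a m b)
  by (eapply ex_CI_horizontal; eauto; lra).
ring.
Qed.

Lemma boundary_int_split_y (F : C -> C) (a b c m d : R) : cont_rect F a b c d ->
  (c <= m <= d)%R -> (a <= b)%R ->
  boundary_int F a b c d = boundary_int F a b c m + boundary_int F a b m d.
Proof.
intros H Hm Hcd. unfold boundary_int.
rewrite <- (CI_Chasles (fun x => F (a, x)) c m d), <- (CI_Chasles (fun x => F (b, x)) c m d)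
  by (eapply ex_CI_vertical; eauto; lra).
ring.
Qed.

Lemma boundary_int_primitive (P F : C -> C) (a b c d : R) :
  (forall z, cder P z (F z)) -> (forall z, ccont F z) -> boundary_int F a b c d = 0.
Proof.
intros HP HF.
assert (X : forall y, CI (fun x => F (x, y)) a b = P (b, y) - P (a, y)).
{ intros y. apply CI_unique. apply (is_CI_derive (fun x => P (x, y))); intros t _.
  - rewrite <- (Cmult_1_l (F (t, y))). apply (pder_comp P (fun x => (x, y))); trivial.
    apply pder_horizontal.
  - now apply cont_horizontal. }
assert (Y : forall x, Ci * CI (fun y => F (x, y)) c d = P (x, d) - P (x, c)).
{ intros x. rewrite <- CI_mult.
  2:{ apply ex_CI_cont. intros t _. now apply cont_vertical. }
  apply CI_unique. apply (is_CI_derive (fun y => P (x, y))); intros t _.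
  - apply (pder_comp P (fun y => (x, y))); trivial. apply pder_vertical.
  - apply continuous_Cmult; [apply continuous_const|]. now apply cont_vertical. }
unfold boundary_int. rewrite !X, !Y. ring.
Qed.

Lemma boundary_int_minus (F G : C -> C) (a b c d : R) : (a <= b)%R -> (c <= d)%R ->
  cont_rect F a b c d -> cont_rect G a b c d ->
  boundary_int (fun w => F w - G w) a b c d = boundary_int F a b c d - boundary_int G a b c d.
Proof.
intros Hab Hcd HF HG. unfold boundary_int.
assert (X : forall y, (c <= y <= d)%R -> CI (fun x => F (x, y) - G (x, y)) a b =
  CI (fun x => F (x, y)) a b - CI (fun x => G (x, y)) a b).
{ intros y Hy. apply CI_minus; [apply (ex_CI_horizontal F a b c d)|apply (ex_CI_horizontal G a b c d)]; trivial; lra. }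
assert (Y : forall x, (a <= x <= b)%R -> CI (fun y => F (x, y) - G (x, y)) c d =
  CI (fun y => F (x, y)) c d - CI (fun y => G (x, y)) c d).
{ intros x Hx. apply CI_minus; [apply (ex_CI_vertical F a b c d)|apply (ex_CI_vertical G a b c d)]; trivial; lra. }
rewrite (X c), (X d), (Y a), (Y b) by lra. ring.
Qed.

Lemma boundary_int_le (F : C -> C) (M a b c d : R) : (a <= b)%R -> (c <= d)%R -> cont_rect F a b c d ->
  (forall x y, (a <= x <= b)%R -> (c <= y <= d)%R -> (Cmod (F (x, y)) <= M)%R) ->
  (Cmod (boundary_int F a b c d) <= 2 * ((b - a) + (d - c)) * M)%R.
Proof.
intros Hab Hcd HF HM. unfold boundary_int.
assert (X : forall y, (c <= y <= d -> Cmod (CI (fun x => F (x, y)) a b) <= (b - a) * M)%R).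
{ intros y Hy. apply Cmod_CI_const; trivial.
  - eapply ex_CI_horizontal; eauto; lra.
  - intros t Ht. now apply HM. }
assert (Y : forall x, (a <= x <= b -> Cmod (Ci * CI (fun y => F (x, y)) c d) <= (d - c) * M)%R).
{ intros x Hx. rewrite Cmod_mult, Cmod_Ci, Rmult_1_l. apply Cmod_CI_const; trivial.
  - eapply ex_CI_vertical; eauto; lra.
  - intros t Ht. now apply HM. }
assert (X1 := X c ltac:(lra)). assert (X2 := X d ltac:(lra)).
assert (Y1 := Y a ltac:(lra)). assert (Y2 := Y b ltac:(lra)).
set (x1 := CI (fun x => F (x, c)) a b) in *. set (x2 := CI (fun x => F (x, d)) a b) in *.
set (y1 := Ci * CI (fun y => F (b, y)) c d) in *. set (y2 := Ci * CI (fun y => F (a, y)) c d) in *.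
assert (T1 := Cmod_triangle (x1 + y1 - x2) (- y2)). rewrite Cmod_opp in T1.
assert (T2 := Cmod_triangle (x1 + y1) (- x2)). rewrite Cmod_opp in T2.
assert (T3 := Cmod_triangle x1 y1).
change (Cmod (x1 + y1 - x2 - y2) <= Cmod (x1 + y1 - x2) + Cmod y2)%R in T1.
change (Cmod (x1 + y1 - x2) <= Cmod (x1 + y1) + Cmod x2)%R in T2. lra.
Qed.

Record rect := Rect { rl : R; rr : R; rb : R; rt : R }.
Definition rect_int F r := boundary_int F (rl r) (rr r) (rb r) (rt r).

(** The last branch is decided by the triangle inequality: if each of the other three quarters
    carries less than a fourth of the integral, the fourth one carries more. *)
Definition quarter (F : C -> C) (r : rect) : rect :=
  let mx := ((rl r + rr r) / 2)%R in
  let my := ((rb r + rt r) / 2)%R in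
  let q1 := Rect (rl r) mx (rb r) my in
  let q2 := Rect mx (rr r) (rb r) my in
  let q3 := Rect (rl r) mx my (rt r) in
  let q4 := Rect mx (rr r) my (rt r) in
  let big q := Rle_dec (Cmod (rect_int F r)) (4 * Cmod (rect_int F q)) in
  if big q1 then q1 else if big q2 then q2 else if big q3 then q3 else q4.

Lemma quarter_spec (F : C -> C) (r : rect) :
  (rl r <= rr r)%R -> (rb r <= rt r)%R -> cont_rect F (rl r) (rr r) (rb r) (rt r) ->
  let q := quarter F r in
  ((rl r <= rl q /\ rl q <= rr q /\ rr q <= rr r) /\ (rb r <= rb q /\ rb q <= rt q /\ rt q <= rt r) /\
  rr q - rl q = (rr r - rl r) / 2 /\ rt q - rb q = (rt r - rb r) / 2 /\
  Cmod (rect_int F r) <= 4 * Cmod (rect_int F q))%R.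
Proof.
intros H1 H2 HF. unfold quarter. cbv zeta.
remember ((rl r + rr r) / 2)%R as mx eqn:Hmx. remember ((rb r + rt r) / 2)%R as my eqn:Hmy.
destruct (Rle_dec (Cmod (rect_int F r)) (4 * Cmod (rect_int F (Rect (rl r) mx (rb r) my)))) as [h1|h1].
{ cbn [rl rr rb rt]. repeat split; try exact h1; clear h1; lra. }
destruct (Rle_dec (Cmod (rect_int F r)) (4 * Cmod (rect_int F (Rect mx (rr r) (rb r) my)))) as [h2|h2].
{ cbn [rl rr rb rt]. repeat split; try exact h2; clear h1 h2; lra. }
destruct (Rle_dec (Cmod (rect_int F r)) (4 * Cmod (rect_int F (Rect (rl r) mx my (rt r))))) as [h3|h3].
{ cbn [rl rr rb rt]. repeat split; try exact h3; clear h1 h2 h3; lra. }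
assert (E : rect_int F r = rect_int F (Rect (rl r) mx (rb r) my) + rect_int F (Rect mx (rr r) (rb r) my)
  + rect_int F (Rect (rl r) mx my (rt r)) + rect_int F (Rect mx (rr r) my (rt r))).
{ unfold rect_int at 1. rewrite (boundary_int_split_x F _ mx) by (trivial; lra).
  rewrite (boundary_int_split_y F (rl r) mx _ my), (boundary_int_split_y F mx (rr r) _ my).
  - unfold rect_int; simpl. ring.
  - intros x y Hx Hy. apply HF; lra.
  - lra.
  - lra.
  - intros x y Hx Hy. apply HF; lra.
  - lra.
  - lra. }
assert (T : (Cmod (rect_int F r) <= Cmod (rect_int F (Rect (rl r) mx (rb r) my)) + Cmod (rect_int F (Rect mx (rr r) (rb r) my))
  + Cmod (rect_int F (Rect (rl r) mx my (rt r))) + Cmod (rect_int F (Rect mx (rr r) my (rt r))))%R).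
{ rewrite E. eapply Rle_trans; [apply Cmod_triangle|]. apply Rplus_le_compat_r.
  eapply Rle_trans; [apply Cmod_triangle|]. apply Rplus_le_compat_r. apply Cmod_triangle. }
cbn [rl rr rb rt]. repeat split; try (clear h1 h2 h3 T E; lra).
set (A0 := Cmod (rect_int F r)) in *. lra.
Qed.

Lemma goursat (F : C -> C) (a b c d : R) : (a <= b)%R -> (c <= d)%R ->
  (forall x y, (a <= x <= b)%R -> (c <= y <= d)%R -> exists l, cder F (x, y) l) ->
  boundary_int F a b c d = 0.
Proof.
intros Hab Hcd HF.
assert (HC : cont_rect F a b c d).
{ intros x y Hx Hy. destruct (HF x y Hx Hy) as [l Hl]. eapply cder_ccont, Hl. }
set (r0 := Rect a b c d).
set (u := fun n => Nat.iter n (quarter F) r0).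
set (s := (b - a + (d - c))%R).
assert (Inv : forall n, (a <= rl (u n) <= rr (u n) /\ rr (u n) <= b /\ c <= rb (u n) <= rt (u n) /\ rt (u n) <= d
  /\ rr (u n) - rl (u n) = (b - a) / 2 ^ n /\ rt (u n) - rb (u n) = (d - c) / 2 ^ n
  /\ Cmod (boundary_int F a b c d) <= 4 ^ n * Cmod (rect_int F (u n)))%R).
{ induction n as [|n IH].
  - unfold u, r0, rect_int; simpl. repeat split; try lra.
  - assert (Q := quarter_spec F (u n)). change (u (S n)) with (quarter F (u n)).
    cbv zeta in Q. destruct Q as (Q1 & Q2 & Q3 & Q4 & Q5); try lra.
    { intros x y Hx Hy. apply HC; lra. }
    assert (P2 : (0 < 2 ^ n)%R) by (apply pow_lt; lra).
    assert (P4 : (0 < 4 ^ n)%R) by (apply pow_lt; lra).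
    destruct IH as (I1 & I2 & I3 & I4 & I5 & I6 & I7).
    repeat split; try lra.
    + rewrite Q3, I5. simpl. field. lra.
    + rewrite Q4, I6. simpl. field. lra.
    + eapply Rle_trans; [exact I7|]. simpl.
      apply Rmult_le_compat_l with (r := (4 ^ n)%R) in Q5; lra. }
assert (Mon : forall n, (rl (u n) <= rl (u (S n)) /\ rb (u n) <= rb (u (S n)) /\ rr (u (S n)) <= rr (u n) /\ rt (u (S n)) <= rt (u n))%R).
{ intros n. assert (I := Inv n). assert (Q := quarter_spec F (u n)). change (u (S n)) with (quarter F (u n)).
  cbv zeta in Q. destruct Q as (Q1 & Q2 & Q3 & Q4 & Q5); try lra.
  intros x y Hx Hy. apply HC; lra. }
assert (Lim : forall (l r : nat -> R), (forall n, l n <= l (S n))%R -> (forall n, r (S n) <= r n)%R ->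
   (forall n, l n <= r n)%R -> exists x, forall n, (l n <= x <= r n)%R).
{ intros l r Hl Hr Hlr.
  assert (Hl' : forall n k, (l n <= l (n + k)%nat)%R).
  { intros n k. induction k; [rewrite Nat.add_0_r; lra|]. rewrite Nat.add_succ_r. specialize (Hl (n + k)%nat). lra. }
  assert (Hr' : forall n k, (r (n + k)%nat <= r n)%R).
  { intros n k. induction k; [rewrite Nat.add_0_r; lra|]. rewrite Nat.add_succ_r. specialize (Hr (n + k)%nat). lra. }
  assert (Hlr' : forall n m, (l n <= r m)%R).
  { intros n m. specialize (Hl' n m). specialize (Hr' m n). specialize (Hlr (n + m)%nat).
    rewrite (Nat.add_comm m n) in Hr'. lra. }
  destruct (completeness (fun x => exists n, x = l n)) as [x [Hx1 Hx2]].
  - exists (r 0%nat). intros x [n ->]. apply Hlr'.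
  - exists (l 0%nat). now exists 0%nat.
  - exists x. intros n. split.
    + apply Hx1. now exists n.
    + apply Hx2. intros y [m ->]. apply Hlr'. }
destruct (Lim (fun n => rl (u n)) (fun n => rr (u n))) as [x0 Hx0]; try (intros n; apply Mon || apply Inv).
destruct (Lim (fun n => rb (u n)) (fun n => rt (u n))) as [y0 Hy0]; try (intros n; apply Mon || apply Inv).
assert (B0 := Hx0 0%nat). assert (B1 := Hy0 0%nat). unfold u, r0 in B0, B1; simpl in B0, B1.
destruct (HF x0 y0 B0 B1) as [l Hl]. set (z0 := (x0, y0) : C) in *.
assert (Hs : (0 <= s)%R) by (unfold s; lra).
assert (Small : forall e, (0 < e)%R -> (Cmod (boundary_int F a b c d) <= 2 * e * s * s)%R).
{ intros e He. destruct (proj1 (cder_eps _ _ _) Hl e He) as [dl [Hdl Hd]].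
  (* When the half-perimeter [s] is 0 the rectangle is a point; it is set apart because the number
     of bisections is chosen by comparing with [dl / s]. *)
  destruct (Rle_lt_or_eq_dec 0 s Hs) as [Hs0|Hs0].
  2:{ assert (E1 := boundary_int_le F (Rmax 0 (Cmod (F (a, c)))) a b c d Hab Hcd HC).
      assert (b = a)%R by (unfold s in *; lra). assert (d = c)%R by (unfold s in *; lra). subst b d.
      eapply Rle_trans; [apply E1|].
      - intros x y Hx Hy. replace x with a by lra. replace y with c by lra. apply Rmax_r.
      - rewrite <- Hs0. lra. }
  destruct (pow_lt_1_zero (/ 2) ltac:(rewrite Rabs_pos_eq; lra) (dl / s)) as [N HN].
  { apply Rdiv_lt_0_compat; trivial. }
  specialize (HN N (le_n N)).
  destruct (Inv N) as (I1 & I2 & I3 & I4 & I5 & I6 & I7). set (q := u N) in *.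
  specialize (Hx0 N). specialize (Hy0 N). fold q in Hx0, Hy0.
  assert (P2 : (0 < 2 ^ N)%R) by (apply pow_lt; lra).
  assert (E4 : (4 ^ N = 2 ^ N * 2 ^ N)%R) by (rewrite <- Rpow_mult_distr; f_equal; lra).
  set (p := (s / 2 ^ N)%R).
  assert (Hp : (p < dl)%R).
  { rewrite Rabs_pos_eq, pow_inv in HN by (apply pow_le; lra).
    apply Rmult_lt_compat_l with (r := s) in HN; trivial.
    replace (s * (dl / s))%R with dl in HN by (field; lra). exact HN. }
  assert (Hp' : (rr q - rl q + (rt q - rb q) = p)%R) by (rewrite I5, I6; unfold p, s; field; lra).
  (* The tangent map [A] has a primitive and integrates to 0. What remains of F is at most e p on a
     rectangle of half-perimeter p = s / 2^N, so its integral is at most 2 e p^2, and p^2 cancels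
     the factor 4^N gained by the bisections. *)
  set (A := fun w : C => F z0 + (w - z0) * l).
  set (G := fun w : C => F w - A w).
  assert (CA : forall w, ccont A w).
  { intros w. unfold A. apply continuous_Cplus; [apply continuous_const|].
    apply continuous_Cmult; [|apply continuous_const]. apply continuous_Cminus; [apply continuous_id|apply continuous_const]. }
  assert (ZA : rect_int A q = 0).
  { unfold rect_int. apply (boundary_int_primitive (fun w => F z0 * w + l * ((w - z0) ^ 2 * / 2)) A); [|exact CA].
    intros w. unfold A.
    eapply cder_eq.
    - apply cder_plus; [apply cder_mult; [apply cder_const|apply cder_id]|].
      apply cder_mult; [apply cder_const|]. apply cder_mult; [|apply cder_const].
      apply cder_pow. apply cder_minus; [apply cder_id|apply cder_const].
    - simpl. replace (RtoC (1 + 1)%R) with (RtoC 2) by (f_equal; ring). field. }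
  assert (EqI : rect_int F q = rect_int G q).
  { assert (CF : cont_rect F (rl q) (rr q) (rb q) (rt q)) by (intros x y Hx Hy; apply HC; lra).
    assert (CA' : cont_rect A (rl q) (rr q) (rb q) (rt q)) by (intros x y Hx Hy; apply CA).
    replace (rect_int F q) with (rect_int F q - rect_int A q) by (rewrite ZA; ring).
    unfold rect_int, G. now rewrite boundary_int_minus by (trivial; lra). }
  assert (BG : (Cmod (rect_int G q) <= 2 * p * (e * p))%R).
  { rewrite <- Hp' at 1. unfold rect_int. apply boundary_int_le; [lra|lra| |].
    - intros x y Hx Hy. apply continuous_Cminus; [apply HC; lra|apply CA].
    - intros x y Hx Hy. unfold G, A.
      assert (D : (Cmod ((x, y) - z0) <= p)%R).
      { eapply Rle_trans; [apply Cmod_le_Rabs|]. unfold z0, Re, Im; simpl. rewrite <- Hp'.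
        apply Rplus_le_compat; apply Rabs_le; lra. }
      replace (F (x, y) - (F z0 + ((x, y) - z0) * l)) with (F (x, y) - F z0 - ((x, y) - z0) * l) by ring.
      eapply Rle_trans; [apply Hd; lra|]. apply Rmult_le_compat_l; lra. }
  rewrite EqI in I7. eapply Rle_trans; [exact I7|].
  apply Rle_trans with (4 ^ N * (2 * p * (e * p)))%R.
  - apply Rmult_le_compat_l; trivial. rewrite E4. apply Rlt_le, Rmult_lt_0_compat; trivial.
  - apply Req_le. rewrite E4. unfold p. field. lra. }
apply Cmod_eq_0. apply Rle_antisym; [|apply Cmod_ge_0].
apply Rnot_lt_le. intros H. set (m := Cmod (boundary_int F a b c d)) in *.
specialize (Small (m / (4 * (s * s + 1)))%R).
assert (K : (0 < 4 * (s * s + 1))%R) by nra.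
specialize (Small (Rdiv_lt_0_compat _ _ H K)).
apply Rmult_le_compat_r with (r := (4 * (s * s + 1))%R) in Small; [|lra].
replace (2 * (m / (4 * (s * s + 1))) * s * s * (4 * (s * s + 1)))%R with (2 * m * s * s)%R in Small by (field; nra).
nra.
Qed.

(** * Mean values, derivatives and primitives of entire functions *)

Lemma Cexp_period (t : R) : Cexp (t, 2 * PI)%R = Cexp (t, 0%R).
Proof. unfold Cexp; simpl. now rewrite cos_2PI, sin_2PI, cos_0, sin_0. Qed.

Lemma Cmod_lt_eps_eq (z w : C) (k : R) : (0 <= k)%R ->
  (forall e, (0 < e)%R -> (Cmod (z - w) <= k * e)%R) -> z = w.
Proof.
intros Hk H. replace z with (w + (z - w)) by ring.
rewrite (Cmod_eq_0 (z - w)); [ring|].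
apply Rle_antisym; [|apply Cmod_ge_0]. apply Rnot_lt_le. intros P.
specialize (H (Cmod (z - w) / (2 * (k + 1)))%R ltac:(apply Rdiv_lt_0_compat; lra)).
apply Rmult_le_compat_r with (r := (2 * (k + 1))%R) in H; [|lra].
replace (k * (Cmod (z - w) / (2 * (k + 1))) * (2 * (k + 1)))%R with (k * Cmod (z - w))%R in H by (field; lra).
nra.
Qed.

(** On the rectangle [t, t0] x [0, 2 pi] the horizontal sides cancel by periodicity, so Goursat
    makes the vertical integral independent of t. Letting t tend to minus infinity shrinks the
    circle to its centre. *)
Lemma circle_int_limit (E : C -> C) (t0 : R) (L : C) :
  (forall t s, (t <= t0)%R -> exists l, cder E (t, s) l) ->
  (forall t, E (t, 2 * PI)%R = E (t, 0%R)) ->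
  (forall e, (0 < e)%R -> exists T, forall t s, (t < T)%R -> (Cmod (E (t, s) - L) <= e)%R) ->
  CI (fun s => E (t0, s)) 0 (2 * PI) = RtoC (2 * PI) * L.
Proof.
intros HE Hper Hlim. assert (HPI := PI_RGT_0).
assert (HC : forall t s, (t <= t0)%R -> ccont E (t, s)).
{ intros t s Ht. destruct (HE t s Ht) as [l Hl]. eapply cder_ccont, Hl. }
assert (Eq : forall t, (t <= t0)%R -> CI (fun s => E (t0, s)) 0 (2 * PI) = CI (fun s => E (t, s)) 0 (2 * PI)).
{ intros t Ht.
  assert (G := goursat E t t0 0 (2 * PI) Ht ltac:(lra) ltac:(intros x y Hx _; apply HE; lra)).
  unfold boundary_int in G.
  rewrite (CI_ext (fun x => E (x, 2 * PI)%R) (fun x => E (x, 0%R))) in G by (intros; apply Hper).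
  set (X := CI (fun x => E (x, 0%R)) t t0) in *.
  set (A := CI (fun s => E (t0, s)) 0 (2 * PI)) in *. set (B := CI (fun s => E (t, s)) 0 (2 * PI)) in *.
  assert (G' : Ci * (X + Ci * A - X - Ci * B) = 0) by (rewrite G; ring).
  replace (Ci * (X + Ci * A - X - Ci * B)) with (Ci * Ci * (A - B)) in G' by ring.
  replace (Ci * Ci) with (- (1)) in G' by (apply injective_projections; simpl; ring).
  replace A with (B - (- (1) * (A - B))) by ring. rewrite G'. ring. }
apply (Cmod_lt_eps_eq _ _ (2 * PI)); [lra|]. intros e He.
destruct (Hlim e He) as [T HT].
set (t := (Rmin t0 (T - 1))%R).
assert (Ht : (t <= t0)%R) by apply Rmin_l.
assert (HtT : (t < T)%R) by (assert (t <= T - 1)%R by apply Rmin_r; lra).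
rewrite (Eq t Ht).
assert (I1 : ex_CI (fun s => E (t, s)) 0 (2 * PI)).
{ apply ex_CI_cont. intros s _. now apply cont_vertical, HC. }
replace (RtoC (2 * PI) * L) with (CI (fun _ => L) 0 (2 * PI)) by (rewrite CI_const, Rminus_0_r; reflexivity).
rewrite <- CI_minus; [|exact I1|].
2:{ apply ex_CI_cont. intros s _. apply continuous_const. }
replace (2 * PI * e)%R with ((2 * PI - 0) * e)%R by ring.
apply Cmod_CI_const; [lra| |].
- apply ex_CI_cont. intros s _. apply continuous_Cminus; [now apply cont_vertical, HC|apply continuous_const].
- intros s _. now apply HT.
Qed.

(** Holomorphy is required on the closed disc alone, since the function fed in by [conj_kernel_mean]
    may have a pole outside it. *)
Lemma mean_value (F : C -> C) (z : C) (t0 : R) :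
  (forall w, (Cmod (w - z) <= exp t0)%R -> exists l, cder F w l) ->
  CI (fun s => F (z + Cexp (t0, s))) 0 (2 * PI) = RtoC (2 * PI) * F z.
Proof.
intros HF.
apply (circle_int_limit (fun w => F (z + Cexp w))).
- intros t s Ht. destruct (HF (z + Cexp (t, s))) as [l Hl].
  + replace (z + Cexp (t, s) - z) with (Cexp (t, s)) by ring. rewrite Cmod_Cexp. simpl.
    destruct Ht as [Ht| ->]; [|lra]. apply Rlt_le. now apply exp_increasing.
  + eexists. apply (cder_comp F (fun w => z + Cexp w)); [exact Hl|].
    apply cder_plus; [apply cder_const|apply cder_Cexp].
- intros t. now rewrite Cexp_period.
- intros e He.
  destruct (HF z) as [l Hl].
  { replace (z - z) with (RtoC 0) by ring. rewrite Cmod_0. apply Rlt_le, exp_pos. }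
  apply cder_ccont in Hl. destruct (proj1 (ccont_eps _ _) Hl e He) as [d [Hd H]].
  exists (ln d). intros t s Ht. apply Rlt_le, H.
  replace (z + Cexp (t, s) - z) with (Cexp (t, s)) by ring. rewrite Cmod_Cexp. simpl.
  rewrite <- (exp_ln d) by trivial. now apply exp_increasing.
Qed.

(** Subtracting [F z] turns the integrand into a difference quotient, whose limit at the centre of
    the circle is [l]. *)
Lemma cauchy_derivative (F : C -> C) (z l : C) (t0 : R) :
  (forall w, exists l, cder F w l) -> cder F z l ->
  CI (fun s => (F (z + Cexp (t0, s)) - F z) * / Cexp (t0, s)) 0 (2 * PI) = RtoC (2 * PI) * l.
Proof.
intros HF Hl.
apply (circle_int_limit (fun w => (F (z + Cexp w) - F z) * / Cexp w)).
- intros t s Ht. destruct (HF (z + Cexp (t, s))) as [l' Hl'].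
  eexists. apply cder_mult.
  + apply cder_minus; [|apply cder_const]. apply (cder_comp F (fun w => z + Cexp w)); [exact Hl'|].
    apply cder_plus; [apply cder_const|apply cder_Cexp].
  + apply (cder_comp Cinv Cexp); [apply cder_inv, Cexp_neq_0|apply cder_Cexp].
- intros t. now rewrite Cexp_period.
- intros e He. destruct (proj1 (cder_eps _ _ _) Hl e He) as [d [Hd H]].
  exists (ln d). intros t s Ht.
  assert (M : (Cmod (Cexp (t, s)) < d)%R).
  { rewrite Cmod_Cexp. simpl. rewrite <- (exp_ln d) by trivial. now apply exp_increasing. }
  assert (N := Cexp_neq_0 (t, s)). set (h := Cexp (t, s)) in *.
  specialize (H (z + h)). replace (z + h - z) with h in H by ring. specialize (H M).
  replace ((F (z + h) - F z) * / h - l) with ((F (z + h) - F z - h * l) * / h) by (field; trivial).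
  rewrite Cmod_mult, Cmod_inv by trivial. apply Cmod_gt_0 in N.
  apply Rmult_le_reg_r with (Cmod h); trivial. rewrite Rmult_assoc, Rinv_l, Rmult_1_r by lra. exact H.
Qed.

(** * Integrals depending on a complex parameter *)

Lemma jcont_eps (K : C -> R -> C) (w : C) (s : R) :
  jcont K w s <-> (forall e, (0 < e)%R -> exists d, (0 < d)%R /\ forall w' s',
    (Cmod (w' - w) < d)%R -> (Rabs (s' - s) < d)%R -> (Cmod (K w' s' - K w s) < e)%R).
Proof.
split.
- intros H e He.
  destruct (proj1 (filterlim_locally (F := locally (w, s)) _ _) H (mkposreal (e / 2) ltac:(lra))) as [d Hd].
  exists d. split; [apply cond_pos|]. intros w' s' Hw Hs.
  replace e with (2 * (e / 2))%R by field. apply ball_C_Cmod.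
  apply (Hd (w', s')). split; [now apply Cmod_ball_C|exact Hs].
- intros H. apply (filterlim_locally (F := locally (w, s))). intros e.
  destruct (H e (cond_pos e)) as [d [Hd H']].
  exists (mkposreal (d / 2) ltac:(lra)). intros [w' s'] [Hw Hs]. apply Cmod_ball_C, H'.
  + apply ball_C_Cmod in Hw. simpl in Hw. cbn [fst]. lra.
  + change (Rabs (s' - s) < d / 2)%R in Hs. cbn [snd]. lra.
Qed.

Lemma tube (K : C -> R -> C) (w : C) (a b e : R) :
  (forall s, (a <= s <= b)%R -> jcont K w s) -> (0 < e)%R ->
  exists d, (0 < d)%R /\ forall w' s, (Cmod (w' - w) < d)%R -> (a <= s <= b)%R ->
    (Cmod (K w' s - K w s) < e)%R.
Proof.
intros H He.
(* [compactness_value_1d] takes a gauge on the whole line: outside [a, b] the radius 1 is a dummy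
   value, and choice makes a function of the radii. It returns its covering point under a double
   negation, hence the later [NNPP]. *)
assert (D : forall s, exists d : posreal, (a <= s <= b)%R -> forall w' s',
    (Cmod (w' - w) < d)%R -> (Rabs (s' - s) < d)%R -> (Cmod (K w' s' - K w s) < e / 2)%R).
{ intros s. destruct (classic (a <= s <= b)%R) as [Hs|Hs].
  - destruct (proj1 (jcont_eps K w s) (H s Hs) (e / 2)%R ltac:(lra)) as [d [Hd H']].
    exists (mkposreal d Hd). intros _. exact H'.
  - exists (mkposreal 1 Rlt_0_1). tauto. }
set (delta := fun s => proj1_sig (constructive_indefinite_description _ (D s))).
assert (Hdelta : forall s, (a <= s <= b)%R -> forall w' s',
    (Cmod (w' - w) < delta s)%R -> (Rabs (s' - s) < delta s)%R -> (Cmod (K w' s' - K w s) < e / 2)%R).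
{ intros s. exact (proj2_sig (constructive_indefinite_description _ (D s))). }
destruct (compactness_value_1d a b delta) as [d Hd].
exists d. split; [apply cond_pos|]. intros w' s Hw Hs.
apply NNPP. intros N. apply (Hd s Hs). intros (t & Ht & H1 & H2). apply N.
assert (A1 := Hdelta t Ht w' s ltac:(lra) H1).
assert (A2 := Hdelta t Ht w s ltac:(replace (w - w) with (RtoC 0) by ring; rewrite Cmod_0; apply cond_pos) H1).
replace (K w' s - K w s) with ((K w' s - K w t) - (K w s - K w t)) by ring.
eapply Rle_lt_trans; [apply Cmod_triangle|]. rewrite Cmod_opp. lra.
Qed.

Lemma jcont_pcont (K : C -> R -> C) (w : C) (s : R) : jcont K w s -> pcont (K w) s.
Proof.
intros H. apply (continuous_comp_2 (V := C_UniformSpace) (W := R_UniformSpace) (fun _ : R => w) (fun s : R => s) K).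
- apply continuous_const. - apply continuous_id. - exact H.
Qed.

Lemma ccont_CI (K : C -> R -> C) (w : C) (a b : R) : (a <= b)%R ->
  (forall w s, (a <= s <= b)%R -> jcont K w s) -> ccont (fun w => CI (K w) a b) w.
Proof.
intros Hab H. apply ccont_eps. intros e He.
assert (I : forall w, ex_CI (K w) a b).
{ intros w'. apply ex_CI_cont. intros s Hs. rewrite Rmin_left, Rmax_right in Hs by lra. now apply jcont_pcont, H. }
destruct (tube K w a b (e / (b - a + 1)) (H w)) as [d [Hd H']]; [apply Rdiv_lt_0_compat; lra|].
exists d. split; trivial. intros w' Hw. rewrite <- CI_minus by trivial.
eapply Rle_lt_trans.
- apply Cmod_CI_const; [trivial| |].
  + apply ex_CI_cont. intros s Hs. rewrite Rmin_left, Rmax_right in Hs by lra.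
    apply continuous_Cminus; now apply jcont_pcont, H.
  + intros s Hs. apply Rlt_le, H'; trivial.
- apply Rmult_lt_reg_r with (b - a + 1)%R; [lra|].
  replace ((b - a) * (e / (b - a + 1)) * (b - a + 1))%R with ((b - a) * e)%R by (field; lra). nra.
Qed.

Lemma cder_segment (F F' : C -> C) (z w : C) :
  (forall z, cder F z (F' z)) -> (forall z, ccont F' z) ->
  is_CI (fun s => F' (z + RtoC s * (w - z)) * (w - z)) 0 1 (F w - F z).
Proof.
intros HF HC.
replace (F w - F z) with (F (z + RtoC 1 * (w - z)) - F (z + RtoC 0 * (w - z))).
2:{ f_equal; [f_equal|f_equal; f_equal]; ring. }
apply (is_CI_derive (fun s => F (z + RtoC s * (w - z)))); intros s _.
- rewrite Cmult_comm. apply (pder_comp F (fun s => z + RtoC s * (w - z))); trivial. apply pder_line.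
- apply continuous_Cmult; [|apply continuous_const].
  apply (continuous_comp (fun s : R => z + RtoC s * (w - z)) F'); trivial.
  eapply pder_pcont, pder_line.
Qed.

Lemma cder_zero_const (F : C -> C) : (forall z, cder F z 0) -> forall z w, F z = F w.
Proof.
intros H z w. assert (E := cder_segment F (fun _ => 0) w z H (fun z => continuous_const _ z)).
apply CI_unique in E. rewrite (CI_ext _ (fun _ => 0)) in E by (intros; ring).
rewrite CI_const, Cmult_0_r in E. replace (F z) with (F w + (F z - F w)) by ring. rewrite <- E. ring.
Qed.

(** The increment of [K] in its first variable is the integral of [K'] along the segment from w to
    w', so [tube] for [K'] bounds the error uniformly in s. *)
Lemma cder_CI (K K' : C -> R -> C) (w : C) (a b : R) : (a <= b)%R ->
  (forall w s, (a <= s <= b)%R -> cder (fun w => K w s) w (K' w s)) ->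
  (forall w s, (a <= s <= b)%R -> jcont K w s) ->
  (forall w s, (a <= s <= b)%R -> jcont K' w s) ->
  cder (fun w => CI (K w) a b) w (CI (K' w) a b).
Proof.
intros Hab HD HK HK'. apply cder_eps. intros e He.
assert (I : forall w, ex_CI (K w) a b).
{ intros w'. apply ex_CI_cont. intros s Hs. rewrite Rmin_left, Rmax_right in Hs by lra. now apply jcont_pcont, HK. }
assert (I' : forall w, ex_CI (K' w) a b).
{ intros w'. apply ex_CI_cont. intros s Hs. rewrite Rmin_left, Rmax_right in Hs by lra. now apply jcont_pcont, HK'. }
destruct (tube K' w a b (e / (b - a + 1)) (HK' w)) as [d [Hd H]]; [apply Rdiv_lt_0_compat; lra|].
exists d. split; trivial. intros w' Hw.
assert (L : forall s, (a <= s <= b)%R -> (Cmod (K w' s - K w s - (w' - w) * K' w s) <= e / (b - a + 1) * Cmod (w' - w))%R).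
{ intros s Hs.
  assert (C1 : forall z, ccont (fun w => K' w s) z).
  { intros z. apply (continuous_comp_2 (V := C_UniformSpace) (W := R_UniformSpace) (fun z : C_UniformSpace => z) (fun _ => s) K').
    - apply continuous_id. - apply continuous_const. - now apply HK'. }
  assert (S := cder_segment (fun w => K w s) (fun w => K' w s) w w' (fun z => HD z s Hs) C1).
  assert (X := S). apply CI_unique in X. rewrite <- X.
  replace ((w' - w) * K' w s) with (CI (fun _ => (w' - w) * K' w s) 0 1) by (rewrite CI_const; replace (RtoC (1 - 0)) with (RtoC 1) by (f_equal; ring); ring).
  rewrite <- CI_minus.
  2:{ eexists. exact S. }
  2:{ apply ex_CI_cont. intros t _. apply continuous_const. }
  replace (e / (b - a + 1) * Cmod (w' - w))%R with ((1 - 0) * (e / (b - a + 1) * Cmod (w' - w)))%R by ring.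
  apply Cmod_CI_const; [lra| |].
  - apply ex_CI_cont. intros t _. apply continuous_Cminus; [|apply continuous_const].
    apply continuous_Cmult; [|apply continuous_const].
    apply (continuous_comp (fun s : R => w + RtoC s * (w' - w)) (fun w => K' w s)); [|apply C1].
    eapply pder_pcont, pder_line.
  - intros t Ht.
    replace (K' (w + RtoC t * (w' - w)) s * (w' - w) - (w' - w) * K' w s) with
      ((K' (w + RtoC t * (w' - w)) s - K' w s) * (w' - w)) by ring.
    rewrite Cmod_mult. apply Rmult_le_compat_r; [apply Cmod_ge_0|]. apply Rlt_le, H; trivial.
    replace (w + RtoC t * (w' - w) - w) with (RtoC t * (w' - w)) by ring.
    rewrite Cmod_mult, Cmod_R, Rabs_pos_eq by lra.
    assert (P := Cmod_ge_0 (w' - w)). nra. }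
rewrite <- CI_minus, <- CI_mult by trivial. rewrite <- CI_minus.
2:{ apply ex_CI_cont. intros s Hs. rewrite Rmin_left, Rmax_right in Hs by lra.
    apply continuous_Cminus; now apply jcont_pcont, HK. }
2:{ apply ex_CI_cont. intros s Hs. rewrite Rmin_left, Rmax_right in Hs by lra.
    apply continuous_Cmult; [apply continuous_const|now apply jcont_pcont, HK']. }
eapply Rle_trans.
- apply Cmod_CI_const; [trivial| |exact L].
  apply ex_CI_cont. intros s Hs. rewrite Rmin_left, Rmax_right in Hs by lra.
    apply continuous_Cminus; [apply continuous_Cminus; now apply jcont_pcont, HK|].
    apply continuous_Cmult; [apply continuous_const|now apply jcont_pcont, HK'].
- rewrite <- Rmult_assoc. apply Rmult_le_compat_r; [apply Cmod_ge_0|].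
  apply Rmult_le_reg_r with (b - a + 1)%R; [lra|].
  replace ((b - a) * (e / (b - a + 1)) * (b - a + 1))%R with ((b - a) * e)%R by (field; lra). nra.
Qed.

Lemma jcont_comp (F : C -> C) (g : C -> R -> C) (w : C) (s : R) :
  ccont F (g w s) -> jcont g w s -> jcont (fun w s => F (g w s)) w s.
Proof. intros HF Hg. exact (continuous_comp (fun p => g (fst p) (snd p)) F (w, s) Hg HF). Qed.

Lemma jcont_fst (w : C) (s : R) : jcont (fun w _ => w) w s.
Proof. apply (continuous_fst (U := C_UniformSpace) (V := R_UniformSpace)). Qed.

Lemma jcont_snd (w : C) (s : R) : jcont (fun _ s => RtoC s) w s.
Proof. apply continuous_RtoC. apply (continuous_snd (U := C_UniformSpace) (V := R_UniformSpace)). Qed.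

Lemma jcont_circle (t : R) (w : C) (s : R) : jcont (fun _ s => Cexp (t, s)) w s.
Proof.
apply continuous_Cexp. apply continuous_Cpair; [apply continuous_const|].
apply (continuous_snd (U := C_UniformSpace) (V := R_UniformSpace)).
Qed.

(** Cauchy's formula on the unit circle about w writes [F'] as an integral of a jointly continuous
    integrand. This comes before the differentiability of [F'], because [cder_CI] asks for a
    continuous derivative. *)
Lemma entire_derivative_continuous (F F' : C -> C) :
  (forall z, cder F z (F' z)) -> forall z, ccont F' z.
Proof.
intros HF z.
assert (N : RtoC (2 * PI) <> 0).
{ intros E. apply (f_equal fst) in E. simpl in E. assert (P := PI_RGT_0). lra. }
apply (continuous_ext (fun w => / RtoC (2 * PI) * CI (fun s => (F (w + Cexp (0%R, s)) - F w) * / Cexp (0%R, s)) 0 (2 * PI))).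
- intros w. rewrite (cauchy_derivative F w (F' w) 0); trivial.
  + match goal with |- @eq _ ?a ?b => change (@eq C a b) end. field. exact N.
  + intros u. eexists. apply HF.
- apply continuous_Cmult; [apply continuous_const|].
  apply (ccont_CI (fun w s => (F (w + Cexp (0%R, s)) - F w) * / Cexp (0%R, s))); [assert (P := PI_RGT_0); lra|].
  intros w s _. apply continuous_Cmult.
  + apply continuous_Cminus.
    * apply (jcont_comp F (fun w s => w + Cexp (0%R, s))); [eapply cder_ccont, HF|].
      apply continuous_Cplus; [apply jcont_fst|apply jcont_circle].
    * apply (jcont_comp F (fun w s => w)); [eapply cder_ccont, HF|apply jcont_fst].
  + apply continuous_Cinv; [apply jcont_circle|apply Cexp_neq_0].
Qed.

Lemma RtoC_2PI_neq_0 : RtoC (2 * PI) <> 0.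
Proof. intros E. apply (f_equal fst) in E. simpl in E. assert (P := PI_RGT_0). lra. Qed.

Lemma entire_C_derive (F : C -> C) : entire F -> forall z, cder F z (C_derive F z).
Proof. intros H z. destruct (H z) as [l Hl]. now rewrite (is_C_derive_unique _ _ _ Hl). Qed.

Lemma cder_entire (F F' : C -> C) : (forall z, cder F z (F' z)) -> entire F.
Proof. intros H z. exists (F' z). apply H. Qed.

Lemma entire_ccont (F : C -> C) : entire F -> forall z, ccont F z.
Proof. intros H z. destruct (H z) as [l Hl]. exact (cder_ccont _ _ _ Hl). Qed.

Lemma entire_derivative_entire (F F' : C -> C) : (forall z, cder F z (F' z)) -> entire F'.
Proof.
intros HF z. assert (HC := entire_derivative_continuous F F' HF).
eexists.
apply (cder_ext (fun w => / RtoC (2 * PI) * CI (fun s => (F (w + Cexp (0%R, s)) - F w) * / Cexp (0%R, s)) 0 (2 * PI))).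
- intros w. rewrite (cauchy_derivative F w (F' w) 0); trivial.
  + field. exact RtoC_2PI_neq_0.
  + exact (cder_entire F F' HF).
- apply cder_mult; [apply cder_const|].
  apply (cder_CI (fun w s => (F (w + Cexp (0%R, s)) - F w) * / Cexp (0%R, s))
    (fun w s => (F' (w + Cexp (0%R, s)) - F' w) * / Cexp (0%R, s))); [assert (P := PI_RGT_0); lra| | |].
  + intros w s _. eapply cder_eq.
    * apply cder_mult; [|apply cder_const]. apply cder_minus; [|apply HF].
      apply (cder_comp F (fun w => w + Cexp (0%R, s))); [apply HF|].
      apply cder_plus; [apply cder_id|apply cder_const].
    * cbv beta. ring.
  + intros w s _. apply continuous_Cmult.
    * apply continuous_Cminus.
      -- apply (jcont_comp F (fun w s => w + Cexp (0%R, s))); [eapply cder_ccont, HF|].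
         apply continuous_Cplus; [apply jcont_fst|apply jcont_circle].
      -- apply (jcont_comp F (fun w s => w)); [eapply cder_ccont, HF|apply jcont_fst].
    * apply continuous_Cinv; [apply jcont_circle|apply Cexp_neq_0].
  + intros w s _. apply continuous_Cmult.
    * apply continuous_Cminus.
      -- apply (jcont_comp F' (fun w s => w + Cexp (0%R, s))); [apply HC|].
         apply continuous_Cplus; [apply jcont_fst|apply jcont_circle].
      -- apply (jcont_comp F' (fun w s => w)); [apply HC|apply jcont_fst].
    * apply continuous_Cinv; [apply jcont_circle|apply Cexp_neq_0].
Qed.

(** * Primitives, logarithms and difference quotients *)

Lemma jcont_scale (w z : C) (s : R) : jcont (fun w s => z + RtoC s * (w - z)) w s.
Proof.
apply continuous_Cplus; [apply continuous_const|]. apply continuous_Cmult; [apply jcont_snd|].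
apply continuous_Cminus; [apply jcont_fst|apply continuous_const].
Qed.

Lemma pder_mult (f g : R -> C) (x : R) (a b : C) :
  pder f x a -> pder g x b -> pder (fun t => f t * g t) x (a * g x + f x * b).
Proof.
intros Hf Hg.
assert (Hf1 := pder_Re _ _ _ Hf). assert (Hf2 := pder_Im _ _ _ Hf).
assert (Hg1 := pder_Re _ _ _ Hg). assert (Hg2 := pder_Im _ _ _ Hg).
assert (M : forall u v (u' v' : R), is_derive u x u' -> is_derive v x v' ->
   is_derive (fun t => u t * v t)%R x (u' * v x + u x * v')%R).
{ intros u v u' v' Hu Hv. apply (is_derive_mult u v x u' v' Hu Hv). exact Rmult_comm. }
assert (P : pder (fun t => (Re (f t) * Re (g t) - Im (f t) * Im (g t), Re (f t) * Im (g t) + Im (f t) * Re (g t))%R : C) x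
   ((Re a * Re (g x) + Re (f x) * Re b) - (Im a * Im (g x) + Im (f x) * Im b),
    (Re a * Im (g x) + Re (f x) * Im b) + (Im a * Re (g x) + Im (f x) * Re b))%R).
{ apply pder_pair.
  - apply (is_derive_minus (V := R_NormedModule) (fun t => Re (f t) * Re (g t))%R (fun t => Im (f t) * Im (g t))%R); now apply M.
  - apply (is_derive_plus (V := R_NormedModule) (fun t => Re (f t) * Im (g t))%R (fun t => Im (f t) * Re (g t))%R); now apply M. }
replace (a * g x + f x * b) with (((Re a * Re (g x) + Re (f x) * Re b) - (Im a * Im (g x) + Im (f x) * Im b),
    (Re a * Im (g x) + Re (f x) * Im b) + (Im a * Re (g x) + Im (f x) * Re b))%R : C).
2:{ unfold Re, Im. apply injective_projections; simpl; ring. }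
exact P.
Qed.

Lemma pder_RtoC (s : R) : pder RtoC s 1.
Proof. apply pder_horizontal. Qed.

Lemma cder_CInt (h : C -> C) (a z : C) : entire h -> cder (CInt h a) z (h z).
Proof.
intros Hh. assert (D := entire_C_derive h Hh). set (h' := C_derive h) in *.
assert (HC := entire_ccont h Hh). assert (HC' := entire_derivative_continuous h h' D).
(* Differentiating under the integral produces this integrand, which is the s-derivative of s h (a +
   s (z - a)); that function runs from 0 to [h z]. *)
assert (E : CI (fun s => h' (a + RtoC s * (z - a)) * (RtoC s * (z - a)) + h (a + RtoC s * (z - a))) 0 1 = h z).
{ apply CI_unique.
  replace (h z) with (RtoC 1 * h (a + RtoC 1 * (z - a)) - RtoC 0 * h (a + RtoC 0 * (z - a))).
  2:{ replace (a + RtoC 1 * (z - a)) with z by ring. ring. }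
  assert (L : forall s, pcont (fun s => a + RtoC s * (z - a)) s) by (intros s; eapply pder_pcont, pder_line).
  apply (is_CI_derive (fun s => RtoC s * h (a + RtoC s * (z - a)))); intros s _.
  - replace (h' (a + RtoC s * (z - a)) * (RtoC s * (z - a)) + h (a + RtoC s * (z - a))) with
    (1 * h (a + RtoC s * (z - a)) + RtoC s * ((z - a) * h' (a + RtoC s * (z - a)))) by ring.
    apply pder_mult; [apply pder_RtoC|].
    apply (pder_comp h (fun s => a + RtoC s * (z - a))); [apply D|apply pder_line].
  - apply continuous_Cplus; [apply continuous_Cmult; [|apply continuous_Cmult; [|apply continuous_const]]|].
    + exact (continuous_comp _ h' s (L s) (HC' _)).
    + eapply pder_pcont, pder_RtoC.
    + exact (continuous_comp _ h s (L s) (HC _)). }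
rewrite <- E.
apply (cder_CI (fun w s => h (a + RtoC s * (w - a)) * (w - a))
  (fun w s => h' (a + RtoC s * (w - a)) * (RtoC s * (w - a)) + h (a + RtoC s * (w - a)))); [lra| | |].
- intros w s _. eapply cder_eq.
  + apply cder_mult; [|apply cder_minus; [apply cder_id|apply cder_const]].
    apply (cder_comp h (fun w => a + RtoC s * (w - a))); [apply D|].
    apply cder_plus; [apply cder_const|]. apply cder_mult; [apply cder_const|].
    apply cder_minus; [apply cder_id|apply cder_const].
  + cbv beta. ring.
- intros w s _. apply continuous_Cmult.
  + apply (jcont_comp h (fun w s => a + RtoC s * (w - a))); [apply HC|apply jcont_scale].
  + apply continuous_Cminus; [apply jcont_fst|apply continuous_const].
- intros w s _. apply continuous_Cplus; [apply continuous_Cmult; [|apply continuous_Cmult]|].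
  + apply (jcont_comp h' (fun w s => a + RtoC s * (w - a))); [apply HC'|apply jcont_scale].
  + apply jcont_snd.
  + apply continuous_Cminus; [apply jcont_fst|apply continuous_const].
  + apply (jcont_comp h (fun w s => a + RtoC s * (w - a))); [apply HC|apply jcont_scale].
Qed.

Lemma entire_comp (f g : C -> C) : entire f -> entire g -> entire (fun z => f (g z)).
Proof.
intros Hf Hg z. destruct (Hg z) as [b Hb]. destruct (Hf (g z)) as [a Ha].
eexists. exact (cder_comp f g z a b Ha Hb).
Qed.

(** The candidate is a primitive of F' / F started at a logarithm of [F 0]: then F exp (- h) has
    derivative 0 and takes the value 1 at the origin. *)
Lemma entire_log (F : C -> C) : entire F -> (forall z, F z <> 0) ->
  exists h, entire h /\ forall z, F z = Cexp (h z).
Proof.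
intros HF H0. assert (D := entire_C_derive F HF). set (F' := C_derive F) in *.
assert (HF' := entire_derivative_entire F F' D).
assert (Q : entire (fun z => F' z * / F z)).
{ intros z. eexists. apply cder_mult.
  - apply entire_C_derive, HF'.
  - apply (cder_comp Cinv F); [apply cder_inv, H0|apply D]. }
destruct (Cexp_surj (F 0) (H0 0)) as [c Hc].
set (h := fun z => c + CInt (fun z => F' z * / F z) 0 z).
assert (Dh : forall z, cder h z (F' z * / F z)).
{ intros z. eapply cder_eq; [apply cder_plus; [apply cder_const|]|].
  - apply cder_CInt, Q.
  - cbv beta. ring. }
exists h. split; [exact (cder_entire _ _ Dh)|]. intros z.
assert (K : forall z w, F z * Cexp (- h z) = F w * Cexp (- h w)).
{ apply (cder_zero_const (fun z => F z * Cexp (- h z))). intros w. eapply cder_eq.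
  - apply cder_mult; [apply D|]. apply (cder_comp Cexp (fun z => - h z)); [apply cder_Cexp|].
    apply cder_opp, Dh.
  - cbv beta. field. apply H0. }
specialize (K z 0).
assert (Eh : h 0 = c).
{ unfold h. replace (CInt (fun z => F' z * / F z) 0 0) with (RtoC 0); [ring|].
  change (RtoC 0 = CI (fun s => F' (0 + RtoC s * (0 - 0)) * / F (0 + RtoC s * (0 - 0)) * (0 - 0)) 0 1).
  rewrite (CI_ext _ (fun _ => 0)) by (intros; ring). rewrite CI_const. ring. }
rewrite Eh, <- Hc, (Cmult_comm (Cexp c)), Cexp_opp_l in K.
replace (F z) with (F z * Cexp (- h z) * Cexp (h z)); [rewrite K; ring|].
rewrite <- Cmult_assoc, Cexp_opp_l. ring.
Qed.

Lemma CI_conj (f : R -> C) (a b : R) : ex_CI f a b -> CI (fun s => Cconj (f s)) a b = Cconj (CI f a b).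
Proof.
intros H. apply CI_unique. apply CI_correct, is_CI_iff in H. apply is_CI_iff. destruct H as [H1 H2].
split; [exact H1|]. exact (is_RInt_opp _ _ _ _ H2).
Qed.

Lemma Cconj_mult (z w : C) : Cconj (z * w) = Cconj z * Cconj w.
Proof. apply injective_projections; simpl; ring. Qed.

(** The mean of h' over the segment from z to w is the difference quotient for w distinct from z,
    and is visibly holomorphic at w = z as well. *)
Lemma entire_quotient (h : C -> C) (z : C) : entire h ->
  exists q, entire q /\ forall w, q w * (w - z) = h w - h z.
Proof.
intros Hh. assert (D := entire_C_derive h Hh). set (h' := C_derive h) in *.
assert (Hh' := entire_derivative_entire h h' D).
assert (D' := entire_C_derive h' Hh'). set (h'' := C_derive h') in *.
assert (HC' := entire_derivative_continuous h h' D). assert (HC'' := entire_derivative_continuous h' h'' D').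
assert (L : forall w s, pcont (fun s => z + RtoC s * (w - z)) s) by (intros w s; eapply pder_pcont, pder_line).
exists (fun w => CI (fun s => h' (z + RtoC s * (w - z))) 0 1). split.
- intros w. eexists. apply (cder_CI (fun w s => h' (z + RtoC s * (w - z))) (fun w s => RtoC s * h'' (z + RtoC s * (w - z)))); [lra| | |].
  + intros u s _. eapply cder_eq.
    * apply (cder_comp h' (fun w => z + RtoC s * (w - z))); [apply D'|].
      apply cder_plus; [apply cder_const|]. apply cder_mult; [apply cder_const|].
      apply cder_minus; [apply cder_id|apply cder_const].
    * cbv beta. ring.
  + intros u s _. apply (jcont_comp h' (fun w s => z + RtoC s * (w - z))); [apply HC'|apply jcont_scale].
  + intros u s _. apply continuous_Cmult; [apply jcont_snd|].
    apply (jcont_comp h'' (fun w s => z + RtoC s * (w - z))); [apply HC''|apply jcont_scale].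
- intros w. rewrite Cmult_comm, <- CI_mult.
  2:{ apply ex_CI_cont. intros s _. exact (continuous_comp _ h' s (L w s) (HC' _)). }
  apply CI_unique. apply (is_RInt_ext (V := C_R_NormedModule) (fun s => h' (z + RtoC s * (w - z)) * (w - z))).
  + intros s _. apply Cmult_comm.
  + now apply cder_segment.
Qed.

(** * The Borel-Caratheodory inequality *)

Lemma pcont_circle (t s : R) : pcont (fun s => Cexp (t, s)) s.
Proof.
apply continuous_Cexp, continuous_Cpair; [apply continuous_const|apply continuous_id].
Qed.

Lemma pcont_on_circle (F : C -> C) (t s : R) : entire F -> pcont (fun s => F (Cexp (t, s))) s.
Proof.
intros HF. exact (continuous_comp _ F s (pcont_circle t s) (entire_ccont F HF _)).
Qed.

Lemma mean_value_0 (F : C -> C) (t : R) : entire F ->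
  CI (fun s => F (Cexp (t, s))) 0 (2 * PI) = RtoC (2 * PI) * F 0.
Proof.
intros HF. rewrite <- (mean_value F 0 t) by (intros w _; apply HF).
apply CI_ext. intros s _. now rewrite Cplus_0_l.
Qed.

Lemma Cexp_conj (t s : R) : Cconj (Cexp (t, s)) = RtoC (exp (2 * t)) * / Cexp (t, s).
Proof.
assert (N := Cexp_neq_0 (t, s)).
replace (RtoC (exp (2 * t))) with (Cexp (t, s) * Cconj (Cexp (t, s))); [field; exact N|].
unfold Cexp; simpl. apply injective_projections; simpl; [|ring].
replace (2 * t)%R with (t + t)%R by ring. rewrite exp_plus.
replace (exp t * cos s * (exp t * cos s) - exp t * sin s * - (exp t * sin s))%R with
  (exp t * exp t * (Rsqr (sin s) + Rsqr (cos s)))%R by (unfold Rsqr; ring).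
rewrite sin2_cos2. ring.
Qed.

Lemma kernel_bounds (z : C) (t s : R) : (2 * Cmod z <= exp t)%R ->
  Cexp (t, s) - z <> 0 /\ (Cmod (Cexp (t, s) * / (Cexp (t, s) - z)) <= 2)%R.
Proof.
intros Hz. assert (M := Cmod_Cexp (t, s)). simpl in M. assert (P := exp_pos t).
set (u := Cexp (t, s)) in *.
assert (T := Cmod_triangle (u - z) z). replace (u - z + z) with u in T by ring.
assert (N : u - z <> 0) by (apply Cmod_gt_0; lra).
split; trivial. rewrite Cmod_mult, Cmod_inv by trivial.
apply Rmult_le_reg_r with (Cmod (u - z)); [lra|].
rewrite Rmult_assoc, Rinv_l, Rmult_1_r by lra. lra.
Qed.

(* Reflecting [w] to [exp (2 t) / Cconj w] turns the conjugate of the Cauchy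
   kernel on the circle of radius [exp t] into a function holomorphic inside. *)
Lemma conj_kernel_mean (h : C -> C) (z : C) (t : R) : entire h -> (2 * Cmod z <= exp t)%R ->
  CI (fun s => Cconj (h (Cexp (t, s))) * (Cexp (t, s) * / (Cexp (t, s) - z))) 0 (2 * PI)
  = RtoC (2 * PI) * Cconj (h 0).
Proof.
intros Hh Hz. assert (P := exp_pos t).
set (R2 := exp (2 * t)).
assert (ER : (R2 = exp t * exp t)%R) by (unfold R2; replace (2 * t)%R with (t + t)%R by ring; apply exp_plus).
assert (PR : (0 < R2)%R) by apply exp_pos.
set (k := fun w => h w * (RtoC R2 * / (RtoC R2 - Cconj z * w))).
assert (NZ : forall w, (Cmod w <= exp t)%R -> RtoC R2 - Cconj z * w <> 0).
{ intros w Hw. apply Cmod_gt_0.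
  assert (T := Cmod_triangle (RtoC R2 - Cconj z * w) (Cconj z * w)).
  replace (RtoC R2 - Cconj z * w + Cconj z * w) with (RtoC R2) in T by ring.
  rewrite Cmod_mult, Cmod_conj, Cmod_R, Rabs_pos_eq in T by lra.
  assert (Cmod z * Cmod w <= exp t / 2 * exp t)%R.
  { apply Rmult_le_compat; try apply Cmod_ge_0; lra. }
  nra. }
assert (Dk : forall w, (Cmod (w - 0) <= exp t)%R -> exists l, cder k w l).
{ intros w Hw. replace (w - 0) with w in Hw by ring. destruct (Hh w) as [l Hl].
  eexists. apply cder_mult; [exact Hl|]. apply cder_mult; [apply cder_const|].
  apply (cder_comp Cinv (fun w => RtoC R2 - Cconj z * w)); [now apply cder_inv, NZ|].
  apply cder_minus; [apply cder_const|]. apply cder_mult; [apply cder_const|apply cder_id]. }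
assert (MV := mean_value k 0 t Dk).
assert (E0 : k 0 = h 0).
{ unfold k. replace (RtoC R2 - Cconj z * 0) with (RtoC R2) by ring. field.
  intros E. apply (f_equal fst) in E. simpl in E. lra. }
assert (CM : forall s, Cmod (Cexp (t, s)) = exp t) by (intros; rewrite Cmod_Cexp; reflexivity).
rewrite (CI_ext _ (fun s => Cconj (k (0 + Cexp (t, s))))).
2:{ intros s _. rewrite Cplus_0_l. unfold k. rewrite Cconj_mult. f_equal.
    assert (N := Cexp_neq_0 (t, s)). destruct (kernel_bounds z t s Hz) as [N1 _].
    rewrite Cconj_mult.
    assert (Cc : Cconj (RtoC R2) = RtoC R2) by (apply injective_projections; simpl; ring).
    assert (E : Cconj (RtoC R2 - Cconj z * Cexp (t, s)) = RtoC R2 * / Cexp (t, s) * (Cexp (t, s) - z)).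
    { transitivity (RtoC R2 - z * Cconj (Cexp (t, s))).
      - apply injective_projections; simpl; ring.
      - rewrite Cexp_conj. fold R2. field. exact N. }
    rewrite Cc, Cinv_conj by (apply NZ; rewrite CM; lra). rewrite E. field.
    repeat split; trivial. intros E'. apply (f_equal fst) in E'. simpl in E'. lra. }
rewrite CI_conj, MV, E0.
- rewrite Cconj_mult. f_equal. apply injective_projections; simpl; ring.
- apply ex_CI_cont. intros s _.
  apply (continuous_comp (fun s => 0 + Cexp (t, s)) k).
  + apply continuous_Cplus; [apply continuous_const|apply pcont_circle].
  + destruct (Dk (0 + Cexp (t, s))) as [l Hl]; [|eapply cder_ccont, Hl].
    replace (0 + Cexp (t, s) - 0) with (Cexp (t, s)) by ring. rewrite CM. lra.
Qed.

(** Cauchy's formula for h and [conj_kernel_mean] use the same kernel; their sum contains h only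
    through its real part on the circle. *)
Lemma schwarz_formula (h : C -> C) (z : C) (t : R) : entire h -> (2 * Cmod z <= exp t)%R ->
  CI (fun s => RtoC (2 * Re (h (Cexp (t, s)))) * (Cexp (t, s) * / (Cexp (t, s) - z))) 0 (2 * PI)
  = RtoC (2 * PI) * (h z + Cconj (h 0)).
Proof.
intros Hh Hz.
assert (CK : forall s, pcont (fun s => Cexp (t, s) * / (Cexp (t, s) - z)) s).
{ intros s. apply continuous_Cmult; [apply pcont_circle|]. apply continuous_Cinv.
  - apply continuous_Cminus; [apply pcont_circle|apply continuous_const].
  - now apply kernel_bounds. }
(* The constant 1 is its own conjugate, so the conjugate formula already gives the mean of the
   kernel. *)
assert (K1 : CI (fun s => Cexp (t, s) * / (Cexp (t, s) - z)) 0 (2 * PI) = RtoC (2 * PI)).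
{ assert (X := conj_kernel_mean (fun _ => 1) z t (cder_entire _ _ (cder_const 1)) Hz).
  cbv beta in X. replace (Cconj 1) with (RtoC 1) in X by (apply injective_projections; simpl; ring).
  rewrite Cmult_1_r in X. rewrite <- X. apply CI_ext. intros s _. ring. }
destruct (entire_quotient h z Hh) as [q [Hq Eq]].
assert (Q0 : CI (fun s => q (Cexp (t, s)) * Cexp (t, s)) 0 (2 * PI) = 0).
{ rewrite (mean_value_0 (fun w => q w * w)); [ring|]. intros w. destruct (Hq w) as [l Hl].
  eexists. apply cder_mult; [exact Hl|apply cder_id]. }
(* With u the point of the circle, h(u) u / (u - z) = q(u) u + h(z) u / (u - z), and the first term
   is the value of an entire function vanishing at 0. *)
assert (I1 : CI (fun s => h (Cexp (t, s)) * (Cexp (t, s) * / (Cexp (t, s) - z))) 0 (2 * PI) = RtoC (2 * PI) * h z).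
{ rewrite (CI_ext _ (fun s => q (Cexp (t, s)) * Cexp (t, s) + h z * (Cexp (t, s) * / (Cexp (t, s) - z)))).
  - rewrite CI_plus, Q0, CI_mult, K1.
    + ring.
    + now apply ex_CI_cont.
    + apply ex_CI_cont. intros s _. apply continuous_Cmult; [now apply pcont_on_circle|apply pcont_circle].
    + apply ex_CI_cont. intros s _. apply continuous_Cmult; [apply continuous_const|apply CK].
  - intros s _. destruct (kernel_bounds z t s Hz) as [N _].
    assert (E := Eq (Cexp (t, s))).
    replace (h (Cexp (t, s))) with (q (Cexp (t, s)) * (Cexp (t, s) - z) + h z) by (rewrite E; ring).
    field. exact N. }
assert (I2 := conj_kernel_mean h z t Hh Hz).
rewrite Cmult_plus_distr_l, <- I1, <- I2, <- CI_plus.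
- apply CI_ext. intros s _. rewrite <- Cmult_plus_distr_r. f_equal.
  apply injective_projections; simpl; unfold Re, Im; ring.
- apply ex_CI_cont. intros s _. apply continuous_Cmult; [now apply pcont_on_circle|apply CK].
- apply ex_CI_cont. intros s _. apply continuous_Cmult; [|apply CK].
  apply continuous_C.
  + now apply (continuous_Re (fun s => h (Cexp (t, s)))), pcont_on_circle.
  + apply (continuous_opp (fun s => Im (h (Cexp (t, s))))).
    now apply (continuous_Im (fun s => h (Cexp (t, s)))), pcont_on_circle.
Qed.

Lemma continuous_Rmax_0 {T : UniformSpace} (f : T -> R) (x : T) :
  continuous f x -> continuous (fun t => Rmax 0 (f t)) x.
Proof.
intros Hf. apply (continuous_ext (fun t => (f t + Rabs (f t)) * / 2)%R).
- intros t. unfold Rmax, Rabs. destruct Rle_dec, Rcase_abs; simpl; lra.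
- apply (continuous_mult (K := R_AbsRing) (fun t => f t + Rabs (f t))%R (fun _ => / 2)%R); [|apply continuous_const].
  apply (continuous_plus f (fun t => Rabs (f t))); trivial.
  apply (continuous_comp f Rabs); trivial. apply continuous_Rabs.
Qed.

Lemma ex_RInt_Re_circle (h : C -> C) (t : R) : entire h ->
  ex_RInt (fun s => Re (h (Cexp (t, s)))) 0 (2 * PI).
Proof.
intros Hh. apply (ex_RInt_continuous (V := R_CompleteNormedModule)). intros s _.
now apply (continuous_Re (fun s => h (Cexp (t, s)))), pcont_on_circle.
Qed.

Lemma ex_RInt_Rmax_circle (h : C -> C) (t : R) : entire h ->
  ex_RInt (fun s => Rmax 0 (Re (h (Cexp (t, s))))) 0 (2 * PI).
Proof.
intros Hh. apply (ex_RInt_continuous (V := R_CompleteNormedModule)). intros s _.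
apply (continuous_Rmax_0 (fun s => Re (h (Cexp (t, s))))).
now apply (continuous_Re (fun s => h (Cexp (t, s)))), pcont_on_circle.
Qed.

(** The mean of Re h is Re h(0), so the mean of its positive part controls the mean of |Re h|. A
    bound in terms of the mean, instead of the maximum, is what the characteristic can supply. *)
Lemma borel_caratheodory_L1 (h : C -> C) (z : C) (t : R) : entire h -> (2 * Cmod z <= exp t)%R ->
  (PI * Cmod (h z) <= 5 * PI * Cmod (h 0) + 4 * RInt (fun s => Rmax 0 (Re (h (Cexp (t, s))))) 0 (2 * PI))%R.
Proof.
intros Hh Hz. assert (PP := PI_RGT_0).
assert (S := schwarz_formula h z t Hh Hz).
assert (I1 := ex_RInt_Re_circle h t Hh). assert (I2 := ex_RInt_Rmax_circle h t Hh).
assert (E1 : RInt (fun s => Re (h (Cexp (t, s)))) 0 (2 * PI) = (2 * PI * Re (h 0))%R).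
{ rewrite <- CI_Re, (mean_value_0 h t Hh).
  - unfold Re. simpl. ring.
  - apply ex_CI_cont. intros s _. now apply pcont_on_circle. }
set (J := RInt (fun s => Rmax 0 (Re (h (Cexp (t, s))))) 0 (2 * PI)) in *.
assert (B : (Cmod (RtoC (2 * PI) * (h z + Cconj (h 0))) <= 8 * J - 8 * PI * Re (h 0))%R).
{ rewrite <- S.
  (* The integrand is 8 max(0, x) - 4 x = 4 |x| with x = Re h: a factor 2 comes from the formula and
     a factor 2 from the bound on the kernel. *)
  replace (8 * J - 8 * PI * Re (h 0))%R with
    (RInt (fun s => 8 * Rmax 0 (Re (h (Cexp (t, s)))) - 4 * Re (h (Cexp (t, s))))%R 0 (2 * PI)).
  2:{ apply is_RInt_unique. replace (8 * J - 8 * PI * Re (h 0))%R with (8 * J - 4 * (2 * PI * Re (h 0)))%R by ring.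
      rewrite <- E1.
      apply (is_RInt_minus (V := R_NormedModule) (fun s => 8 * Rmax 0 (Re (h (Cexp (t, s)))))%R (fun s => 4 * Re (h (Cexp (t, s))))%R).
      - apply (is_RInt_scal (V := R_NormedModule)), (RInt_correct (V := R_CompleteNormedModule)), I2.
      - apply (is_RInt_scal (V := R_NormedModule)), (RInt_correct (V := R_CompleteNormedModule)), I1. }
  apply Cmod_CI_le; [lra| | |].
  - apply ex_CI_cont. intros s _. apply continuous_Cmult.
    + apply continuous_RtoC.
      apply (continuous_mult (K := R_AbsRing) (fun _ => 2) (fun s => Re (h (Cexp (t, s))))); [apply continuous_const|].
      now apply (continuous_Re (fun s => h (Cexp (t, s)))), pcont_on_circle.
    + apply continuous_Cmult; [apply pcont_circle|]. apply continuous_Cinv.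
      * apply continuous_Cminus; [apply pcont_circle|apply continuous_const].
      * now apply kernel_bounds.
  - apply (ex_RInt_minus (V := R_NormedModule) (fun s => 8 * Rmax 0 (Re (h (Cexp (t, s)))))%R (fun s => 4 * Re (h (Cexp (t, s))))%R).
    + now apply (ex_RInt_scal (V := R_NormedModule)).
    + now apply (ex_RInt_scal (V := R_NormedModule)).
  - intros s _. destruct (kernel_bounds z t s Hz) as [_ K]. rewrite Cmod_mult, Cmod_R.
    set (x := Re (h (Cexp (t, s)))).
    apply Rle_trans with (Rabs (2 * x) * 2)%R; [apply Rmult_le_compat_l; [apply Rabs_pos|exact K]|].
    unfold Rabs, Rmax. destruct Rcase_abs, Rle_dec; lra. }
rewrite Cmod_mult, Cmod_R, Rabs_pos_eq in B by lra.
assert (T := Cmod_triangle (h z + Cconj (h 0)) (- Cconj (h 0))).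
rewrite Cmod_opp, Cmod_conj in T. replace (h z + Cconj (h 0) + - Cconj (h 0)) with (h z) in T by ring.
assert (T2 := re_le_Cmod (h 0)). apply Rabs_le_between in T2.
apply (Rmult_le_compat_l PI) in T; [|lra].
assert (PI * (- Cmod (h 0)) <= PI * Re (h 0))%R by (apply Rmult_le_compat_l; lra).
lra.
Qed.

(** * Laplacians of radial functions of an entire function *)

Lemma rcont_vertical (f : C -> R) (t s : R) : rcont f (t, s) -> continuous (fun s => f (t, s)) s.
Proof.
intros H. apply (continuous_comp (fun s : R => (t, s) : C_UniformSpace) f); trivial.
eapply pder_pcont, pder_vertical.
Qed.

Lemma ex_RInt_vertical (f : C -> R) (t a b : R) : (forall z, rcont f z) ->
  ex_RInt (fun s => f (t, s)) a b.
Proof.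
intros H. apply (ex_RInt_continuous (V := R_CompleteNormedModule)). intros s _.
now apply rcont_vertical.
Qed.

Lemma is_derive_RInt_vertical (f f1 : C -> R) (a b t : R) :
  (forall t s, is_derive (fun u => f (u, s)) t (f1 (t, s))) ->
  (forall z, rcont f z) -> (forall z, rcont f1 z) ->
  is_derive (fun t => RInt (fun s => f (t, s)) a b) t (RInt (fun s => f1 (t, s)) a b).
Proof.
intros D Hf Hf1.
rewrite <- (RInt_ext (fun s => Derive (fun u => f (u, s)) t)).
2:{ intros s _. apply is_derive_unique, D. }
apply (is_derive_RInt_param (fun t s => f (t, s))).
- exists (mkposreal 1 Rlt_0_1). intros u _ s _. eexists. apply D.
- intros s _. apply (continuity_2d_pt_ext (fun u v => f1 (u, v))).
  + intros u v. symmetry. apply is_derive_unique, D.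
  + apply continuity_2d_pt_filterlim.
    apply (filterlim_ext f1); [now intros [u v]|]. apply (Hf1 (t, s)).
- exists (mkposreal 1 Rlt_0_1). intros u _. now apply ex_RInt_vertical.
Qed.

(** The squared modulus, kept polynomial in the real and imaginary parts so that it can be
    differentiated at zeros too. *)
Definition Csq (w : C) : R := (Re w * Re w + Im w * Im w)%R.

Lemma Csq_Cmod (w : C) : Csq w = (Cmod w * Cmod w)%R.
Proof.
assert (E := Cmod2_alt w). unfold Csq. simpl in E. lra.
Qed.

Lemma Csq_ge_0 (w : C) : (0 <= Csq w)%R.
Proof. unfold Csq. nra. Qed.

Lemma Csq_mult (z w : C) : Csq (z * w) = (Csq z * Csq w)%R.
Proof. rewrite !Csq_Cmod, Cmod_mult. ring. Qed.

Lemma rcont_Re (F : C -> C) (z : C) : ccont F z -> rcont (fun w => Re (F w)) z.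
Proof. apply (continuous_Re (T := C_UniformSpace)). Qed.

Lemma rcont_Im (F : C -> C) (z : C) : ccont F z -> rcont (fun w => Im (F w)) z.
Proof. apply (continuous_Im (T := C_UniformSpace)). Qed.

Lemma rcont_mult (f g : C -> R) (z : C) : rcont f z -> rcont g z -> rcont (fun w => f w * g w)%R z.
Proof. apply (continuous_mult (U := C_UniformSpace) (K := R_AbsRing)). Qed.

Lemma rcont_plus (f g : C -> R) (z : C) : rcont f z -> rcont g z -> rcont (fun w => f w + g w)%R z.
Proof. apply (continuous_plus (U := C_UniformSpace) (V := R_NormedModule)). Qed.

Lemma rcont_minus (f g : C -> R) (z : C) : rcont f z -> rcont g z -> rcont (fun w => f w - g w)%R z.
Proof. apply (continuous_minus (U := C_UniformSpace) (V := R_NormedModule)). Qed.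

Lemma rcont_const (c : R) (z : C) : rcont (fun _ => c) z.
Proof. apply continuous_const. Qed.

Lemma rcont_Csq (F : C -> C) (z : C) : ccont F z -> rcont (fun w => Csq (F w)) z.
Proof.
intros H. assert (H1 := rcont_Re F z H). assert (H2 := rcont_Im F z H).
exact (rcont_plus _ _ z (rcont_mult _ _ z H1 H1) (rcont_mult _ _ z H2 H2)).
Qed.

Lemma horizontal_der (F F1 : C -> C) (t s : R) : (forall z, cder F z (F1 z)) ->
  is_derive (fun u => Re (F (u, s))) t (Re (F1 (t, s))) /\
  is_derive (fun u => Im (F (u, s))) t (Im (F1 (t, s))).
Proof.
intros H. assert (D : pder (fun u => F (u, s)) t (F1 (t, s))).
{ rewrite <- (Cmult_1_l (F1 (t, s))). apply (pder_comp F (fun u => (u, s))); [apply H|apply pder_horizontal]. }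
split; [exact (pder_Re _ _ _ D)|exact (pder_Im _ _ _ D)].
Qed.

(** The Cauchy-Riemann equations: moving vertically multiplies the derivative by i. *)
Lemma vertical_der (F F1 : C -> C) (t s : R) : (forall z, cder F z (F1 z)) ->
  is_derive (fun u => Re (F (t, u))) s (- Im (F1 (t, s)))%R /\
  is_derive (fun u => Im (F (t, u))) s (Re (F1 (t, s))).
Proof.
intros H. assert (D : pder (fun u => F (t, u)) s (Ci * F1 (t, s))).
{ apply (pder_comp F (fun u => (t, u))); [apply H|apply pder_vertical]. }
split.
- replace (- Im (F1 (t, s)))%R with (Re (Ci * F1 (t, s))) by (unfold Re, Im; simpl; ring). exact (pder_Re _ _ _ D).
- replace (Re (F1 (t, s)))%R with (Im (Ci * F1 (t, s))) by (unfold Re, Im; simpl; ring). exact (pder_Im _ _ _ D).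
Qed.

Lemma der_mult (u v : R -> R) (x a b : R) : is_derive u x a -> is_derive v x b ->
  is_derive (fun t => u t * v t)%R x (a * v x + u x * b)%R.
Proof. intros Hu Hv. apply (is_derive_mult u v x a b Hu Hv). exact Rmult_comm. Qed.

Lemma der_plus (u v : R -> R) (x a b : R) : is_derive u x a -> is_derive v x b ->
  is_derive (fun t => u t + v t)%R x (a + b)%R.
Proof. apply (is_derive_plus (V := R_NormedModule)). Qed.

Lemma der_minus (u v : R -> R) (x a b : R) : is_derive u x a -> is_derive v x b ->
  is_derive (fun t => u t - v t)%R x (a - b)%R.
Proof. apply (is_derive_minus (V := R_NormedModule)). Qed.

Lemma der_const (c x : R) : is_derive (fun _ : R => c) x 0%R.
Proof. apply (is_derive_const (V := R_NormedModule)). Qed.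

Lemma der_comp (u v : R -> R) (x a b : R) : is_derive u (v x) a -> is_derive v x b ->
  is_derive (fun t => u (v t)) x (b * a)%R.
Proof. apply (is_derive_comp (V := R_NormedModule)). Qed.

Lemma der_eq (u : R -> R) (x a b : R) : is_derive u x a -> a = b -> is_derive u x b.
Proof. now intros H <-. Qed.

Section Laplacian.
Variables (e0 e1 e2 : R -> R).
Hypothesis e0_derive : forall x, (0 <= x)%R -> is_derive e0 x (e1 x).
Hypothesis e1_derive : forall x, (0 <= x)%R -> is_derive e1 x (e2 x).
Hypothesis e2_cont : forall x, (0 <= x)%R -> continuous e2 x.
Variables (G G1 G2 : C -> C).
Hypothesis G_der : forall z, cder G z (G1 z).
Hypothesis G1_der : forall z, cder G1 z (G2 z).
Hypothesis G_per : forall t, G (t, 2 * PI)%R = G (t, 0%R).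
Hypothesis G1_per : forall t, G1 (t, 2 * PI)%R = G1 (t, 0%R).

(** The suffixes [t] and [s] denote partial derivatives in the variable t + i s. Since d/ds acts on
    holomorphic functions as i times the complex derivative, the [G2] term changes sign between
    [Ntt] and [Nss]. *)
Let N z := Csq (G z).
Let Nt z := (2 * (Re (G z) * Re (G1 z) + Im (G z) * Im (G1 z)))%R.
Let Ns z := (2 * (Im (G z) * Re (G1 z) - Re (G z) * Im (G1 z)))%R.
Let Ntt z := (2 * (Csq (G1 z) + (Re (G z) * Re (G2 z) + Im (G z) * Im (G2 z))))%R.
Let Nss z := (2 * (Csq (G1 z) - (Re (G z) * Re (G2 z) + Im (G z) * Im (G2 z))))%R.

Lemma Csq_dt t s : is_derive (fun u => N (u, s)) t (Nt (t, s)).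
Proof.
destruct (horizontal_der G G1 t s G_der) as [H1 H2].
eapply der_eq; [exact (der_plus _ _ _ _ _ (der_mult _ _ _ _ _ H1 H1) (der_mult _ _ _ _ _ H2 H2))|].
unfold Nt. change (AbsRing.sort R_AbsRing) with R in *. ring.
Qed.

Lemma Csq_ds t s : is_derive (fun u => N (t, u)) s (Ns (t, s)).
Proof.
destruct (vertical_der G G1 t s G_der) as [H1 H2].
eapply der_eq; [exact (der_plus _ _ _ _ _ (der_mult _ _ _ _ _ H1 H1) (der_mult _ _ _ _ _ H2 H2))|].
unfold Ns. change (AbsRing.sort R_AbsRing) with R in *. ring.
Qed.

Lemma Csq_dtt t s : is_derive (fun u => Nt (u, s)) t (Ntt (t, s)).
Proof.
destruct (horizontal_der G G1 t s G_der) as [H1 H2]. destruct (horizontal_der G1 G2 t s G1_der) as [H3 H4].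
eapply der_eq; [exact (der_mult _ _ _ _ _ (der_const 2 t) (der_plus _ _ _ _ _ (der_mult _ _ _ _ _ H1 H3) (der_mult _ _ _ _ _ H2 H4)))|].
unfold Ntt, Csq. cbv beta. change (AbsRing.sort R_AbsRing) with R in *. ring.
Qed.

Lemma Csq_dss t s : is_derive (fun u => Ns (t, u)) s (Nss (t, s)).
Proof.
destruct (vertical_der G G1 t s G_der) as [H1 H2]. destruct (vertical_der G1 G2 t s G1_der) as [H3 H4].
eapply der_eq; [exact (der_mult _ _ _ _ _ (der_const 2 s) (der_minus _ _ _ _ _ (der_mult _ _ _ _ _ H2 H3) (der_mult _ _ _ _ _ H1 H4)))|].
unfold Nss, Csq. cbv beta. change (AbsRing.sort R_AbsRing) with R in *. ring.
Qed.

Let v z := e0 (N z).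
Let vt z := (Nt z * e1 (N z))%R.
Let vs z := (Ns z * e1 (N z))%R.
Let vtt z := (Ntt z * e1 (N z) + Nt z * (Nt z * e2 (N z)))%R.
Let vss z := (Nss z * e1 (N z) + Ns z * (Ns z * e2 (N z)))%R.
Let lap z := (4 * Csq (G1 z) * (N z * e2 (N z) + e1 (N z)))%R.

(** The [G2] terms cancel, and Nt^2 + Ns^2 = 4 |G|^2 |G1|^2, because [Nt] and [- Ns] are twice the
    real and imaginary parts of conj(G) G1. *)
Lemma laplacian_split z : lap z = (vtt z + vss z)%R.
Proof. unfold lap, vtt, vss, Ntt, Nss, Nt, Ns, N, Csq. ring. Qed.

Lemma Csq_G_ge_0 z : (0 <= N z)%R.
Proof. apply Csq_ge_0. Qed.

Lemma profile_dt t s : is_derive (fun u => v (u, s)) t (vt (t, s)).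
Proof. apply (der_comp e0 (fun u => N (u, s))); [apply e0_derive, Csq_G_ge_0|apply Csq_dt]. Qed.

Lemma profile_dtt t s : is_derive (fun u => vt (u, s)) t (vtt (t, s)).
Proof.
apply (der_mult (fun u => Nt (u, s)) (fun u => e1 (N (u, s)))); [apply Csq_dtt|]. apply (der_comp e1 (fun u => N (u, s))); [apply e1_derive, Csq_G_ge_0|apply Csq_dt].
Qed.

Lemma profile_dss t s : is_derive (fun u => vs (t, u)) s (vss (t, s)).
Proof.
apply (der_mult (fun u => Ns (t, u)) (fun u => e1 (N (t, u)))); [apply Csq_dss|]. apply (der_comp e1 (fun u => N (t, u))); [apply e1_derive, Csq_G_ge_0|apply Csq_ds].
Qed.

Lemma G_cont z : ccont G z. Proof. eapply cder_ccont, G_der. Qed.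
Lemma G1_cont z : ccont G1 z. Proof. eapply cder_ccont, G1_der. Qed.
Lemma G2_cont z : ccont G2 z. Proof. exact (entire_derivative_continuous _ _ G1_der z). Qed.

Lemma rcont_comp_N (f : R -> R) z : (forall x, (0 <= x)%R -> continuous f x) -> rcont (fun z => f (N z)) z.
Proof.
intros H. apply (continuous_comp N f); [apply rcont_Csq, G_cont|apply H, Csq_G_ge_0].
Qed.

Lemma e0_cont x : (0 <= x)%R -> continuous e0 x.
Proof. intros H. apply (ex_derive_continuous e0). eexists. now apply e0_derive. Qed.
Lemma e1_cont x : (0 <= x)%R -> continuous e1 x.
Proof. intros H. apply (ex_derive_continuous e1). eexists. now apply e1_derive. Qed.

(** Two differentiations under the integral leave the mean of [vtt]. Adding [vss] does not change
    it: [vss] is the s-derivative of the periodic function [vs], and the sum is the Laplacian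
    [lap]. *)
Lemma circle_laplacian : exists A1 : R -> R,
  (forall t, is_derive (fun t => RInt (fun s => e0 (Csq (G (t, s)))) 0 (2 * PI)) t (A1 t)) /\
  (forall t, is_derive A1 t (RInt (fun s => 4 * Csq (G1 (t, s)) *
     (Csq (G (t, s)) * e2 (Csq (G (t, s))) + e1 (Csq (G (t, s)))))%R 0 (2 * PI))).
Proof.
assert (a0 := fun z => rcont_Re G z (G_cont z)). assert (b0 := fun z => rcont_Im G z (G_cont z)).
assert (a1 := fun z => rcont_Re G1 z (G1_cont z)). assert (b1 := fun z => rcont_Im G1 z (G1_cont z)).
assert (a2 := fun z => rcont_Re G2 z (G2_cont z)). assert (b2 := fun z => rcont_Im G2 z (G2_cont z)).
assert (c_N := fun z => rcont_Csq G z (G_cont z)). assert (c_M := fun z => rcont_Csq G1 z (G1_cont z)).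
assert (c_v := fun z => rcont_comp_N e0 z e0_cont : rcont v z).
assert (d1 := fun z => rcont_comp_N e1 z e1_cont). assert (d2 := fun z => rcont_comp_N e2 z e2_cont).
assert (c_Nt : forall z, rcont Nt z) by (exact (fun z => rcont_mult _ _ z (rcont_const 2 z)
  (rcont_plus _ _ z (rcont_mult _ _ z (a0 z) (a1 z)) (rcont_mult _ _ z (b0 z) (b1 z))))).
assert (c_Ns : forall z, rcont Ns z) by (exact (fun z => rcont_mult _ _ z (rcont_const 2 z)
  (rcont_minus _ _ z (rcont_mult _ _ z (b0 z) (a1 z)) (rcont_mult _ _ z (a0 z) (b1 z))))).
assert (c_2 := fun z => rcont_plus _ _ z (rcont_mult _ _ z (a0 z) (a2 z)) (rcont_mult _ _ z (b0 z) (b2 z))).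
assert (c_Ntt : forall z, rcont Ntt z) by (exact (fun z => rcont_mult _ _ z (rcont_const 2 z) (rcont_plus _ _ z (c_M z) (c_2 z)))).
assert (c_Nss : forall z, rcont Nss z) by (exact (fun z => rcont_mult _ _ z (rcont_const 2 z) (rcont_minus _ _ z (c_M z) (c_2 z)))).
assert (c_vt : forall z, rcont vt z) by (exact (fun z => rcont_mult _ _ z (c_Nt z) (d1 z))).
assert (c_vtt : forall z, rcont vtt z) by (exact (fun z => rcont_plus _ _ z (rcont_mult _ _ z (c_Ntt z) (d1 z))
  (rcont_mult _ _ z (c_Nt z) (rcont_mult _ _ z (c_Nt z) (d2 z))))).
assert (c_vss : forall z, rcont vss z) by (exact (fun z => rcont_plus _ _ z (rcont_mult _ _ z (c_Nss z) (d1 z))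
  (rcont_mult _ _ z (c_Ns z) (rcont_mult _ _ z (c_Ns z) (d2 z))))).
exists (fun t => RInt (fun s => vt (t, s)) 0 (2 * PI)). split.
- intros t. apply (is_derive_RInt_vertical v vt); trivial. exact profile_dt.
- intros t.
  assert (Z : is_RInt (fun s => vss (t, s)) 0 (2 * PI) 0%R).
  { assert (Q : is_RInt (fun s => vss (t, s)) 0 (2 * PI) (vs (t, 2 * PI) - vs (t, 0))%R).
    { apply (is_RInt_derive (V := R_CompleteNormedModule) (fun s => vs (t, s))).
      - intros s _. apply profile_dss.
      - intros s _. now apply rcont_vertical. }
    unfold vs, Ns, N in Q. rewrite G_per, G1_per, Rminus_diag in Q. exact Q. }
  change (is_derive (fun t => RInt (fun s => vt (t, s)) 0 (2 * PI)) t (RInt (fun s => lap (t, s)) 0 (2 * PI))).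
  rewrite (RInt_ext (fun s => lap (t, s)) (fun s => vtt (t, s) + vss (t, s))%R).
  2:{ intros s _. apply laplacian_split. }
  rewrite (RInt_plus (V := R_CompleteNormedModule) (fun s => vtt (t, s)) (fun s => vss (t, s))).
  + rewrite (is_RInt_unique _ _ _ _ Z).
    replace (plus (RInt (fun s => vtt (t, s)) 0 (2 * PI)) 0%R) with (RInt (fun s => vtt (t, s)) 0 (2 * PI)).
    2:{ symmetry. apply (plus_zero_r (G := R_AbelianMonoid)). }
    apply (is_derive_RInt_vertical vt vtt); trivial. exact profile_dtt.
  + now apply ex_RInt_vertical.
  + now apply ex_RInt_vertical.
Qed.
End Laplacian.

(** * Two radial profiles: the smoothed logarithm and ln (1 + x) *)

Lemma is_derive_glue (f g h : R -> R) (a l : R) :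
  (forall x, (x <= a)%R -> h x = f x) -> (forall x, (a <= x)%R -> h x = g x) ->
  is_derive f a l -> is_derive g a l -> is_derive h a l.
Proof.
intros Hf Hg. rewrite !is_derive_R_eps. intros Df Dg e He.
destruct (Df e He) as [d1 [Hd1 H1]]. destruct (Dg e He) as [d2 [Hd2 H2]].
exists (Rmin d1 d2). split; [now apply Rmin_pos|]. intros y Hy.
destruct (Rle_dec y a) as [Hya|Hya].
- rewrite (Hf y Hya), (Hf a (Rle_refl a)). apply H1. eapply Rlt_le_trans; [exact Hy|apply Rmin_l].
- rewrite (Hg y), (Hg a (Rle_refl a)) by lra. apply H2. eapply Rlt_le_trans; [exact Hy|apply Rmin_r].
Qed.

Lemma is_derive_glue_all (f g h f' g' h' : R -> R) (a : R) :
  (forall x, (x <= a)%R -> h x = f x) -> (forall x, (a <= x)%R -> h x = g x) ->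
  (forall x, (x <= a)%R -> h' x = f' x) -> (forall x, (a <= x)%R -> h' x = g' x) ->
  (forall x, (x <= a)%R -> is_derive f x (f' x)) -> (forall x, (a <= x)%R -> is_derive g x (g' x)) ->
  forall x, is_derive h x (h' x).
Proof.
intros Hf Hg Hf' Hg' Df Dg x.
destruct (Rtotal_order x a) as [Hx|[-> |Hx]].
- rewrite Hf' by lra. apply (is_derive_ext_loc f); [|apply Df; lra].
  exists (mkposreal (a - x) ltac:(lra)). intros y Hy. symmetry. apply Hf.
  change (Rabs (y - x) < a - x)%R in Hy. apply Rabs_lt_between in Hy. lra.
- apply (is_derive_glue f g); trivial.
  + rewrite Hf' by lra. apply Df; lra.
  + rewrite Hg' by lra. apply Dg; lra.
- rewrite Hg' by lra. apply (is_derive_ext_loc g); [|apply Dg; lra].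
  exists (mkposreal (x - a) ltac:(lra)). intros y Hy. symmetry. apply Hg.
  change (Rabs (y - x) < x - a)%R in Hy. apply Rabs_lt_between in Hy. lra.
Qed.

(* [pot (|w|^2)] is a C^2 modification of [ln |w|^2] inside the unit disc whose
   Laplacian, [4 (x pot2 x + pot1 x) = 8 (1 - x)] at [x = |w|^2], is nonnegative
   and vanishes outside that disc. *)
Definition pot (x : R) : R := if Rle_dec x 1 then (x - 1 - (x - 1) * (x - 1) / 2)%R else ln x.
Definition pot1 (x : R) : R := if Rle_dec x 1 then (2 - x)%R else (/ x)%R.
Definition pot2 (x : R) : R := (- (/ Rmax 1 x * / Rmax 1 x))%R.

Lemma pot_derive (x : R) : is_derive pot x (pot1 x).
Proof.
revert x. apply (is_derive_glue_all (fun x => x - 1 - (x - 1) * (x - 1) / 2)%R ln _ (fun x => 2 - x)%R (fun x => / x)%R _ 1);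
  intros x Hx; unfold pot, pot1; try destruct Rle_dec; try lra.
- replace x with 1%R by lra. rewrite ln_1. field.
- replace x with 1%R by lra. field.
- auto_derive; trivial. field.
- auto_derive; [lra|field; lra].
Qed.

Lemma pot1_derive (x : R) : is_derive pot1 x (pot2 x).
Proof.
revert x. apply (is_derive_glue_all (fun x => 2 - x)%R (fun x => / x)%R _ (fun x => -1)%R (fun x => - (/ x * / x))%R _ 1);
  intros x Hx; unfold pot1, pot2; try destruct Rle_dec; try lra.
- replace x with 1%R by lra. field.
- rewrite Rmax_left by lra. field.
- rewrite Rmax_right by lra. reflexivity.
- apply (der_eq _ _ (0 - 1)%R); [apply (der_minus (fun _ => 2) (fun x => x))%R; [apply der_const|apply (is_derive_id (K := R_AbsRing))]|ring].
- auto_derive; [lra|field; lra].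
Qed.

Lemma pot2_cont (x : R) : continuous pot2 x.
Proof.
assert (M : continuous (fun x => Rmax 1 x) x).
{ apply (continuous_ext (fun x => (1 + Rmax 0 (x - 1)))%R).
  - intros y. unfold Rmax. repeat destruct Rle_dec; lra.
  - apply (continuous_plus (fun _ => 1) (fun x => Rmax 0 (x - 1)))%R; [apply continuous_const|].
    apply (continuous_Rmax_0 (fun x => x - 1)%R).
    apply (continuous_minus (fun x => x) (fun _ => 1)%R); [apply continuous_id|apply continuous_const]. }
assert (I : continuous (fun x => / Rmax 1 x)%R x).
{ apply (continuous_comp (fun x => Rmax 1 x) Rinv); trivial.
  apply (ex_derive_continuous Rinv). auto_derive. assert (1 <= Rmax 1 x)%R by apply Rmax_l. lra. }
apply (continuous_opp (fun x => / Rmax 1 x * / Rmax 1 x)%R).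
apply (continuous_mult (K := R_AbsRing) (fun x => / Rmax 1 x)%R (fun x => / Rmax 1 x)%R); trivial.
Qed.

Lemma pot_laplacian (x : R) : (0 <= x)%R ->
  (0 <= x * pot2 x + pot1 x <= 2)%R /\ ((1 <= x)%R -> x * pot2 x + pot1 x = 0)%R.
Proof.
intros Hx. unfold pot1, pot2. destruct Rle_dec as [H|H].
- rewrite Rmax_left by lra. rewrite Rinv_1. split; intros; lra.
- rewrite Rmax_right by lra. replace (x * - (/ x * / x) + / x)%R with 0%R by (field; lra). split; intros; lra.
Qed.

Lemma ln_le_sub1 (x : R) : (0 < x)%R -> (ln x <= x - 1)%R.
Proof.
intros Hx. assert (H := exp_ineq1_le (ln x)). rewrite exp_ln in H; lra.
Qed.

Lemma ln1p_ge_0 (x : R) : (0 <= x)%R -> (0 <= ln (1 + x))%R.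
Proof. intros H. rewrite <- ln_1. apply ln_le; lra. Qed.

(** This allows the circle mean of [pot] to dominate [logmean] up to an additive constant; the value
    3 is generous. *)
Lemma pot_ge (x : R) : (0 <= x)%R -> (ln (1 + x) <= pot x + 3)%R.
Proof.
intros Hx. unfold pot. destruct Rle_dec as [H|H].
- assert (L := ln_le_sub1 (1 + x) ltac:(lra)). nra.
- assert (L : (ln (1 + x) <= ln (x * 2))%R) by (apply ln_le; lra).
  rewrite ln_mult in L by lra. assert (L2 := ln_le_sub1 2 ltac:(lra)). lra.
Qed.

Lemma ln1p_derive (x : R) : (0 <= x)%R -> is_derive (fun x => ln (1 + x)) x (/ (1 + x))%R.
Proof. intros H. auto_derive; [lra|]. field. lra. Qed.

Lemma ln1p_derive2 (x : R) : (0 <= x)%R -> is_derive (fun x => / (1 + x))%R x (- (/ (1 + x) * / (1 + x)))%R.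
Proof. intros H. auto_derive; [lra|]. field. lra. Qed.

Lemma ln1p_cont2 (x : R) : (0 <= x)%R -> continuous (fun x => - (/ (1 + x) * / (1 + x)))%R x.
Proof.
intros H. apply (ex_derive_continuous (fun x => - (/ (1 + x) * / (1 + x)))%R). auto_derive. lra.
Qed.

Lemma ln1p_laplacian (x : R) : (0 <= x)%R ->
  (x * - (/ (1 + x) * / (1 + x)) + / (1 + x) = / ((1 + x) * (1 + x)))%R.
Proof. intros H. field. lra. Qed.

(* Nevanlinna's characteristic, in the Ahlfors-Shimizu form and up to constants. *)
Definition logmean (f : C -> C) (t : R) : R :=
  RInt (fun s => ln (1 + Csq (f (Cexp (t, s))))) 0 (2 * PI).

Lemma continuous_ln1p_Csq {T : UniformSpace} (f : T -> C) (x : T) :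
  continuous (U := C_UniformSpace) f x -> continuous (fun t => ln (1 + Csq (f t))) x.
Proof.
intros H.
apply (continuous_comp (fun t => Csq (f t)) (fun x => ln (1 + x))).
- assert (H1 := continuous_Re f x H). assert (H2 := continuous_Im f x H).
  exact (continuous_plus _ _ x (continuous_mult (K := R_AbsRing) _ _ x H1 H1)
     (continuous_mult (K := R_AbsRing) _ _ x H2 H2)).
- apply (ex_derive_continuous (fun x => ln (1 + x))). eexists. apply ln1p_derive, Csq_ge_0.
Qed.

Lemma ex_RInt_logmean (f : C -> C) (t : R) : entire f ->
  ex_RInt (fun s => ln (1 + Csq (f (Cexp (t, s))))) 0 (2 * PI).
Proof.
intros Hf. apply (ex_RInt_continuous (V := R_CompleteNormedModule)). intros s _.
now apply continuous_ln1p_Csq, pcont_on_circle.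
Qed.

Lemma logmean_ge_0 (f : C -> C) (t : R) : entire f -> (0 <= logmean f t)%R.
Proof.
intros Hf. apply RInt_ge_0.
- assert (P := PI_RGT_0). lra.
- now apply ex_RInt_logmean.
- intros s _. apply ln1p_ge_0, Csq_ge_0.
Qed.

Lemma convex_ge_tangent (D D1 D2 : R -> R) (t : R) :
  (forall t, is_derive D t (D1 t)) -> (forall t, is_derive D1 t (D2 t)) -> (forall t, (0 <= D2 t)%R) ->
  (forall u v, (u <= v)%R -> (D1 u <= D1 v)%R) /\
  (forall u v, (u <= v)%R -> (D1 u * (v - u) <= D v - D u)%R).
Proof.
intros H1 H2 H3.
assert (M : forall u v, (u <= v)%R -> (D1 u <= D1 v)%R).
{ intros u v [Huv| ->]; [|lra].
  destruct (MVT_gen D1 u v D2) as [c [_ Hc]].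
  - intros; apply H2.
  - intros x _. apply continuity_pt_filterlim. apply (ex_derive_continuous D1). eexists. apply H2.
  - specialize (H3 c). nra. }
split; trivial. intros u v [Huv| ->]; [|lra].
destruct (MVT_gen D u v D1) as [c [Hc E]].
- intros; apply H1.
- intros x _. apply continuity_pt_filterlim. apply (ex_derive_continuous D). eexists. apply H1.
- rewrite Rmin_left in Hc by lra. specialize (M u c (proj1 Hc)). nra.
Qed.

(** The second derivative is the integral of the spherical area density pulled back by f o exp, as
    in the Ahlfors-Shimizu theory; in particular it is nonnegative. *)
Lemma logmean_derive (f f' : C -> C) : (forall z, cder f z (f' z)) -> exists A1 : R -> R,
  (forall t, is_derive (logmean f) t (A1 t)) /\
  (forall t, is_derive A1 t (RInt (fun s => 4 * Csq (Cexp (t, s) * f' (Cexp (t, s))) *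
     / ((1 + Csq (f (Cexp (t, s)))) * (1 + Csq (f (Cexp (t, s))))))%R 0 (2 * PI))).
Proof.
intros Hf. assert (Hf' := entire_C_derive f' (entire_derivative_entire f f' Hf)).
assert (D : forall z, cder (fun z => f (Cexp z)) z (Cexp z * f' (Cexp z))).
{ intros z. apply (cder_comp f Cexp); [apply Hf|apply cder_Cexp]. }
destruct (circle_laplacian (fun x => ln (1 + x)) (fun x => / (1 + x))%R (fun x => - (/ (1 + x) * / (1 + x)))%R
  ln1p_derive ln1p_derive2 ln1p_cont2 (fun z => f (Cexp z)) (fun z => Cexp z * f' (Cexp z)) _ D
  (entire_C_derive _ (entire_derivative_entire _ _ D))) as [A1 [HA HA1]].
- intros t. now rewrite Cexp_period.
- intros t. now rewrite Cexp_period.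
- exists A1. split; [exact HA|]. intros t.
  rewrite <- (RInt_ext (fun s => 4 * Csq (Cexp (t, s) * f' (Cexp (t, s))) *
     (Csq (f (Cexp (t, s))) * - (/ (1 + Csq (f (Cexp (t, s)))) * / (1 + Csq (f (Cexp (t, s))))) +
      / (1 + Csq (f (Cexp (t, s))))))%R).
  + apply HA1.
  + intros s _. now rewrite ln1p_laplacian by apply Csq_ge_0.
Qed.

(** * The characteristic under composition and differentiation *)

Lemma RInt_vertical_le (f g : R -> R) : ex_RInt f 0 (2 * PI) -> ex_RInt g 0 (2 * PI) ->
  (forall s, f s <= g s)%R -> (RInt f 0 (2 * PI) <= RInt g 0 (2 * PI))%R.
Proof.
intros Hf Hg H. apply RInt_le; trivial. assert (P := PI_RGT_0). lra.
Qed.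

Lemma Csq_plus_le (z w : C) : (Csq (z + w) <= 2 * Csq z + 2 * Csq w)%R.
Proof.
unfold Csq. simpl. unfold Re, Im. simpl.
assert (H1 := Rle_0_sqr (fst z - fst w)). assert (H2 := Rle_0_sqr (snd z - snd w)). unfold Rsqr in *. lra.
Qed.

Lemma local_bounds (f f' : C -> C) (w1 : C) : (forall z, cder f z (f' z)) -> f' w1 <> 0 ->
  exists d m B, (0 < d <= 1 /\ 0 < m /\ 1 <= B)%R /\
   forall w, (Csq (w - w1) <= d * d)%R -> (m <= Csq (f' w))%R /\ (1 + Csq (f w) <= B)%R.
Proof.
intros Hf H0. assert (C' := entire_derivative_continuous f f' Hf w1).
assert (C0 := cder_ccont _ _ _ (Hf w1)).
rewrite ccont_eps in C', C0. assert (M := proj1 (Cmod_gt_0 _) H0).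
destruct (C' (Cmod (f' w1) / 2)%R ltac:(lra)) as [d1 [Hd1 H1]].
destruct (C0 1%R Rlt_0_1) as [d2 [Hd2 H2]].
set (m := Cmod (f' w1)) in *. set (b := (Cmod (f w1) + 1)%R).
assert (Hb : (1 <= b)%R) by (assert (K := Cmod_ge_0 (f w1)); unfold b; lra).
(* On this disc |f'| stays above half its value at [w1] and |f| below |f(w1)| + 1. Halving the
   radius makes the closed disc fit into the open ones, and the cap 1 gives d^2 <= 1 later on. *)
exists (Rmin 1 (Rmin d1 d2 / 2)), (m / 2 * (m / 2))%R, (1 + b * b)%R.
assert (Hd : (0 < Rmin d1 d2)%R) by now apply Rmin_pos.
assert (Hd' : (0 < Rmin 1 (Rmin d1 d2 / 2))%R) by (apply Rmin_pos; lra).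
repeat split; try nra; [apply Rmin_l| |].
all: assert (K : (Cmod (w - w1) <= Rmin d1 d2 / 2)%R);
 [rewrite Csq_Cmod in H; apply Rnot_lt_le; intros N;
  assert (P := Rmin_r 1 (Rmin d1 d2 / 2)); assert (Q := Cmod_ge_0 (w - w1)); nra|].
- specialize (H1 w ltac:(assert (Q := Rmin_l d1 d2); lra)).
  assert (T := Cmod_triangle (f' w1 - f' w) (f' w)). replace (f' w1 - f' w + f' w) with (f' w1) in T by ring.
  replace (f' w1 - f' w) with (- (f' w - f' w1)) in T by ring. rewrite Cmod_opp in T. fold m in T.
  rewrite Csq_Cmod. nra.
- specialize (H2 w ltac:(assert (Q := Rmin_r d1 d2); lra)).
  assert (T := Cmod_triangle (f w - f w1) (f w1)). replace (f w - f w1 + f w1) with (f w) in T by ring.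
  rewrite Csq_Cmod. assert (Q := Cmod_ge_0 (f w)). unfold b. assert (Cmod (f w) <= Cmod (f w1) + 1)%R by lra. nra.
Qed.

Lemma Csq_div (z : C) (d : R) : (0 < d)%R -> Csq (z * / RtoC d) = (Csq z / (d * d))%R.
Proof.
intros H. rewrite Csq_mult, (Csq_Cmod (/ RtoC d)), Cmod_inv, Cmod_R, Rabs_pos_eq by (lra || (intros E; apply (f_equal fst) in E; simpl in E; lra)).
field. lra.
Qed.

(** The Laplacian of [pot (|G|^2)] lives only where g is within d of [w1], and exactly there the
    Laplacian of ln (1 + |f o g|^2) has a lower bound of the same shape. Hence k T(f o g) - U is
    convex in t for a suitable k, and lies above its tangent at t = 0; this tangent is the source of
    the term 1 + t. Finally T(g) exceeds U by at most a constant. *)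
Lemma logmean_comp_ge (f g : C -> C) (w1 : C) : entire f -> entire g -> C_derive f w1 <> 0 ->
  exists K, (0 <= K)%R /\ forall t, (0 <= t)%R ->
    (logmean g t <= K * (1 + t + logmean (fun z => f (g z)) t))%R.
Proof.
intros Hf Hg H0. assert (PP := PI_RGT_0).
assert (Df := entire_C_derive f Hf). set (f' := C_derive f) in *.
assert (Dg := entire_C_derive g Hg). set (g' := C_derive g) in *.
destruct (local_bounds f f' w1 Df H0) as (d & m & B & (Hd & Hm & HB) & L).
assert (Hdn : RtoC d <> 0) by (intros E; apply (f_equal fst) in E; simpl in E; lra).
(* Rescaled so that the unit disc of [pot] becomes the disc of radius d about [w1]. *)
set (G := fun z => (g (Cexp z) - w1) * / RtoC d).
set (G1 := fun z => Cexp z * g' (Cexp z) * / RtoC d).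
assert (DG : forall z, cder G z (G1 z)).
{ intros z. eapply cder_eq.
  - apply cder_mult; [|apply cder_const]. apply cder_minus; [|apply cder_const].
    apply (cder_comp g Cexp); [apply Dg|apply cder_Cexp].
  - unfold G1. cbv beta. ring. }
destruct (circle_laplacian pot pot1 pot2 (fun x _ => pot_derive x) (fun x _ => pot1_derive x) (fun x _ => pot2_cont x)
  G G1 _ DG (entire_C_derive _ (entire_derivative_entire _ _ DG))) as [U1 [HU HU1]].
{ intros t. unfold G. now rewrite Cexp_period. }
{ intros t. unfold G1. now rewrite Cexp_period. }
set (U := fun t => RInt (fun s => pot (Csq (G (t, s)))) 0 (2 * PI)) in *.
set (c := fun z => f (g z)).
assert (Dc : forall z, cder c z (g' z * f' (g z))).
{ intros z. apply (cder_comp f g); [apply Df|apply Dg]. }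
assert (Hc : entire c) by exact (cder_entire _ _ Dc).
destruct (logmean_derive c _ Dc) as [V1 [HV HV1]].
(* Inside the disc the Laplacian of [pot] is at most 8 |G1|^2, while the other one is at least 4
   |G1|^2 d^2 m / B^2; [k] is the quotient of the two bounds. *)
set (k := (2 * B * B / (d * d * m))%R).
assert (Hdm : (0 < d * d * m)%R) by (apply Rmult_lt_0_compat; [apply Rmult_lt_0_compat|]; lra).
assert (Hk : (0 <= k)%R) by (apply Rlt_le, Rdiv_lt_0_compat; [apply Rmult_lt_0_compat; lra|trivial]).
assert (G_cont : forall z, ccont G z) by (intros z; eapply cder_ccont, DG).
assert (G1_cont : forall z, ccont G1 z) by (exact (entire_derivative_continuous _ _ DG)).
set (p := fun z => (4 * Csq (G1 z) * (Csq (G z) * pot2 (Csq (G z)) + pot1 (Csq (G z))))%R).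
assert (c_p : forall z, rcont p z).
{ intros z. assert (X := rcont_Csq G z (G_cont z)).
  assert (X1 : rcont (fun z => pot1 (Csq (G z))) z).
  { apply (continuous_comp (fun z => Csq (G z)) pot1); trivial.
    apply (ex_derive_continuous pot1). eexists. apply pot1_derive. }
  assert (X2 : rcont (fun z => pot2 (Csq (G z))) z).
  { apply (continuous_comp (fun z => Csq (G z)) pot2); trivial. apply pot2_cont. }
  exact (rcont_mult _ _ z (rcont_mult _ _ z (rcont_const 4 z) (rcont_Csq G1 z (G1_cont z)))
    (rcont_plus _ _ z (rcont_mult _ _ z X X2) X1)). }
set (q := fun z => (4 * Csq (Cexp z * (g' (Cexp z) * f' (g (Cexp z)))) *
     / ((1 + Csq (c (Cexp z))) * (1 + Csq (c (Cexp z)))))%R).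
assert (c_q : forall z, rcont q z).
{ intros z.
  assert (E1 : entire (fun z => Cexp z * (g' (Cexp z) * f' (g (Cexp z))))).
  { intros w. eexists. apply cder_mult; [apply cder_Cexp|]. apply cder_mult.
    - apply (cder_comp g' Cexp); [|apply cder_Cexp]. apply entire_C_derive, (entire_derivative_entire g g' Dg).
    - apply (cder_comp f' (fun w => g (Cexp w))); [apply entire_C_derive, (entire_derivative_entire f f' Df)|].
      apply (cder_comp g Cexp); [apply Dg|apply cder_Cexp]. }
  assert (E2 : entire (fun z => c (Cexp z))).
  { intros w. eexists. apply (cder_comp c Cexp); [apply Dc|apply cder_Cexp]. }
  assert (X1 := rcont_Csq _ z (entire_ccont _ E1 z)). assert (X2 := rcont_Csq _ z (entire_ccont _ E2 z)).
  assert (X3 := rcont_plus _ _ z (rcont_const 1 z) X2).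
  assert (X4 := rcont_mult _ _ z X3 X3).
  apply (rcont_mult _ _ z (rcont_mult _ _ z (rcont_const 4 z) X1)).
  apply (continuous_comp (U := C_UniformSpace) _ Rinv); [exact X4|].
  apply (ex_derive_continuous Rinv). auto_derive.
  assert (Y := Csq_ge_0 (c (Cexp z))). nra. }
assert (PQ : forall z, (0 <= k * q z - p z)%R).
{ intros z. unfold p, q. fold c.
  replace (Cexp z * (g' (Cexp z) * f' (g (Cexp z)))) with (G1 z * (RtoC d * f' (g (Cexp z)))) by (unfold G1; field; exact Hdn).
  rewrite (Csq_mult (G1 z)). assert (Y0 := Csq_ge_0 (G1 z)). set (M := Csq (G1 z)) in *.
  assert (YG := Csq_ge_0 (G z)). destruct (pot_laplacian (Csq (G z)) YG) as [P1 P2].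
  set (X := (Csq (G z) * pot2 (Csq (G z)) + pot1 (Csq (G z)))%R) in *.
  assert (Yc := Csq_ge_0 (c (Cexp z))). set (n := Csq (c (Cexp z))) in *.
  assert (Yf := Csq_ge_0 (RtoC d * f' (g (Cexp z)))).
  assert (In : (0 < / ((1 + n) * (1 + n)))%R) by (apply Rinv_0_lt_compat, Rmult_lt_0_compat; lra).
  (* Outside the disc [pot] is the harmonic logarithm and only nonnegativity of q remains; inside it
     the local bounds on f and f' apply. *)
  destruct (Rle_dec 1 (Csq (G z))) as [F|F].
  - rewrite (P2 F), Rmult_0_r, Rminus_0_r. apply Rmult_le_pos; [exact Hk|]. repeat apply Rmult_le_pos; try exact Y0; try exact Yf; try (apply Rlt_le; exact In); lra.
  - assert (EG : Csq (G z) = (Csq (g (Cexp z) - w1) / (d * d))%R) by (unfold G; apply Csq_div; lra).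
    destruct (L (g (Cexp z))) as [L1 L2].
    { rewrite EG in F. apply Rnot_le_lt in F.
      apply (Rmult_lt_compat_r (d * d)) in F; [|nra].
      replace (Csq (g (Cexp z) - w1) / (d * d) * (d * d))%R with (Csq (g (Cexp z) - w1)) in F by (field; lra). lra. }
    fold c in L2. change (f (g (Cexp z))) with (c (Cexp z)) in L2. fold n in L2.
    rewrite Csq_mult, (Csq_Cmod (RtoC d)), Cmod_R, Rabs_pos_eq by lra.
    set (fp := Csq (f' (g (Cexp z)))) in *.
    assert (J : (2 <= k * (d * d * fp) * / ((1 + n) * (1 + n)))%R).
    { apply Rmult_le_reg_r with ((1 + n) * (1 + n))%R; [apply Rmult_lt_0_compat; lra|].
      rewrite Rmult_assoc, Rinv_l, Rmult_1_r by (apply Rgt_not_eq, Rmult_lt_0_compat; lra).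
      apply Rle_trans with (2 * (B * B))%R.
      - apply Rmult_le_compat_l; [lra|]. apply Rmult_le_compat; lra.
      - replace (k * (d * d * fp))%R with (2 * (B * B) * (fp / m))%R by (unfold k; field; lra).
        rewrite <- (Rmult_1_r (2 * (B * B))) at 1. apply Rmult_le_compat_l; [nra|].
        apply Rmult_le_reg_r with m; trivial. replace (fp / m * m)%R with fp by (field; lra). lra. }
    replace (k * (4 * (M * (d * d * fp)) * / ((1 + n) * (1 + n))) - 4 * M * X)%R with
      (4 * M * (k * (d * d * fp) * / ((1 + n) * (1 + n)) - X))%R by ring.
    apply Rmult_le_pos; lra. }
set (D := fun t => (k * logmean c t - U t)%R). set (D1 := fun t => (k * V1 t - U1 t)%R).
set (D2 := fun t => (k * RInt (fun s => q (t, s)) 0 (2 * PI) - RInt (fun s => p (t, s)) 0 (2 * PI))%R).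
assert (HD : forall t, is_derive D t (D1 t)).
{ intros t. unfold D, D1. apply (der_minus (fun t => k * logmean c t)%R U); [|apply HU].
  apply (is_derive_scal (logmean c)). apply HV. }
assert (HD1 : forall t, is_derive D1 t (D2 t)).
{ intros t. unfold D1, D2. apply (der_minus (fun t => k * V1 t)%R U1); [|apply HU1].
  apply (is_derive_scal V1). apply HV1. }
assert (HD2 : forall t, (0 <= D2 t)%R).
{ intros t. unfold D2.
  replace (k * RInt (fun s => q (t, s)) 0 (2 * PI))%R with (RInt (fun s => k * q (t, s))%R 0 (2 * PI)).
  2:{ apply (RInt_scal (V := R_CompleteNormedModule) (fun s => q (t, s))). now apply ex_RInt_vertical. }
  assert (RInt (fun s => p (t, s)) 0 (2 * PI) <= RInt (fun s => k * q (t, s)) 0 (2 * PI))%R; [|lra].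
  apply RInt_vertical_le.
  - now apply ex_RInt_vertical.
  - apply (ex_RInt_scal (V := R_NormedModule) (fun s => q (t, s))). now apply ex_RInt_vertical.
  - intros s. specialize (PQ (t, s)). lra. }
destruct (convex_ge_tangent D D1 D2 0 HD HD1 HD2) as [_ Tan].
(* From g = w1 + d G with d <= 1: 1 + |g|^2 <= 1 + 2 |w1|^2 + 2 |G|^2 <= (2 |w1|^2 + 3) (1 +
   |G|^2). *)
set (C0 := ln (2 * Csq w1 + 3)).
assert (HC0 : (0 <= C0)%R) by (unfold C0; assert (Y := Csq_ge_0 w1); rewrite <- ln_1; apply ln_le; lra).
assert (PW : forall t, (logmean g t <= U t + 2 * PI * (3 + C0))%R).
{ intros t.
  assert (cpot : forall z, rcont (fun z => pot (Csq (G z))) z).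
  { intros z. apply (continuous_comp (fun z => Csq (G z)) pot); [apply rcont_Csq, G_cont|].
    apply (ex_derive_continuous pot). eexists. apply pot_derive. }
  replace (U t + 2 * PI * (3 + C0))%R with (RInt (fun s => pot (Csq (G (t, s))) + (3 + C0))%R 0 (2 * PI)).
  2:{ rewrite (RInt_plus (V := R_CompleteNormedModule) (fun s => pot (Csq (G (t, s)))) (fun _ => 3 + C0)%R).
      - rewrite RInt_const. unfold plus, scal; simpl. unfold mult; simpl. rewrite Rminus_0_r. reflexivity.
      - now apply (ex_RInt_vertical (fun z => pot (Csq (G z)))).
      - apply ex_RInt_const. }
  apply RInt_vertical_le.
  - now apply ex_RInt_logmean.
  - apply (ex_RInt_plus (V := R_NormedModule) (fun s => pot (Csq (G (t, s)))) (fun _ => 3 + C0)%R).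
    + now apply (ex_RInt_vertical (fun z => pot (Csq (G z)))).
    + apply ex_RInt_const.
  - intros s. assert (Y := Csq_ge_0 (G (t, s))). assert (P := pot_ge _ Y).
    assert (Z : (1 + Csq (g (Cexp (t, s))) <= (2 * Csq w1 + 3) * (1 + Csq (G (t, s))))%R).
    { replace (g (Cexp (t, s))) with (w1 + RtoC d * G (t, s)) by (unfold G; field; exact Hdn).
      assert (Q := Csq_plus_le w1 (RtoC d * G (t, s))). rewrite Csq_mult, (Csq_Cmod (RtoC d)), Cmod_R, Rabs_pos_eq in Q by lra.
      assert (d * d * Csq (G (t, s)) <= 1 * Csq (G (t, s)))%R by (apply Rmult_le_compat_r; nra).
      assert (Y1 := Csq_ge_0 w1). nra. }
    assert (Y1 := Csq_ge_0 w1). assert (Y2 := Csq_ge_0 (g (Cexp (t, s)))).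
    apply ln_le in Z; [|lra]. rewrite ln_mult in Z by lra. fold C0 in Z. lra. }
set (E := (Rabs (D 0) + Rabs (D1 0) + 2 * PI * (3 + C0))%R).
assert (HE1 := Rabs_pos (D 0%R)). assert (HE2 := Rabs_pos (D1 0%R)).
exists (k + E)%R.
assert (HE3 : (0 <= 2 * PI * (3 + C0))%R) by (apply Rmult_le_pos; lra).
split; [unfold E; lra|]. intros t Ht.
specialize (Tan 0%R t Ht). specialize (PW t).
assert (Lc := logmean_ge_0 c t Hc). change (fun z => f (g z)) with c.
assert (A1 : (U t <= k * logmean c t + Rabs (D 0) + Rabs (D1 0) * t)%R).
{ unfold D at 1 in Tan.
  assert (- D 0%R <= Rabs (D 0))%R by (rewrite <- Rabs_Ropp; apply Rle_abs).
  assert (- D1 0%R * t <= Rabs (D1 0) * t)%R by (apply Rmult_le_compat_r; [lra|rewrite <- Rabs_Ropp; apply Rle_abs]).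
  lra. }
unfold E. nra.
Qed.

(** Since |g'| = exp (Re h), the integrand of the second derivative of T is large wherever Re h is
    large and |g| is not. A second derivative is controlled by T only on average over an interval,
    so the estimate holds at some radius [u] in [t, t + 1]. *)
Lemma logmean_derivative_bound (g h : C -> C) : entire h -> (forall z, cder g z (Cexp (h z))) ->
  exists K, (0 <= K)%R /\ forall t, (0 <= t)%R -> exists u, (t <= u <= t + 1)%R /\
   (RInt (fun s => Rmax 0 (Re (h (Cexp (u, s))))) 0 (2 * PI) <= K * (1 + logmean g (t + 2)))%R.
Proof.
intros Hh Dg. assert (PP := PI_RGT_0). assert (Hg := cder_entire _ _ Dg).
destruct (logmean_derive g _ Dg) as [A1 [HA HA1]].
set (q := fun z => (4 * Csq (Cexp z * Cexp (h (Cexp z))) *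
     / ((1 + Csq (g (Cexp z))) * (1 + Csq (g (Cexp z)))))%R).
pose (A2 := (fun t => RInt (fun s => q (t, s)) 0 (2 * PI)) : R -> R).
assert (c_q : forall z, rcont q z).
{ intros z.
  assert (E1 : entire (fun z => Cexp z * Cexp (h (Cexp z)))).
  { intros w. eexists. apply cder_mult; [apply cder_Cexp|].
    apply (cder_comp Cexp (fun w => h (Cexp w))); [apply cder_Cexp|].
    apply (cder_comp h Cexp); [apply entire_C_derive, Hh|apply cder_Cexp]. }
  assert (E2 : entire (fun z => g (Cexp z))).
  { intros w. eexists. apply (cder_comp g Cexp); [apply Dg|apply cder_Cexp]. }
  assert (X1 := rcont_Csq _ z (entire_ccont _ E1 z)). assert (X2 := rcont_Csq _ z (entire_ccont _ E2 z)).
  assert (X3 := rcont_plus _ _ z (rcont_const 1 z) X2).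
  assert (X4 := rcont_mult _ _ z X3 X3).
  apply (rcont_mult _ _ z (rcont_mult _ _ z (rcont_const 4 z) X1)).
  apply (continuous_comp (U := C_UniformSpace) _ Rinv); [exact X4|].
  apply (ex_derive_continuous Rinv). auto_derive.
  assert (Y := Csq_ge_0 (g (Cexp z))). nra. }
assert (q_ge_0 : forall z, (0 <= q z)%R).
{ intros z. unfold q. assert (Y := Csq_ge_0 (g (Cexp z))).
  repeat apply Rmult_le_pos; try lra; [apply Csq_ge_0|]. apply Rlt_le, Rinv_0_lt_compat, Rmult_lt_0_compat; lra. }
assert (HA2 : forall t, (0 <= A2 t)%R).
{ intros t. apply RInt_ge_0; [lra|now apply ex_RInt_vertical|intros; apply q_ge_0]. }
destruct (convex_ge_tangent (logmean g) A1 A2 0 HA HA1 HA2) as [Mon Tan].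
set (a := Rabs (A1 0)). assert (Ha : (0 <= a)%R) by apply Rabs_pos.
assert (Ha' : (- A1 0%R <= a)%R) by (unfold a; rewrite <- Rabs_Ropp; apply Rle_abs).
exists (3 + 5 * a)%R. split; [lra|]. intros t Ht.
(* Here A2(u) = A1(t + 1) - A1(t). Convexity bounds A1(t + 1) by T(t + 2) - T(t + 1) <= X, and A1(t)
   is at least A1(0) >= - a. The constant 3 + 5 a below collects A2(u) <= X + a and T(u) <= X + 2 a,
   the latter counted twice. *)
destruct (MVT_gen A1 t (t + 1) A2) as [u [Hu Eu]].
{ intros; apply HA1. }
{ intros x _. apply continuity_pt_filterlim. apply (ex_derive_continuous A1). eexists. apply HA1. }
rewrite Rmin_left, Rmax_right in Hu by lra.
exists u. split; trivial.
assert (T1 := Tan (t + 1)%R (t + 2)%R ltac:(lra)). assert (T2 := Tan u (t + 2)%R ltac:(lra)).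
assert (M1 := Mon 0%R t Ht). assert (M2 := Mon 0%R u ltac:(lra)).
assert (L1 := logmean_ge_0 g (t + 1) Hg). set (X := logmean g (t + 2)) in *.
assert (L2 := logmean_ge_0 g (t + 2) Hg). fold X in L2.
assert (B2 : (A2 u <= X + a)%R).
{ replace (A2 u * (t + 1 - t))%R with (A2 u) in Eu by ring. lra. }
assert (B1 : (logmean g u <= X + 2 * a)%R).
{ assert (A1 u * (t + 2 - u) >= - a * 2)%R by nra. lra. }
apply Rle_trans with (A2 u + 2 * logmean g u)%R; [|nra].
unfold A2, logmean.
replace (RInt (fun s => q (u, s)) 0 (2 * PI) + 2 * RInt (fun s => ln (1 + Csq (g (Cexp (u, s))))) 0 (2 * PI))%R
  with (RInt (fun s => q (u, s) + 2 * ln (1 + Csq (g (Cexp (u, s)))))%R 0 (2 * PI)).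
2:{ rewrite (RInt_plus (V := R_CompleteNormedModule) (fun s => q (u, s)) (fun s => 2 * ln (1 + Csq (g (Cexp (u, s)))))%R).
    - assert (ES : RInt (fun s => 2 * ln (1 + Csq (g (Cexp (u, s)))))%R 0 (2 * PI) =
        (2 * RInt (fun s => ln (1 + Csq (g (Cexp (u, s))))) 0 (2 * PI))%R).
      { apply (RInt_scal (V := R_CompleteNormedModule) (fun s => ln (1 + Csq (g (Cexp (u, s)))))). now apply ex_RInt_logmean. }
      rewrite ES. reflexivity.
    - now apply ex_RInt_vertical.
    - apply (ex_RInt_scal (V := R_NormedModule)). now apply ex_RInt_logmean. }
apply RInt_vertical_le.
- now apply ex_RInt_Rmax_circle.
- apply (ex_RInt_plus (V := R_NormedModule) (fun s => q (u, s)) (fun s => 2 * ln (1 + Csq (g (Cexp (u, s)))))%R).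
  + now apply ex_RInt_vertical.
  + apply (ex_RInt_scal (V := R_NormedModule)). now apply ex_RInt_logmean.
- intros s. unfold q. set (z := Cexp (u, s)).
  assert (Yn := Csq_ge_0 (g z)). set (n := Csq (g z)) in *.
  rewrite Csq_mult. assert (Ez : (1 <= Csq z)%R).
  { unfold z. rewrite Csq_Cmod, Cmod_Cexp. simpl. assert (K := exp_ineq1_le u). nra. }
  rewrite (Csq_Cmod (Cexp (h z))), Cmod_Cexp. set (r := Re (h z)).
  assert (Pr := exp_pos r). set (x := exp r) in *.
  assert (Hx2 : (0 < x * x)%R) by nra.
  set (y := (Csq z * (x * x) * / ((1 + n) * (1 + n)))%R).
  assert (Hn : (0 < / ((1 + n) * (1 + n)))%R) by (apply Rinv_0_lt_compat; nra).
  assert (Hy : (0 <= y)%R) by (unfold y; apply Rmult_le_pos; nra).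
  (* |z| >= 1 enters here. Taking logarithms gives 2 Re h <= y + 2 ln (1 + n), and the integrand 4 y
     + 2 ln (1 + n) dominates the positive part of Re h. *)
  assert (F1 : (1 + x * x <= (1 + y) * ((1 + n) * (1 + n)))%R).
  { replace ((1 + y) * ((1 + n) * (1 + n)))%R with ((1 + n) * (1 + n) + Csq z * (x * x))%R by (unfold y; field; lra).
    nra. }
  assert (F2 : (ln (1 + x * x) <= ln (1 + y) + (ln (1 + n) + ln (1 + n)))%R).
  { rewrite <- !ln_mult by nra. apply ln_le; lra. }
  assert (F3 := ln_le_sub1 (1 + y) ltac:(lra)).
  assert (F4 : (r + r <= ln (1 + x * x))%R).
  { replace (r + r)%R with (ln (x * x)); [apply ln_le; lra|]. unfold x. rewrite <- exp_plus. apply ln_exp. }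
  assert (F5 : (0 <= ln (1 + x * x))%R) by (apply ln1p_ge_0; lra).
  replace (4 * (Csq z * (x * x)) * / ((1 + n) * (1 + n)))%R with (4 * y)%R by (unfold y; ring).
  unfold Rmax. destruct Rle_dec; lra.
Qed.

(** * Growth of logarithms *)

(** The exponential is (1 + |z|)^N; a real exponent is wanted for N = 1/2. In [log_growth] the
    radius is e^t, so that e^(N t) is its N-th power. *)
Definition poly_growth (N : R) (h : C -> C) : Prop :=
  exists K, (0 <= K)%R /\ forall z, (Cmod (h z) <= K * exp (N * ln (1 + Cmod z)))%R.

Definition log_growth (N : R) (g : C -> C) : Prop :=
  exists K, (0 <= K)%R /\ forall t, (0 <= t)%R -> (logmean g t <= K * exp (N * t))%R.

Lemma ln1p_Cmod_ge_0 (z : C) : (0 <= ln (1 + Cmod z))%R.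
Proof. apply ln1p_ge_0, Cmod_ge_0. Qed.

Lemma exp_ge_1 (x : R) : (0 <= x)%R -> (1 <= exp x)%R.
Proof. intros H. assert (K := exp_ineq1_le x). lra. Qed.

Lemma poly_growth_of_means (h : C -> C) (K N : R) : entire h -> (0 <= N)%R -> (0 <= K)%R ->
  (forall t, (0 <= t)%R -> exists u, (t <= u)%R /\
    (RInt (fun s => Rmax 0 (Re (h (Cexp (u, s))))) 0 (2 * PI) <= K * exp (N * t))%R) ->
  poly_growth N h.
Proof.
intros Hh HN HK H. assert (PP := PI_RGT_0). assert (H0 := Cmod_ge_0 (h 0)).
assert (E2 := exp_pos (N * ln 2)).
assert (HK' : (0 <= 4 * K * exp (N * ln 2) / PI)%R).
{ apply Rmult_le_pos; [|apply Rlt_le, Rinv_0_lt_compat, PP]. apply Rmult_le_pos; lra. }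
exists (5 * Cmod (h 0) + 4 * K * exp (N * ln 2) / PI)%R. split; [lra|].
intros z. assert (Hz := Cmod_ge_0 z). assert (Lz := ln1p_Cmod_ge_0 z).
assert (L2 : (0 <= ln 2)%R) by (rewrite <- ln_1; apply ln_le; lra).
(* The radius is at least 2 (1 + |z|), as Borel-Caratheodory requires, and the bound costs only the
   extra factor 2^N. *)
destruct (H (ln 2 + ln (1 + Cmod z))%R ltac:(lra)) as [u [Hu Iu]].
assert (Eu : (2 * Cmod z <= exp u)%R).
{ apply Rle_trans with (exp (ln 2 + ln (1 + Cmod z))).
  - rewrite exp_plus, !exp_ln by lra. lra.
  - destruct Hu as [Hu| ->]; [apply Rlt_le, exp_increasing, Hu|lra]. }
assert (B := borel_caratheodory_L1 h z u Hh Eu).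
rewrite Rmult_plus_distr_l, exp_plus in Iu.
assert (E1 : (1 <= exp (N * ln (1 + Cmod z)))%R) by (apply exp_ge_1, Rmult_le_pos; lra).
set (X := exp (N * ln (1 + Cmod z))) in *. set (Y := exp (N * ln 2)) in *.
apply Rmult_le_reg_l with PI; trivial. eapply Rle_trans; [exact B|].
replace (PI * ((5 * Cmod (h 0) + 4 * K * Y / PI) * X))%R with (5 * PI * Cmod (h 0) * X + 4 * (K * (Y * X)))%R by (field; lra).
apply Rplus_le_compat; [|lra].
assert (0 <= 5 * PI * Cmod (h 0))%R by (apply Rmult_le_pos; lra). nra.
Qed.

(** Because |F| = exp (Re h), twice the positive part of Re h is at most ln (1 + |F|^2) pointwise,
    on the circle of radius e^t itself. *)
Lemma poly_growth_log (F h : C -> C) (N : R) : entire F -> entire h -> (0 <= N)%R ->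
  (forall z, F z = Cexp (h z)) -> log_growth N F -> poly_growth N h.
Proof.
intros HF Hh HN E [K [HK H]]. apply (poly_growth_of_means h K); trivial.
intros t Ht. exists t. split; [lra|]. eapply Rle_trans; [|apply H, Ht].
apply RInt_vertical_le; [now apply ex_RInt_Rmax_circle|now apply ex_RInt_logmean|].
intros s. rewrite E, Csq_Cmod, Cmod_Cexp. set (r := Re (h (Cexp (t, s)))).
assert (Pr := exp_pos r).
assert (F4 : (r + r <= ln (1 + exp r * exp r))%R).
{ rewrite <- exp_plus. rewrite <- (ln_exp (r + r)) at 1. apply ln_le; [apply exp_pos|lra]. }
assert (F5 : (0 <= ln (1 + exp r * exp r))%R) by (apply ln1p_ge_0; nra).
unfold Rmax. destruct Rle_dec; lra.
Qed.

(** The shift of t by 2 in [logmean_derivative_bound] costs a factor exp (2 N) and leaves the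
    exponent N unchanged. *)
Lemma poly_growth_log_derivative (g h : C -> C) (N : R) : entire h -> (0 <= N)%R ->
  (forall z, cder g z (Cexp (h z))) -> log_growth N g -> poly_growth N h.
Proof.
intros Hh HN Dg [K [HK H]]. destruct (logmean_derivative_bound g h Hh Dg) as [M [HM HM']].
assert (E2 := exp_pos (N * 2)).
apply (poly_growth_of_means h (M * (1 + K * exp (N * 2)))%R); trivial.
{ apply Rmult_le_pos; trivial. assert (0 <= K * exp (N * 2))%R by (apply Rmult_le_pos; lra). lra. }
intros t Ht. destruct (HM' t Ht) as [u [Hu I]]. exists u. split; [lra|].
eapply Rle_trans; [exact I|]. rewrite Rmult_assoc. apply Rmult_le_compat_l; trivial.
specialize (H (t + 2)%R ltac:(lra)). rewrite Rmult_plus_distr_l, exp_plus in H.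
assert (E1 : (1 <= exp (N * t))%R) by (apply exp_ge_1, Rmult_le_pos; lra). lra.
Qed.

(** Cauchy's estimate on a circle of radius r bounds |h'(z)| by O(r^(1/2) / r). The computation is
    done with squares to avoid fractional powers. *)
Lemma liouville_sublinear (h : C -> C) : entire h -> poly_growth (/ 2) h -> forall z, cder h z 0.
Proof.
intros Hh [K [HK H]] z. assert (D := entire_C_derive h Hh z). set (l := C_derive h z) in *.
assert (PP := PI_RGT_0). assert (Hz := Cmod_ge_0 z).
assert (S : forall w, (Cmod (h w) * Cmod (h w) <= K * K * (1 + Cmod w))%R).
{ intros w. specialize (H w). assert (Q := Cmod_ge_0 (h w)).
  assert (E : (exp (/ 2 * ln (1 + Cmod w)) * exp (/ 2 * ln (1 + Cmod w)) = 1 + Cmod w)%R).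
  { rewrite <- exp_plus. replace (/ 2 * ln (1 + Cmod w) + / 2 * ln (1 + Cmod w))%R with (ln (1 + Cmod w)) by field.
    apply exp_ln. assert (Y := Cmod_ge_0 w). lra. }
  rewrite <- E. assert (Y := exp_pos (/ 2 * ln (1 + Cmod w))).
  replace (K * K * (exp (/ 2 * ln (1 + Cmod w)) * exp (/ 2 * ln (1 + Cmod w))))%R with
   ((K * exp (/ 2 * ln (1 + Cmod w))) * (K * exp (/ 2 * ln (1 + Cmod w))))%R by ring.
  apply Rmult_le_compat; trivial. }
(* For such r the circle about z stays in 1 + |w| <= 2 r, whence |h| <= K sqrt (2 r) both on the
   circle and at its centre. *)
assert (B : forall r, (1 + Cmod z <= r)%R -> (Cmod l * Cmod l * r <= 8 * K * K)%R).
{ intros r Hr. set (t := ln r). assert (Et : exp t = r) by (apply exp_ln; lra).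
  set (M := (2 * (K * sqrt (2 * r)))%R).
  assert (Sq := sqrt_pos (2 * r)). assert (Sq2 := sqrt_sqrt (2 * r) ltac:(lra)).
  assert (KS : (0 <= K * sqrt (2 * r))%R) by (apply Rmult_le_pos; lra).
  assert (Bd : forall w, (Cmod w <= Cmod z + r)%R -> (Cmod (h w) <= K * sqrt (2 * r))%R).
  { intros w Hw. specialize (S w). assert (Q := Cmod_ge_0 (h w)).
    assert (K * K * (1 + Cmod w) <= K * K * (2 * r))%R by (apply Rmult_le_compat_l; [nra|lra]).
    apply Rnot_lt_le. intros N. rewrite <- Sq2 in H0. nra. }
  assert (CD := cauchy_derivative h z l t Hh D).
  assert (Ml : (Cmod (RtoC (2 * PI) * l) <= (2 * PI - 0) * (M / r))%R).
  { rewrite <- CD. apply Cmod_CI_const; [lra| |].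
    - apply ex_CI_cont. intros s _. apply continuous_Cmult.
      + apply continuous_Cminus; [|apply continuous_const].
        apply (continuous_comp (fun s => z + Cexp (t, s)) h); [|now apply entire_ccont].
        apply continuous_Cplus; [apply continuous_const|apply pcont_circle].
      + apply continuous_Cinv; [apply pcont_circle|apply Cexp_neq_0].
    - intros s _. rewrite Cmod_mult, Cmod_inv, Cmod_Cexp by apply Cexp_neq_0.
      change (Re (t, s)) with t. rewrite Et. unfold Rdiv. apply Rmult_le_compat_r; [apply Rlt_le, Rinv_0_lt_compat; lra|].
      eapply Rle_trans; [apply Cmod_triangle|]. rewrite Cmod_opp. unfold M.
      assert (B1 := Bd (z + Cexp (t, s))). assert (B2 := Bd z ltac:(lra)).
      assert (T := Cmod_triangle z (Cexp (t, s))). rewrite Cmod_Cexp in T. change (Re (t, s)) with t in T. rewrite Et in T.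
      specialize (B1 T). lra. }
  rewrite Cmod_mult, Cmod_R, Rabs_pos_eq, Rminus_0_r in Ml by lra.
  apply Rmult_le_reg_l in Ml; [|lra].
  assert (Ll : (Cmod l * r <= M)%R).
  { apply Rmult_le_compat_r with (r := r) in Ml; [|lra]. unfold Rdiv in Ml. rewrite Rmult_assoc, Rinv_l, Rmult_1_r in Ml by lra. exact Ml. }
  assert (Q := Cmod_ge_0 l).
  assert (Sql : ((Cmod l * r) * (Cmod l * r) <= M * M)%R) by (apply Rmult_le_compat; trivial; apply Rmult_le_pos; lra).
  replace (M * M)%R with (4 * (K * K) * (sqrt (2 * r) * sqrt (2 * r)))%R in Sql by (unfold M; ring).
  rewrite Sq2 in Sql. apply Rmult_le_reg_r with r; lra. }
replace (RtoC 0) with l; [exact D|]. apply Cmod_eq_0. apply Rle_antisym; [|apply Cmod_ge_0].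
apply Rnot_lt_le. intros P. set (m := Cmod l) in *.
(* Chosen so that m^2 r exceeds 8 K^2 by m^2 (1 + |z|) > 0. *)
set (r := (1 + Cmod z + 8 * K * K / (m * m))%R).
assert (Pm : (0 < m * m)%R) by nra.
assert (Q : (0 <= 8 * K * K / (m * m))%R) by (apply Rmult_le_pos; [nra|apply Rlt_le, Rinv_0_lt_compat, Pm]).
specialize (B r ltac:(unfold r; lra)).
replace (m * m * r)%R with (m * m * (1 + Cmod z) + 8 * K * K)%R in B by (unfold r; field; lra).
nra.
Qed.

Lemma logmean_le_sup (f : C -> C) (t M : R) : entire f ->
  (forall s, (ln (1 + Csq (f (Cexp (t, s)))) <= M)%R) -> (logmean f t <= 2 * PI * M)%R.
Proof.
intros Hf H. replace (2 * PI * M)%R with (RInt (fun _ => M) 0 (2 * PI)).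
- apply RInt_vertical_le; [now apply ex_RInt_logmean|apply ex_RInt_const|exact H].
- rewrite RInt_const. unfold scal; simpl. unfold mult; simpl. ring.
Qed.

(** The logarithm of a polynomial bound is linear in t, with N only as a coefficient, and 1 + t <= 2
    e^(t/2). *)
Lemma poly_growth_log_growth (q : C -> C) (N : R) : entire q -> (0 <= N)%R ->
  poly_growth N q -> log_growth (/ 2) q.
Proof.
intros Hq HN [K [HK H]]. assert (PP := PI_RGT_0).
assert (L0 : (0 <= ln (1 + K * K))%R) by (apply ln1p_ge_0; nra).
exists (2 * PI * (ln (1 + K * K) + 4 * N))%R. split; [apply Rmult_le_pos; lra|].
intros t Ht. rewrite Rmult_assoc. apply logmean_le_sup; trivial. intros s.
specialize (H (Cexp (t, s))). rewrite Cmod_Cexp in H. change (Re (t, s)) with t in H.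
set (w := q (Cexp (t, s))) in *. assert (Qw := Cmod_ge_0 w).
assert (E1 := exp_ge_1 t Ht). assert (E0 := exp_pos t).
assert (Lt : (0 <= ln (1 + exp t) <= 1 + t)%R).
{ split; [apply ln1p_ge_0; lra|].
  apply Rle_trans with (ln (2 * exp t)); [apply ln_le; lra|].
  rewrite ln_mult, ln_exp by lra. assert (X := ln_le_sub1 2 ltac:(lra)). lra. }
set (X := exp (N * ln (1 + exp t))) in *.
assert (X1 : (1 <= X)%R) by (apply exp_ge_1, Rmult_le_pos; lra).
assert (W : (1 + Csq w <= (1 + K * K) * (X * X))%R).
{ rewrite Csq_Cmod. assert (Cmod w * Cmod w <= (K * X) * (K * X))%R by (apply Rmult_le_compat; trivial).
  assert (1 <= X * X)%R by nra. nra. }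
assert (Y0 := Csq_ge_0 w). assert (W0 : (0 < 1 + Csq w)%R) by lra. assert (LW := ln_le _ _ W0 W).
rewrite !ln_mult in LW by nra. unfold X in LW. rewrite ln_exp in LW.
assert (NL : (N * ln (1 + exp t) <= N * (1 + t))%R) by (apply Rmult_le_compat_l; lra).
assert (Eh := exp_ineq1_le (/ 2 * t)). set (Y := exp (/ 2 * t)) in *.
assert (1 <= Y)%R by lra. assert (N * (1 + t) <= N * (2 * Y))%R by (apply Rmult_le_compat_l; lra).
nra.
Qed.

(** The condition 1/2 <= N lets e^(N t) absorb the additive 1 + t of [logmean_comp_ge]. *)
Lemma log_growth_comp (f g : C -> C) (w1 : C) (N : R) : entire f -> entire g -> C_derive f w1 <> 0 ->
  (/ 2 <= N)%R -> log_growth N (fun z => f (g z)) -> log_growth N g.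
Proof.
intros Hf Hg H0 HN [K [HK H]].
destruct (logmean_comp_ge f g w1 Hf Hg H0) as [M [HM HM']].
exists (M * (2 + K))%R. split; [apply Rmult_le_pos; lra|]. intros t Ht.
eapply Rle_trans; [apply HM', Ht|]. rewrite Rmult_assoc. apply Rmult_le_compat_l; trivial.
specialize (H t Ht).
assert (Eh := exp_ineq1_le (/ 2 * t)).
assert (E2 : (exp (/ 2 * t) <= exp (N * t))%R).
{ assert (X : (/ 2 * t <= N * t)%R) by (apply Rmult_le_compat_r; lra).
  destruct X as [X|X]; [apply Rlt_le, exp_increasing, X|rewrite X; lra]. }
lra.
Qed.

Lemma log_growth_shift (g : C -> C) (w : C) (N : R) : entire g -> (0 <= N)%R ->
  log_growth N g -> log_growth N (fun z => g z - w).
Proof.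
intros Hg HN [K [HK H]]. assert (PP := PI_RGT_0).
assert (Yw := Csq_ge_0 (- w)).
set (c := ln (2 * Csq (- w) + 3)).
assert (Hc : (0 <= c)%R) by (unfold c; rewrite <- ln_1; apply ln_le; lra).
assert (P : (0 <= 2 * PI * c)%R) by (apply Rmult_le_pos; lra).
exists (2 * PI * c + K)%R. split; [lra|]. intros t Ht.
assert (E1 : (1 <= exp (N * t))%R) by (apply exp_ge_1, Rmult_le_pos; lra).
apply Rle_trans with (2 * PI * c + logmean g t)%R; [|specialize (H t Ht); nra].
assert (Hg' : entire (fun z => g z - w)).
{ intros z. destruct (Hg z) as [l Hl]. eexists. apply cder_minus; [exact Hl|apply cder_const]. }
replace (2 * PI * c + logmean g t)%R with (RInt (fun s => c + ln (1 + Csq (g (Cexp (t, s)))))%R 0 (2 * PI)).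
2:{ rewrite (RInt_plus (V := R_CompleteNormedModule) (fun _ => c) (fun s => ln (1 + Csq (g (Cexp (t, s)))))).
    - rewrite RInt_const. unfold plus, scal; simpl. unfold mult; simpl. rewrite Rminus_0_r. reflexivity.
    - apply ex_RInt_const.
    - now apply ex_RInt_logmean. }
apply RInt_vertical_le.
- now apply (ex_RInt_logmean (fun z => g z - w)).
- apply (ex_RInt_plus (V := R_NormedModule) (fun _ => c)); [apply ex_RInt_const|now apply ex_RInt_logmean].
- intros s. set (x := g (Cexp (t, s))).
  assert (Y0 := Csq_ge_0 x). assert (Y1 := Csq_ge_0 (x - w)). assert (Y2 := Csq_plus_le x (- w)).
  change (x + - w) with (x - w) in Y2.
  unfold c. rewrite <- ln_mult by lra. apply ln_le; nra.
Qed.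

Lemma cder_const_affine (f : C -> C) (a : C) : (forall z, cder f z a) -> forall z, f z = a * z + f 0.
Proof.
intros H z. assert (E := cder_zero_const (fun z => f z - a * z)).
specialize (E ltac:(intros w; eapply cder_eq; [apply cder_minus; [apply H|apply cder_mult; [apply cder_const|apply cder_id]]|cbv beta; ring]) z 0).
cbv beta in E. replace (f z) with (f z - a * z + a * z) by ring. rewrite E. ring.
Qed.

(** * The functions [f_ n] *)

Lemma exp_INR (n : nat) (t : R) : (exp t ^ n = exp (INR n * t))%R.
Proof.
induction n as [|n IH]; [simpl; now rewrite Rmult_0_l, exp_0|].
rewrite S_INR. simpl. rewrite IH, <- exp_plus. f_equal. ring.
Qed.

Lemma cder_neg_pow (n : nat) (z : C) : cder (fun z => - z ^ n) z (- (RtoC (INR n) * z ^ pred n)).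
Proof.
eapply cder_eq; [apply cder_opp, cder_pow, cder_id|]. cbv beta. ring.
Qed.

Lemma entire_exp_neg_pow (n : nat) : entire (fun z => Cexp (- z ^ n)).
Proof.
intros z. eexists. apply (cder_comp Cexp (fun z => - z ^ n)); [apply cder_Cexp|apply cder_neg_pow].
Qed.

Lemma cder_f_ (n : nat) (z : C) : cder (f_ n) z (Cexp (- z ^ n)).
Proof. apply (cder_CInt (fun t => Cexp (- t ^ n)) 0 z), entire_exp_neg_pow. Qed.

Lemma f__log_growth (n : nat) : (1 <= n)%nat -> log_growth (INR n) (f_ n).
Proof.
intros Hn. assert (PP := PI_RGT_0).
assert (Hc := cder_entire _ _ (cder_f_ n)).
assert (B : forall z, (Cmod (f_ n z) <= Cmod z * exp (Cmod z ^ n))%R).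
{ intros z. change (f_ n z) with (CI (fun s => Cexp (- (0 + RtoC s * (z - 0)) ^ n) * (z - 0)) 0 1).
  replace (Cmod z * exp (Cmod z ^ n))%R with ((1 - 0) * (Cmod z * exp (Cmod z ^ n)))%R by ring.
  apply Cmod_CI_const; [lra| |].
  - apply ex_CI_cont. intros s _. apply continuous_Cmult; [|apply continuous_const].
    apply (continuous_comp (fun s : R => 0 + RtoC s * (z - 0)) (fun t => Cexp (- t ^ n))).
    + eapply pder_pcont, pder_line.
    + apply entire_ccont, entire_exp_neg_pow.
  - intros s Hs. replace (z - 0) with z by ring. rewrite Cplus_0_l, Cmod_mult, Cmod_Cexp, Rmult_comm.
    apply Rmult_le_compat_l; [apply Cmod_ge_0|].
    assert (X : (Re (- (RtoC s * z) ^ n) <= Cmod z ^ n)%R).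
    { eapply Rle_trans; [apply Rle_abs|]. eapply Rle_trans; [apply re_le_Cmod|].
      rewrite Cmod_opp, Cmod_pow, Cmod_mult, Cmod_R, Rabs_pos_eq by lra.
      assert (P := Cmod_ge_0 z). apply pow_incr. split; [apply Rmult_le_pos; lra|nra]. }
    destruct X as [X|X]; [apply Rlt_le, exp_increasing, X|rewrite X; lra]. }
(* With R0 = |z|^n one has |f_n| <= |z| e^(R0) <= e^(2 R0), so ln (1 + |f_n|^2) <= 1 + 4 R0 <= 5
   R0. *)
exists (2 * PI * 5)%R. split; [lra|]. intros t Ht. rewrite Rmult_assoc. apply logmean_le_sup; trivial.
intros s. specialize (B (Cexp (t, s))). rewrite Cmod_Cexp in B. change (Re (t, s)) with t in B.
rewrite exp_INR in B. assert (E1 := exp_ge_1 t Ht).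
assert (Hn' : (1 <= INR n)%R) by (apply (le_INR 1), Hn).
assert (E2 : (exp t <= exp (INR n * t))%R).
{ assert (X : (t <= INR n * t)%R) by nra. destruct X as [X|X]; [apply Rlt_le, exp_increasing, X|rewrite <- X; lra]. }
set (R0 := exp (INR n * t)) in *. set (x := Cmod (f_ n (Cexp (t, s)))) in *.
assert (Hx : (0 <= x)%R) by apply Cmod_ge_0.
assert (ER := exp_ge_1 R0 ltac:(lra)).
assert (B' : (x <= exp (R0 + R0))%R).
{ rewrite exp_plus. eapply Rle_trans; [exact B|]. apply Rmult_le_compat_r; [lra|].
  assert (Y := exp_ineq1_le R0). lra. }
assert (ER2 := exp_ge_1 (R0 + R0) ltac:(lra)).
rewrite Csq_Cmod. fold x.
apply Rle_trans with (ln (exp 1 * (exp (R0 + R0) * exp (R0 + R0)))).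
- apply ln_le; [nra|]. assert (Y := exp_ineq1_le 1).
  assert (x * x <= exp (R0 + R0) * exp (R0 + R0))%R by (apply Rmult_le_compat; trivial).
  assert (1 <= exp (R0 + R0) * exp (R0 + R0))%R by nra. nra.
- rewrite <- !exp_plus, ln_exp. lra.
Qed.

Lemma pow_0_pred (n : nat) : (2 <= n)%nat -> (0 : C) ^ pred n = 0.
Proof. intros H. destruct n as [|[|n]]; try lia. simpl. ring. Qed.

Lemma f__surjective (n : nat) (w : C) : (2 <= n)%nat -> exists z, f_ n z = w.
Proof.
intros Hn. apply NNPP. intros NE.
assert (Hn0 : (0 <= INR n)%R) by apply pos_INR.
assert (Hc := cder_entire _ _ (cder_f_ n)).
assert (DF : forall z, cder (fun z => f_ n z - w) z (Cexp (- z ^ n))).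
{ intros z. eapply cder_eq; [apply cder_minus; [apply cder_f_|apply cder_const]|ring]. }
assert (HF := cder_entire _ _ DF).
destruct (entire_log _ HF) as [P [HP EP]].
{ intros z E. apply NE. exists z. replace (f_ n z) with (f_ n z - w + w) by ring. rewrite E. ring. }
assert (DP := entire_C_derive P HP).
assert (GP : poly_growth (INR n) P).
{ apply (poly_growth_log (fun z => f_ n z - w)); trivial.
  apply log_growth_shift; trivial. apply f__log_growth. lia. }
set (h := fun z => - z ^ n - P z).
assert (Dh : forall z, cder h z (- (RtoC (INR n) * z ^ pred n) - C_derive P z)).
{ intros z. apply cder_minus; [apply cder_neg_pow|apply DP]. }
assert (EPh : forall z, C_derive P z = Cexp (h z)).
{ intros z. assert (U := cder_unique _ _ _ _ (DF z) (cder_ext _ _ _ _ (fun w => eq_sym (EP w))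
     (cder_comp Cexp P z _ _ (cder_Cexp (P z)) (DP z)))).
  unfold h, Cminus. rewrite Cexp_plus, U, <- Cmult_assoc, (Cmult_comm (Cexp (P z))), Cexp_opp_l. ring. }
assert (Gh : poly_growth (/ 2) h).
{ apply (poly_growth_log_derivative P); [exact (cder_entire _ _ Dh)|lra| |].
  - intros z. rewrite <- EPh. apply DP.
  - now apply (poly_growth_log_growth P (INR n)). }
(* At the origin h' = - n 0^(n-1) - P'(0) must vanish; the power is 0 since n >= 2, while P' = exp h
   never vanishes. *)
assert (Z := cder_unique _ _ _ _ (Dh 0) (liouville_sublinear h (cder_entire _ _ Dh) Gh 0)).
rewrite pow_0_pred, EPh in Z by trivial.
apply (Cexp_neq_0 (h 0)). replace (Cexp (h 0)) with (- (- (RtoC (INR n) * 0) - Cexp (h 0))) by ring.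
rewrite Z. ring.
Qed.

(** * Excluding factorizations *)

Lemma poly_growth_pow (n : nat) : poly_growth (INR n) (fun z => z ^ n).
Proof.
exists 1%R. split; [lra|]. intros z. assert (P := Cmod_ge_0 z).
rewrite <- exp_INR, exp_ln, Cmod_pow, Rmult_1_l by lra. apply pow_incr. lra.
Qed.

Lemma poly_growth_const (c : C) (N : R) : (0 <= N)%R -> poly_growth N (fun _ => c).
Proof.
intros HN. exists (Cmod c). split; [apply Cmod_ge_0|]. intros z.
assert (L := ln1p_Cmod_ge_0 z). assert (E := exp_ge_1 (N * ln (1 + Cmod z)) ltac:(now apply Rmult_le_pos)).
assert (P := Cmod_ge_0 c). nra.
Qed.

Lemma poly_growth_minus (f g : C -> C) (N : R) :
  poly_growth N f -> poly_growth N g -> poly_growth N (fun z => f z - g z).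
Proof.
intros [K [HK H]] [M [HM HM']]. exists (K + M)%R. split; [lra|]. intros z.
eapply Rle_trans; [apply Cmod_triangle|]. rewrite Cmod_opp. specialize (H z). specialize (HM' z). lra.
Qed.

(** A period of [f_ n] is a period of its derivative exp (- z^n) and of the second derivative, which
    is 0 at the origin and nonzero at T. *)
Lemma f__not_periodic (n : nat) (T : C) : (2 <= n)%nat -> T <> 0 ->
  ~ (forall z, f_ n (z + T) = f_ n z).
Proof.
intros Hn HT H.
assert (E1 : forall z, Cexp (- (z + T) ^ n) = Cexp (- z ^ n)).
{ intros z. apply (cder_unique (f_ n) z); [|apply cder_f_].
  apply (cder_ext (fun z => f_ n (z + T))); trivial.
  eapply cder_eq; [apply (cder_comp (f_ n) (fun z => z + T)); [apply cder_f_|apply cder_plus; [apply cder_id|apply cder_const]]|].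
  ring. }
assert (D : forall z, cder (fun z => Cexp (- z ^ n)) z (- (RtoC (INR n) * z ^ pred n) * Cexp (- z ^ n))).
{ intros z. apply (cder_comp Cexp (fun z => - z ^ n)); [apply cder_Cexp|apply cder_neg_pow]. }
assert (D' := cder_ext _ _ _ _ E1 (cder_comp _ (fun z => z + T) 0 _ _ (D (0 + T)) (cder_plus _ _ _ _ _ (cder_id 0) (cder_const T 0)))).
assert (E2 := cder_unique _ _ _ _ D' (D 0)). rewrite pow_0_pred in E2 by trivial.
apply (Cmult_neq_0 (RtoC (INR n)) (T ^ pred n * Cexp (- T ^ n))).
- intros E. apply (f_equal fst) in E. simpl in E. apply (not_0_INR n); [lia|exact E].
- apply Cmult_neq_0; [apply Cpow_nz, HT|apply Cexp_neq_0].
- rewrite Cplus_0_l in E2.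
  transitivity (- ((1 + 0) * (- (RtoC (INR n) * T ^ pred n) * Cexp (- T ^ n)))); [ring|].
  rewrite E2. ring.
Qed.

Lemma f__not_composite (n : nat) : (2 <= n)%nat -> ~ composite (f_ n).
Proof.
intros Hn [_ (f & g & Hf & Hg & Af & Ag & Hc)].
assert (Df := entire_C_derive f Hf). set (f' := C_derive f) in *.
assert (Dg := entire_C_derive g Hg). set (g' := C_derive g) in *.
assert (Hn0 : (0 <= INR n)%R) by apply pos_INR.
assert (Hn1 : (/ 2 <= INR n)%R) by (assert (X := le_INR 2 n Hn); simpl in X; lra).
assert (E : forall z, g' z * f' (g z) = Cexp (- z ^ n)).
{ intros z. apply (cder_unique (f_ n) z); [|apply cder_f_].
  apply (cder_ext (fun z => f (g z))); [intros; symmetry; apply Hc|]. apply (cder_comp f g); trivial. }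
assert (Ng : forall z, g' z <> 0).
{ intros z Z. apply (Cexp_neq_0 (- z ^ n)). rewrite <- E, Z. ring. }
assert (Nf : forall z, f' (g z) <> 0).
{ intros z Z. apply (Cexp_neq_0 (- z ^ n)). rewrite <- E, Z. ring. }
assert (Lg : log_growth (INR n) g).
{ apply (log_growth_comp f g (g 0)); trivial.
  destruct (f__log_growth n ltac:(lia)) as [K [HK H]]. exists K. split; trivial. intros t Ht.
  unfold logmean. rewrite (RInt_ext _ (fun s => ln (1 + Csq (f_ n (Cexp (t, s)))))).
  - now apply H.
  - intros s _. now rewrite Hc. }
assert (Hg' := entire_derivative_entire g g' Dg).
destruct (entire_log g' Hg' Ng) as [h [Hh Eh]].
assert (Dg2 : forall z, cder g z (Cexp (h z))) by (intros z; rewrite <- Eh; apply Dg).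
assert (Dh := entire_C_derive h Hh).
(* The chain rule excludes zeros of f' only on the range of g, so one may still sit at a value that
   g omits. *)
destruct (classic (exists w0, f' w0 = 0)) as [[w0 Hw0]|NZ].
- assert (NV : forall z, g z - w0 <> 0).
  { intros z Z. apply (Nf z). replace (g z) with (g z - w0 + w0) by ring. rewrite Z, Cplus_0_l. exact Hw0. }
  assert (Dgw : forall z, cder (fun z => g z - w0) z (Cexp (h z))).
  { intros z. eapply cder_eq; [apply cder_minus; [apply Dg2|apply cder_const]|ring]. }
  assert (Hgw := cder_entire _ _ Dgw).
  destruct (entire_log _ Hgw NV) as [q [Hq Eq]].
  assert (Dq := entire_C_derive q Hq).
  assert (Gq : poly_growth (INR n) q).
  { apply (poly_growth_log (fun z => g z - w0)); trivial. now apply log_growth_shift. }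
  set (u := fun z => h z - q z).
  assert (Du : forall z, cder u z (C_derive h z - C_derive q z)) by (intros z; apply cder_minus; [apply Dh|apply Dq]).
  assert (Hu := cder_entire _ _ Du).
  assert (Equ : forall z, C_derive q z = Cexp (u z)).
  { intros z. assert (U := cder_unique _ _ _ _ (Dgw z) (cder_ext _ _ _ _ (fun w => eq_sym (Eq w))
       (cder_comp Cexp q z _ _ (cder_Cexp (q z)) (Dq z)))).
    unfold u, Cminus. rewrite Cexp_plus, U, <- Cmult_assoc, (Cmult_comm (Cexp (q z))), Cexp_opp_l. ring. }
  assert (Gu : poly_growth (/ 2) u).
  { apply (poly_growth_log_derivative q); trivial; [lra| |].
    - intros z. rewrite <- Equ. apply Dq.
    - now apply (poly_growth_log_growth q (INR n)). }
  assert (Cu := cder_zero_const u (liouville_sublinear u Hu Gu)).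
  set (a := Cexp (u 0)). assert (Ha : a <> 0) by apply Cexp_neq_0.
  assert (Aq := cder_const_affine q a ltac:(intros z; unfold a; rewrite (Cu 0 z), <- Equ; apply Dq)).
  (* q is affine with slope a, so 2 pi i / a is a period of g = w0 + exp q, hence of f o g. *)
  set (T := (0, 2 * PI)%R * / a : C).
  assert (HT : T <> 0).
  { unfold T. apply Cmult_neq_0.
    - intros X. apply (f_equal snd) in X. simpl in X. assert (PP := PI_RGT_0). lra.
    - intros X. apply (f_equal (Cmult a)) in X. rewrite Cinv_r, Cmult_0_r in X by trivial.
      apply (f_equal fst) in X. simpl in X. lra. }
  apply (f__not_periodic n T Hn HT). intros z. rewrite (Hc (z + T)), (Hc z).
  assert (E1 : forall x, g x = Cexp (a * x + q 0) + w0).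
  { intros x. rewrite <- Aq, <- Eq. ring. }
  assert (E2 : a * (z + T) + q 0 = a * z + q 0 + (0, 2 * PI)%R) by (unfold T; field; exact Ha).
  assert (E3 : Cexp (0, 2 * PI)%R = 1) by (rewrite Cexp_period; apply Cexp_0).
  rewrite (E1 (z + T)), (E1 z), E2, (Cexp_plus (a * z + q 0)), E3, Cmult_1_r. reflexivity.
- assert (Hf' := entire_derivative_entire f f' Df).
  destruct (entire_log f' Hf') as [p [Hp Ep]].
  { intros w Z. apply NZ. now exists w. }
  assert (Dp := entire_C_derive p Hp).
  destruct (classic (exists w1, C_derive p w1 <> 0)) as [[w1 Hw1]|CZ].
  + assert (Gh := poly_growth_log_derivative g h (INR n) Hh Hn0 Dg2 Lg).
    (* The exponents in g' f'(g) = exp (- z^n) agree only modulo 2 pi i; differentiating exp v = 1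
       shows that their difference is constant. *)
    set (v := fun z => h z + p (g z) - - z ^ n).
    assert (Hpg := entire_comp p g Hp Hg).
    assert (Hv : entire v).
    { intros z. destruct (Hpg z) as [l Hl]. eexists. apply cder_minus; [apply cder_plus; [apply Dh|exact Hl]|apply cder_neg_pow]. }
    assert (Dv := entire_C_derive v Hv).
    assert (Ev : forall z, Cexp (v z) = 1).
    { intros z. unfold v, Cminus. rewrite !Cexp_plus, <- Eh, <- Ep, E, Cmult_comm. apply Cexp_opp_l. }
    assert (Zv : forall z, cder v z 0).
    { intros z. replace (RtoC 0) with (C_derive v z); [apply Dv|].
      assert (U := cder_unique _ _ _ _ (cder_ext _ _ _ _ Ev (cder_comp Cexp v z _ _ (cder_Cexp (v z)) (Dv z))) (cder_const 1 z)).
      rewrite Ev, Cmult_1_r in U. exact U. }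
    assert (Cv := cder_zero_const v Zv).
    assert (Gp : poly_growth (INR n) (fun z => p (g z))).
    { destruct (poly_growth_minus _ _ _ (poly_growth_minus _ _ _ (poly_growth_const (v 0) _ Hn0) Gh) (poly_growth_pow n)) as [K [HK H]].
      exists K. split; trivial. intros z. specialize (H z). cbv beta in H. rewrite (Cv 0 z) in H.
      replace (v z - h z - z ^ n) with (p (g z)) in H by (unfold v; ring). exact H. }
    (* The composition bound is used a second time, now with p as outer function: the polynomial
       bound on p o g lowers the exponent for g from n to 1/2. *)
    assert (Lg2 : log_growth (/ 2) g).
    { apply (log_growth_comp p g w1); trivial; [lra|]. now apply (poly_growth_log_growth _ (INR n)). }
    assert (Gh2 := poly_growth_log_derivative g h (/ 2) Hh ltac:(lra) Dg2 Lg2).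
    assert (Ch := cder_zero_const h (liouville_sublinear h Hh Gh2)).
    apply Ag. exists (Cexp (h 0)), (g 0). split; [apply Cexp_neq_0|].
    apply cder_const_affine. intros z. rewrite (Ch 0 z). apply Dg2.
  + assert (Cp := cder_zero_const p).
    specialize (Cp ltac:(intros z; replace (RtoC 0) with (C_derive p z); [apply Dp|apply NNPP; intros X; apply CZ; now exists z])).
    apply Af. exists (Cexp (p 0)), (f 0). split; [apply Cexp_neq_0|].
    apply cder_const_affine. intros z. rewrite (Cp 0 z), <- Ep. apply Df.
Qed.

Theorem corollary7p14 :
  forall k : nat, (1 <= k)%nat ->
    (elh (f_ (2 * k)) /\ ~ AutC (f_ (2 * k))) /\
    (forall w : C, exists z : C, f_ (2 * k) z = w) /\
    prime (f_ (2 * k)).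
Proof.
intros k Hk. set (n := (2 * k)%nat). assert (Hn : (2 <= n)%nat) by (unfold n; lia).
assert (D : forall z, C_derive (f_ n) z = Cexp (- z ^ n)) by (intros z; apply is_C_derive_unique, cder_f_).
assert (Helh : elh (f_ n)).
{ split; [exact (cder_entire _ _ (cder_f_ n))|]. split.
  - intros z. rewrite D. apply Cexp_neq_0.
  - rewrite D. replace (- 0 ^ n) with (RtoC 0); [apply Cexp_0|].
    destruct n; [lia|]. simpl. ring. }
assert (HAut : ~ AutC (f_ n)).
{ intros [a Ha].
  (* A translation has derivative 1 everywhere, whereas the derivative at 1 is exp (-1); the
     argument parses as minus 1^n. *)
  assert (E : Cexp (- 1 ^ n) = 1).
  { apply (cder_unique (f_ n) 1); [apply cder_f_|]. apply (cder_ext (fun z => z + a)); [intros; symmetry; apply Ha|].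
    eapply cder_eq; [apply cder_plus; [apply cder_id|apply cder_const]|ring]. }
  rewrite Cpow_1_l in E. apply (f_equal Cmod) in E. rewrite Cmod_Cexp, Cmod_1 in E.
  assert (X : (exp (Re (- (1))) < exp 0)%R) by (apply exp_increasing; simpl; lra).
  rewrite exp_0 in X. lra. }
repeat split; trivial; try apply Helh.
- intros w. now apply f__surjective.
- now apply f__not_composite.
Qed.
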